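(* Let $\Lambda$ be a constrained Willmore surface in $S^n$ with multiplier $q$ and let $(V,d^\lambda)$ be its $2$-perturbed harmonic central sphere congruence. Let $r$ be a dressing gauge for $(V,d^\lambda)$, let $(\hat V,\hat d^\lambda)$ be the dressing transform of $(V,d^\lambda)$ by $r$, and define $$\hat\Lambda=r(0)\Lambda^{1,0}\cap r(\infty)\Lambda^{0,1},\qquad \hat q=\mathrm{Ad}_{r(\infty)}q^{1,0}+\mathrm{Ad}_{r(0)}q^{0,1}.$$ Then, on the open set where $\hat\Lambda$ immerses, $\hat\Lambda$ is conformal and is a constrained Willmore surface with multiplier $\hat q$ and central sphere congruence $\hat V$.
   Context: Setting. $\Sigma$ is a Riemann surface. $\mathbb{R}^{n+1,1}$ is Lorentzian space with inner product $(\,,\,)$ and light-cone $\mathcal{L}$; $\mathbb{C}^{n+2}=\mathbb{R}^{n+1,1}\otimes\mathbb{C}$ carries the complex bilinear extension of $(\,,\,)$ and the complex conjugation with fixed set $\mathbb{R}^{n+1,1}$. Underlining denotes the trivial bundle over $\Sigma$, and $d$ is the trivial connection. Subbundles are complex and not distinguished from their complexifications; a subbundle is real if stable under conjugation. $\wedge^2\mathbb{C}^{n+2}\cong\mathfrak{o}(\mathbb{C}^{n+2})$ via $(u\wedge v)(w)=(u,w)v-(v,w)u$. A bundle of $(3,1)$-planes is a real non-degenerate rank $4$ subbundle $V$ with $V\cap\underline{\mathbb{R}}^{n+1,1}$ of signature $(3,1)$; $\rho_V$ is reflection across $V$ ($+1$ on $V$, $-1$ on $V^\perp$). Gauge action: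 $g\cdot\nabla=g\circ\nabla\circ g^{-1}$. For $\lambda\in\mathbb{P}^1$, $\lambda^*=1/\bar\lambda$. Surfaces. $S^n\cong\mathbb{P}(\mathcal{L})$ as conformal manifolds. A map $\Lambda:\Sigma\to\mathbb{P}(\mathcal{L})$ is viewed as a real null line subbundle $\Lambda\leq\underline{\mathbb{C}}^{n+2}$. For a lift (section) $\sigma$ of $\Lambda$, set $\Lambda^{(1)}=\langle\sigma,d\sigma(T\Sigma)\rangle$, $\Lambda^{1,0}=\langle\sigma,d\sigma(T^{1,0}\Sigma)\rangle$, $\Lambda^{0,1}=\langle\sigma,d\sigma(T^{0,1}\Sigma)\rangle$ (independent of $\sigma$). $\Lambda$ is an immersion iff $\Lambda^{(1)}$ has rank $3$, and an immersion is conformal iff $\Lambda^{1,0}$ is isotropic. The central sphere congruence of a conformal immersion $\Lambda$ is the bundle of $(3,1)$-planes $V=\Lambda^{(1)}\oplus\langle\Delta\sigma\rangle$, with $\Delta$ the Laplacian of the metric $(d\sigma,d\sigma)$. Any bundle $V$ of $(3,1)$-planes gives $d=\mathcal{D}_V+\mathcal{N}_V$ with $V,V^\perp$ $\mathcal{D}_V$-parallel and $\mathcal{N}_V\in\Omega^1(V\wedge V^\perp)$. A conformal immersion $\Lambda$ is constrained Willmore with multiplier $q$ if $q\in\Omega^1(\Lambda\wedge\Lambda^{(1)})$ is real with $d^{\mathcal{D}_V}q=0$ and $d^{\mathcal{D}_V}{*}\mathcal{N}_V=2[q\wedge*\mathcal{N}_V]$. Then $$d^\lambda=\mathcal{D}_V+\lambda\mathcal{N}_V^{1,0}+\lambda^{-1}\mathcal{N}_V^{0,1}+(\lambda^2-1)q^{1,0}+(\lambda^{-2}-1)q^{0,1}$$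 is flat for all $\lambda\in\mathbb{C}^\times$, and ''the $2$-perturbed harmonic central sphere congruence'' of $\Lambda$ means $(V,d^\lambda)$ with this $d^\lambda$ ($q=0$ is allowed). Dressing gauge. A dressing gauge for $(V,d^\lambda)$ is a family of gauge transformations $\lambda\mapsto r(\lambda)\in\Gamma\mathrm{O}(\underline{\mathbb{C}}^{n+2})$, defined for $\lambda\in\mathrm{dom}(r)\subset\mathbb{P}^1$ (with $\mathrm{dom}(r)$ containing neighbourhoods of $0,\infty$ and stable under $\lambda\mapsto-\lambda$ and $\lambda\mapsto\pm\lambda^*$), holomorphic in $\lambda$ near $0$ and $\infty$, such that: (i) $r(-\lambda)\circ\rho_V\circ r(\lambda)^{-1}$ is independent of $\lambda\in\mathrm{dom}(r)$; (ii) $r(\lambda^* )=\overline{r(\lambda)}$ for all $\lambda\in\mathrm{dom}(r)$; (iii) the connections $r(\lambda)\cdot d^\lambda$ extend from $\mathrm{dom}(r)\setminus\{0,\infty\}$ to a holomorphic family of connections $\hat d^\lambda$ on $\mathbb{C}^\times$ with $\hat d^1=d$; (iv) $\det(r(0)^{-1}r(\infty)|_V)=1$ (it follows from (i) that $r(0)V=r(\infty)V$). The dressing transform of $(V,d^\lambda)$ by $r$ is $(\hat V,\hat d^\lambda)$ with $\hat V=r(0)V$. (It is known that $\hat V$ is a bundle of $(3,1)$-planes and that $\hat\Lambda$ is a real null line subbundle.) *)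

(* Defs.v *)
From HB Require Import structures.
From mathcomp Require Import all_boot all_order all_algebra.
From mathcomp Require Import all_classical all_reals.
From mathcomp Require Import topology normedtype derive.
From mathcomp Require Import complex.

Set Implicit Arguments.
Unset Strict Implicit.
Unset Printing Implicit Defensive.

Import Order.TTheory GRing.Theory Num.Theory.
Import numFieldNormedType.Exports.

Local Open Scope classical_set_scope.
Local Open Scope ring_scope.

(* R[i] through its field structure: unlike the bare type R[i], this carries
   the topology and the normed-module structure of a numFieldType. *)
Definition Cplx (R : realType) : numClosedFieldType := R[i].

Definition realC (R : realType) (x : R) : Cplx R := (x%:C)%C.

Definition ReC (R : realType) (z : Cplx R) : R := complex.Re (z : R[i]).
Definition ImC (R : realType) (z : Cplx R) : R := complex.Im (z : R[i]).

(* A Hausdorff space with a holomorphic atlas.  Chart [i] is the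
   homeomorphism [rs_z i] from [rs_dom i] onto an open subset of the plane,
   with inverse [rs_zinv i]; the values of [rs_z i] off [rs_dom i] and of
   [rs_zinv i] off the image are irrelevant.  Neither connectedness nor second
   countability is imposed. *)
Record riemannSurface (R : realType) := RiemannSurface {
  rs_carrier :> topologicalType;
  rs_idx : Type;
  rs_dom : rs_idx -> set rs_carrier;
  rs_z : rs_idx -> rs_carrier -> Cplx R;
  rs_zinv : rs_idx -> Cplx R -> rs_carrier;
  rs_hausdorff : hausdorff_space rs_carrier;
  rs_cover : forall p, exists i, rs_dom i p;
  rs_open_dom : forall i, open (rs_dom i);
  rs_open_img : forall i, open (rs_z i @` rs_dom i);
  rs_zK : forall i p, rs_dom i p -> rs_zinv i (rs_z i p) = p;
  rs_z_cont : forall i p, rs_dom i p -> {for p, continuous (rs_z i)};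
  rs_zinv_cont : forall i w,
    (rs_z i @` rs_dom i) w -> {for w, continuous (rs_zinv i)};
  rs_holo : forall i j p, rs_dom i p -> rs_dom j p ->
    derivable (fun w : Cplx R => rs_z j (rs_zinv i w)) (rs_z i p) 1
}.

Section Calculus.
Variables (R : realType) (S : riemannSurface R).
Local Notation C := (Cplx R).

Definition chart_at (p : S) : rs_idx S := projT1 (cid (rs_cover p)).

(* [f] along the coordinate line of chart [i] through [p] with direction [v] *)
Definition coord_line (i : rs_idx S) (v : C) (f : S -> C) (p : S) (t : R) : C :=
  f (rs_zinv i (rs_z i p + realC t * v)).

Definition has_pd (i : rs_idx S) (v : C) (f : S -> C) (p : S) : Prop :=
  derivable (fun t : R => ReC (coord_line i v f p t)) 0 1 /\
  derivable (fun t : R => ImC (coord_line i v f p t)) 0 1.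

Definition pd (i : rs_idx S) (v : C) (f : S -> C) (p : S) : C :=
  realC (derive1 (fun t : R => ReC (coord_line i v f p t)) 0) +
  'i * realC (derive1 (fun t : R => ImC (coord_line i v f p t)) 0).

(* With z = x + 'i y: [false] stands for the direction of x, [true] for y. *)
Definition dir (b : bool) : C := if b then 'i else 1.

Definition pds (i : rs_idx S) (s : seq bool) (f : S -> C) : S -> C :=
  foldr (fun b g => pd i (dir b) g) f s.

Definition smooth (W : set S) (f : S -> C) : Prop :=
  forall i (s : seq bool) p, W p -> rs_dom i p ->
    (forall b, has_pd i (dir b) (pds i s f) p) /\
    {for p, continuous (pds i s f)}.

(* A holomorphic map from [Om] to the space of smooth functions on [W]: all
   derivatives along [S] exist, are jointly continuous, and are holomorphic in
   the parameter. *)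
Definition hol_family (Om : set C) (W : set S) (f : C -> S -> C) : Prop :=
  forall i (s : seq bool) l p, Om l -> W p -> rs_dom i p ->
    [/\ forall b, has_pd i (dir b) (pds i s (f l)) p,
        {for (l, p), continuous (fun x : C * S => pds i s (f x.1) x.2)} &
        derivable (fun m : C => pds i s (f m) p) l 1].

Definition dz (i : rs_idx S) (f : S -> C) (p : S) : C :=
  (pd i 1 f p - 'i * pd i 'i f p) / 2.
Definition dzb (i : rs_idx S) (f : S -> C) (p : S) : C :=
  (pd i 1 f p + 'i * pd i 'i f p) / 2.

Section MatrixValued.
Variables m k : nat.
Implicit Types F : S -> 'M[C]_(m, k).

Definition mx_smooth (W : set S) F : Prop :=
  forall a b, smooth W (fun p => F p a b).
Definition mx_hol_family (Om : set C) (W : set S) (F : C -> S -> 'M[C]_(m, k)) :=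
  forall a b, hol_family Om W (fun l p => F l p a b).
Definition mx_pd (i : rs_idx S) (v : C) F (p : S) : 'M[C]_(m, k) :=
  \matrix_(a, b) pd i v (fun x => F x a b) p.
Definition mx_dz (i : rs_idx S) F (p : S) : 'M[C]_(m, k) :=
  \matrix_(a, b) dz i (fun x => F x a b) p.
Definition mx_dzb (i : rs_idx S) F (p : S) : 'M[C]_(m, k) :=
  \matrix_(a, b) dzb i (fun x => F x a b) p.

(* Complex matrix-valued 1-forms: in chart [i], [al i p] is the pair (a, b)
   with al = a dz + b dzbar at [p]; only the values on [rs_dom i] matter. *)
Definition form1 := (rs_idx S -> S -> 'M[C]_(m, k) * 'M[C]_(m, k))%type.

(* [dz i (rs_z j)] is the derivative of the (holomorphic) transition map. *)
Definition is_form (W : set S) (al : form1) : Prop :=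
  [/\ forall i, mx_smooth (W `&` rs_dom i) (fun p => (al i p).1),
      forall i, mx_smooth (W `&` rs_dom i) (fun p => (al i p).2) &
      forall i j p, W p -> rs_dom i p -> rs_dom j p ->
        (al i p).1 = dz i (rs_z j) p *: (al j p).1 /\
        (al i p).2 = (dz i (rs_z j) p)^* *: (al j p).2].

Definition real_form (W : set S) (al : form1) : Prop :=
  forall i p, W p -> rs_dom i p ->
    (al i p).2 = map_mx Num.conj (al i p).1.

Definition form_in (W : set S) (E : S -> {vspace 'M[C]_(m, k)}) (al : form1) :=
  forall i p, W p -> rs_dom i p -> (al i p).1 \in E p /\ (al i p).2 \in E p.

Definition form10 (al : form1) : form1 := fun i p => ((al i p).1, 0).
Definition form01 (al : form1) : form1 := fun i p => (0, (al i p).2).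

Definition hodge (al : form1) : form1 :=
  fun i p => (- 'i *: (al i p).1, 'i *: (al i p).2).

(* 2-forms, by their coefficient of dz /\ dzbar *)
Definition form2 := (rs_idx S -> S -> 'M[C]_(m, k))%type.

Definition eq_form2 (W : set S) (a b : form2) : Prop :=
  forall i p, W p -> rs_dom i p -> a i p = b i p.

Definition ext_d (al : form1) : form2 := fun i p =>
  mx_dz i (fun x => (al i x).2) p - mx_dzb i (fun x => (al i x).1) p.

End MatrixValued.

Section EndValued.
Variable m : nat.
Implicit Types (A al be : form1 m m) (g : S -> 'M[C]_m).

Definition lie (a b : 'M[C]_m) : 'M[C]_m := a *m b - b *m a.

(* [al /\ be](X, Y) = [al X, be Y] - [al Y, be X] *)
Definition wedge_lie al be : form2 m m := fun i p =>
  lie (al i p).1 (be i p).2 - lie (al i p).2 (be i p).1.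

(* exterior derivative coupled to the connection d + A acting on
   endomorphisms *)
Definition cov_d A al : form2 m m := ext_d al + wedge_lie A al.

Definition Ad_form g al : form1 m m := fun i p =>
  (g p *m (al i p).1 *m invmx (g p), g p *m (al i p).2 *m invmx (g p)).

Definition connection := ((S -> 'cV[C]_m) -> form1 m 1)%type.

Definition nabla A : connection := fun s i p =>
  (mx_dz i s p + (A i p).1 *m s p, mx_dzb i s p + (A i p).2 *m s p).

Definition gauge g (D : connection) : connection := fun s i p =>
  let w := D (fun x => invmx (g x) *m s x) i p in (g p *m w.1, g p *m w.2).

Definition eq_connection (D D' : connection) : Prop :=
  forall (O : set S) (s : S -> 'cV[C]_m), open O -> mx_smooth O s ->
    forall i p, O p -> rs_dom i p -> D s i p = D' s i p.

End EndValued.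
End Calculus.

Section Lorentz.
Variables (R : realType) (n : nat).
Local Notation C := (Cplx R).
Local Notation vec := 'cV[C]_(n.+2).
Local Notation End := 'M[C]_(n.+2).
Implicit Types (u v w : vec) (U V : {vspace vec}).

(* n.+1 plus signs, one minus sign *)
Definition gram : End := diag_mx (\row_j (if j == ord_max then -1 else 1)).

Definition ip u v : C := (u^T *m gram *m v) 0 0.

Definition conjv u : vec := map_mx Num.conj u.

Definition orthogonal_mx (g : End) : Prop := g^T *m gram *m g = gram.

Definition isotropic U : Prop := forall u v, u \in U -> v \in U -> ip u v = 0.

(* common kernel of the forms (b, -), for b in a basis of U *)
Definition perp U : {vspace vec} :=
  (\bigcap_(b <- vbasis U) lker (linfun (mulmx (b^T *m gram))))%VS.

(* matrix of w |-> (u, w) v - (v, w) u *)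
Definition wedge u v : End := v *m (u^T *m gram) - u *m (v^T *m gram).

Definition wedge_sp U V : {vspace End} :=
  <<[seq wedge u v | u <- vbasis U, v <- vbasis V]>>%VS.

Definition mx_image (g : End) U : {vspace vec} := (linfun (mulmx g) @: U)%VS.

Definition reflection U : 'End(vec) :=
  (daddv_pi U (perp U) - daddv_pi (perp U) U)%R.

(* determinant of the restriction to U of an endomorphism g preserving U *)
Definition det_on U (g : End) : C :=
  \det (\matrix_(i < \dim U, j < \dim U)
          coord (vbasis U) i (g *m (vbasis U)`_j)).

End Lorentz.

Section Surfaces.
Variables (R : realType) (S : riemannSurface R) (n : nat).
Local Notation C := (Cplx R).
Local Notation vec := 'cV[C]_(n.+2).
Local Notation End := 'M[C]_(n.+2).
Local Notation bundle := (S -> {vspace vec}).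
Implicit Types (W O : set S) (L V : bundle) (sg : S -> vec) (p : S).

(* real light-cone-valued section spanning L over O *)
Definition is_lift O L sg : Prop :=
  mx_smooth O sg /\
  forall p, O p ->
    [/\ conjv (sg p) = sg p, sg p != 0, ip (sg p) (sg p) = 0 &
        L p = <[sg p]>%VS].

Definition is_lift_near p L sg : Prop :=
  exists O, [/\ open O, O p & is_lift O L sg].

(* L is, over W, a smooth map into the projectivised light-cone, i.e. a real
   null line subbundle *)
Definition null_line_bundle W L : Prop :=
  forall p, W p -> exists sg, is_lift_near p L sg.

(* some lift of L near p; the zero section if there is none *)
Definition lift_near L p : S -> vec := xget (fun=> 0) (is_lift_near p L).

(* The bundles below depend neither on the lift nor on the chart used. *)
Definition Lam1 L : bundle := fun p =>
  let sg := lift_near L p in let i := chart_at p in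
  <<[:: sg p; mx_dz i sg p; mx_dzb i sg p]>>%VS.
Definition Lam10 L : bundle := fun p =>
  let sg := lift_near L p in let i := chart_at p in
  <<[:: sg p; mx_dz i sg p]>>%VS.
Definition Lam01 L : bundle := fun p =>
  let sg := lift_near L p in let i := chart_at p in
  <<[:: sg p; mx_dzb i sg p]>>%VS.

Definition immerses_at L p : Prop := \dim (Lam1 L p) = 3.

Definition conformal_immersion W L : Prop :=
  null_line_bundle W L /\
  forall p, W p -> immerses_at L p /\ isotropic (Lam10 L p).

(* Beltrami's formula, in chart i, for the Laplacian applied to sg of the
   metric (d sg, d sg) = E dx^2 + 2 F dx dy + G dy^2 *)
Definition laplacian (i : rs_idx S) sg : S -> vec :=
  let sx := mx_pd i 1 sg in
  let sy := mx_pd i 'i sg in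
  let E p := ip (sx p) (sx p) in
  let F p := ip (sx p) (sy p) in
  let G p := ip (sy p) (sy p) in
  let w p := realC (Num.sqrt (ReC (E p * G p - F p ^+ 2))) in
  fun p => (w p)^-1 *:
    (mx_pd i 1 (fun x => (w x)^-1 *: (G x *: sx x - F x *: sy x)) p +
     mx_pd i 'i (fun x => (w x)^-1 *: (E x *: sy x - F x *: sx x)) p).

Definition central_sphere L : bundle := fun p =>
  (Lam1 L p + <[laplacian (chart_at p) (lift_near L p) p]>)%VS.

Definition is_section O V sg : Prop :=
  mx_smooth O sg /\ forall p, O p -> sg p \in V p.

Definition parallel W V (A : form1 S n.+2 n.+2) : Prop :=
  forall O sg, open O -> O `<=` W -> is_section O V sg ->
    form_in O V (nabla A sg).

(* N = N_V: the trivial connection is d = D_V + N with D_V = d - N *)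
Definition splitting W V (N : form1 S n.+2 n.+2) : Prop :=
  [/\ is_form W N,
      form_in W (fun p => wedge_sp (V p) (perp (V p))) N,
      parallel W V (- N) &
      parallel W (fun p => perp (V p)) (- N)].

Definition constrained_Willmore W L (q : form1 S n.+2 n.+2) : Prop :=
  [/\ conformal_immersion W L,
      is_form W q /\ real_form W q,
      form_in W (fun p => wedge_sp (L p) (Lam1 L p)) q &
      exists2 N, splitting W (central_sphere L) N &
        eq_form2 W (cov_d (- N) q) 0 /\
        eq_form2 W (cov_d (- N) (hodge N)) (2 *: wedge_lie q (hodge N))].

(* connection form of
   d^l = D_V + l N^{1,0} + l^-1 N^{0,1} + (l^2 - 1) q^{1,0} + (l^-2 - 1) q^{0,1} *)
Definition perturbed_form (N q : form1 S n.+2 n.+2) (l : C) :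
    form1 S n.+2 n.+2 :=
  - N + l *: form10 N + l^-1 *: form01 N
  + (l ^+ 2 - 1) *: form10 q + (l ^- 2 - 1) *: form01 q.

(* The Riemann sphere; [None] is the point at infinity. *)
Definition P1 := option C.
Definition P1inv (l : P1) : P1 :=
  if l is Some z then (if z == 0 then None else Some z^-1) else Some 0.
Definition P1opp (l : P1) : P1 := omap (fun z : C => - z) l.
Definition P1star (l : P1) : P1 := P1inv (omap (fun z : C => z^*) l).

Implicit Types (dom : set P1) (r : P1 -> S -> End).

Definition holomorphic_near0 dom r : Prop :=
  exists Om : set C,
    [/\ open Om, Om 0, forall l, Om l -> dom (Some l) &
        mx_hol_family Om setT (fun l => r (Some l))].

(* [fun l => r (P1inv l)] near 0 is [r] near infinity. *)
Definition holomorphic_nearoo dom r : Prop :=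
  holomorphic_near0 (fun l => dom (P1inv l)) (fun l => r (P1inv l)).

(* [A l] is the connection form of d^l. *)
Record dressing_gauge V (A : C -> form1 S n.+2 n.+2) dom r : Prop := {
  dg_near0 : holomorphic_near0 dom r;
  dg_nearoo : holomorphic_nearoo dom r;
  dg_dom_opp : forall l, dom l -> dom (P1opp l);
  dg_dom_star : forall l, dom l ->
    dom (P1star l) /\ dom (P1opp (P1star l));
  dg_smooth : forall l, dom l -> mx_smooth setT (r l);
  dg_orthogonal : forall l p, dom l -> orthogonal_mx (r l p);
  dg_twist : forall l m p w, dom l -> dom m ->
    r (P1opp l) p *m reflection (V p) (invmx (r l p) *m w) =
    r (P1opp m) p *m reflection (V p) (invmx (r m p) *m w);
  dg_real : forall l p, dom l -> r (P1star l) p = map_mx Num.conj (r l p);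
  dg_extend : exists Ah : C -> form1 S n.+2 n.+2,
    [/\ forall l, l != 0 -> is_form setT (Ah l),
        forall i, let Cx := [set l : C | l != 0] in
          mx_hol_family Cx (rs_dom i) (fun l p => (Ah l i p).1) /\
          mx_hol_family Cx (rs_dom i) (fun l p => (Ah l i p).2),
        forall l, l != 0 -> dom (Some l) ->
          eq_connection (gauge (r (Some l)) (nabla (A l))) (nabla (Ah l)) &
        eq_connection (nabla (Ah 1)) (nabla 0)];
  dg_det : forall p, det_on (V p) (invmx (r (Some 0) p) *m r None p) = 1
}.

End Surfaces.

(* Main.v *)
(* In a chart, write n, m for the dz- and dzbar-parts of N, u, v for those of q, and
   A(l) for the dz-part of the dressed connection r(l) . d^l.  It is holomorphic on C^*,
   extends to l = 0 because r is holomorphic there, and l^2 A(1/l) extends to l = 0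
   because r is holomorphic at infinity; so A is a quadratic polynomial whose leading
   coefficient is Ad_{r(oo)} u, and A(1) = 0 gives A(l) = - n' + l n' + (l^2 - 1) u'.
   The dzbar-part is handled in the same way after l |-> 1/l, so the dressed family has
   the shape of the original one.

   The symmetry r(-l) o rho_V o r(l)^-1 = const makes n' anticommute with the reflection in
   Vhat = r(0)V, so n', m' are the components of N_Vhat.  Comparing the order-one poles at
   the other end shows that n' kills r(oo) Lambda^{0,1}, hence for a lift s of Lhat
   the derivative s_z is a section of r(0) Lambda^{1,0}: Lhat is conformal where it
   immerses, and s, s_z, s_zzbar and s_zbar span Vhat.  Finally the flatness of the dressed
   family for small l, expanded in powers of l, yields the two constrained Willmore
   equations up to the term [u', v'], which vanishes since u' and v' are multiples of
   s /\ s_zbar and s /\ s_z. *)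
Require Import Defs.
From HB Require Import structures.
From mathcomp Require Import all_boot all_order all_algebra.
From mathcomp Require Import all_classical all_reals.
From mathcomp Require Import topology normedtype derive.
From mathcomp Require Import complex ring lra.
From mathcomp Require Import sequences realfun exp trigo measure.
From mathcomp Require Import lebesgue_measure lebesgue_integral ftc.
Set Implicit Arguments.
Unset Strict Implicit.
Unset Printing Implicit Defensive.
Import Order.TTheory GRing.Theory Num.Theory.
Import numFieldNormedType.Exports.
Local Open Scope classical_set_scope.
Local Open Scope ring_scope.

(** That a family with the stated behaviour at both ends is quadratic rests on one comparison: a
    function holomorphic on the punctured plane with limits at 0 and at infinity has equal limits.
    Pulled back by the exponential, this is Goursat's theorem on a rectangle of height 2 pi.
    Difference quotients of the family minus its quadratic part then tend to the derivative at one
    end and to 0 at the other.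

    The definition of a constrained Willmore surface only gives the two equations for q and N, so
    the flatness of the original family has to be derived. Closedness of q must be split into its
    (1,0)- and (0,1)-parts; this forces q^{1,0} into Lambda /\ Lambda^{0,1} and makes the two parts
    of q commute.

    The derivative s_z is located by evaluating the dressed family at l = 0: d_z - n' - u' is the
    conjugate by r(0) of d_z - n - u, an operator that preserves Lambda^{1,0}, and n', u' kill s.

    A boolean stands throughout for the choice between dz with l and dzbar with 1/l, so each
    argument is made once for both ends. *)

Section ComplexBasics.
Variable R : realType.
Local Notation C := (Cplx R).
Implicit Types (x y : R) (z w : C).

Lemma Ceq z w : ReC z = ReC w -> ImC z = ImC w -> z = w.
Proof. by case: z w => [a b] [c d] /= -> ->. Qed.

Lemma ReCD z w : ReC (z + w) = ReC z + ReC w.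
Proof. by case: z w => [a b] [c d]. Qed.
Lemma ImCD z w : ImC (z + w) = ImC z + ImC w.
Proof. by case: z w => [a b] [c d]. Qed.
Lemma ReCN z : ReC (- z) = - ReC z.
Proof. by case: z. Qed.
Lemma ImCN z : ImC (- z) = - ImC z.
Proof. by case: z. Qed.
Lemma ReCM z w : ReC (z * w) = ReC z * ReC w - ImC z * ImC w.
Proof. by case: z w => [a b] [c d]. Qed.
Lemma ImCM z w : ImC (z * w) = ReC z * ImC w + ImC z * ReC w.
Proof. by case: z w => [a b] [c d]. Qed.
Lemma ReCr x : ReC (realC x) = x. Proof. by []. Qed.
Lemma ImCr x : ImC (realC x) = 0. Proof. by []. Qed.
Lemma ReCi : ReC ('i : C) = 0.
Proof. by rewrite /ReC /Cplx -complexiE. Qed.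
Lemma ImCi : ImC ('i : C) = 1.
Proof. by rewrite /ImC /Cplx -complexiE. Qed.
Lemma ReC0 : ReC (0 : C) = 0. Proof. by []. Qed.
Lemma ImC0 : ImC (0 : C) = 0. Proof. by []. Qed.
Lemma ReC1 : ReC (1 : C) = 1. Proof. by []. Qed.
Lemma ImC1 : ImC (1 : C) = 0. Proof. by []. Qed.
Lemma conjCE z : z^* = ((z : R[i])^*)%C.
Proof.
case: (z) => [a b].
have e : ((a +i* b)%C : C) = realC a + 'i * realC b.
  by apply: Ceq; rewrite !(ReCD, ImCD, ReCM, ImCM, ReCi, ImCi) /=; ring.
rewrite e rmorphD rmorphM /= conjCi !conj_Creal ?complex_real ?eqxx //=.
by apply: Ceq; rewrite !(ReCD, ImCD, ReCM, ImCM, ReCN, ImCN, ReCi, ImCi) /=; ring.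
Qed.
Lemma ReC_conj z : ReC z^* = ReC z.
Proof. by rewrite conjCE; case: z. Qed.
Lemma ImC_conj z : ImC z^* = - ImC z.
Proof. by rewrite conjCE; case: z. Qed.

Definition CcompE := (ReCD, ImCD, ReCN, ImCN, ReCM, ImCM, ReCr, ImCr, ReCi, ImCi,
  ReC0, ImC0, ReC1, ImC1, ReC_conj, ImC_conj).

Lemma Cdecomp z : z = realC (ReC z) + 'i * realC (ImC z).
Proof. by apply: Ceq; rewrite !CcompE; ring. Qed.

Lemma realCD x y : realC (x + y) = realC x + realC y.
Proof. by apply: Ceq; rewrite !CcompE; ring. Qed.
Lemma realCN x : realC (- x) = - realC x.
Proof. by apply: Ceq; rewrite !CcompE; ring. Qed.
Lemma realCM x y : realC (x * y) = realC x * realC y.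
Proof. by apply: Ceq; rewrite !CcompE; ring. Qed.
Lemma realC0 : realC 0 = 0 :> C. Proof. by []. Qed.
Lemma realCn n : realC n%:R = n%:R :> C.
Proof. exact: (rmorph_nat (real_complex R)). Qed.
Lemma realC_inj : injective (@realC R).
Proof. by move=> x y /(congr1 (@ReC R)). Qed.
Lemma realC_eq0 x : (realC x == 0) = (x == 0).
Proof. by rewrite -realC0 (inj_eq realC_inj). Qed.
Lemma realCV x : realC x^-1 = (realC x)^-1.
Proof. by rewrite /realC; exact: (fmorphV (real_complex R)). Qed.
Lemma sqri : 'i * 'i = -1 :> C. Proof. by rewrite -expr2 sqrCi. Qed.

(** The norm of [Cplx R] takes values in [Cplx R]; this equivalent one is real, so estimates become
    goals for [lra]. It is submultiplicative but not multiplicative, hence the constant 4 in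
    [norm1V]. *)
Definition norm1 z : R := (`|ReC z| : R) + (`|ImC z| : R).

Lemma norm1_ge0 z : 0 <= norm1 z. Proof. exact: addr_ge0. Qed.
Lemma norm1D z w : norm1 (z + w) <= norm1 z + norm1 w.
Proof.
rewrite /norm1 !CcompE.
by have := ler_normD (ReC z) (ReC w); have := ler_normD (ImC z) (ImC w); lra.
Qed.
Lemma norm1N z : norm1 (- z) = norm1 z.
Proof. by rewrite /norm1 !CcompE !normrN. Qed.
Lemma norm1B z w : norm1 (z - w) <= norm1 z + norm1 w.
Proof. by apply: le_trans (norm1D _ _) _; rewrite norm1N. Qed.
Lemma norm1M z w : norm1 (z * w) <= norm1 z * norm1 w.
Proof.
rewrite /norm1 !CcompE.
have := ler_normB (ReC z * ReC w) (ImC z * ImC w).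
have := ler_normD (ReC z * ImC w) (ImC z * ReC w).
by rewrite !normrM; lra.
Qed.
Lemma norm1_eq0 z : (norm1 z == 0) = (z == 0).
Proof.
apply/idP/eqP => [|->]; last by rewrite /norm1 !CcompE normr0 addr0.
by rewrite paddr_eq0 // !normr_eq0 => /andP[/eqP a /eqP b]; apply: Ceq.
Qed.
Lemma norm1r x : norm1 (realC x) = `|x|.
Proof. by rewrite /norm1 !CcompE normr0 addr0. Qed.
Lemma norm1Mr z x : norm1 (z * realC x) = norm1 z * `|x|.
Proof. by rewrite /norm1 !CcompE !mulr0 subr0 add0r !normrM mulrDl. Qed.
Lemma norm1i z : norm1 ('i * z) = norm1 z.
Proof. by rewrite /norm1 !CcompE !mul0r !mul1r !add0r normrN addrC. Qed.
Lemma norm10 : norm1 0 = 0. Proof. by apply/eqP; rewrite norm1_eq0. Qed.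

Lemma realC_ge0 x : (0 <= realC x) = (0 <= x).
Proof. exact: ler0c. Qed.
Lemma realC_le x y : (realC x <= realC y) = (x <= y).
Proof. exact: lecR. Qed.
Lemma realC_lt x y : (realC x < realC y) = (x < y).
Proof. exact: ltcR. Qed.
Lemma norm_realC x : `|realC x| = realC `|x|.
Proof.
have [h|h] := leP 0 x; first by rewrite !ger0_norm ?realC_ge0.
by rewrite !ler0_norm ?realCN ?(ltW h) // -realC0 realC_le ltW.
Qed.

Lemma norm_le_norm1 z : `|z| <= realC (norm1 z).
Proof.
rewrite {1}[z]Cdecomp; apply: le_trans (ler_normD _ _) _.
by rewrite normrM !norm_realC normCi mul1r realCD.
Qed.
Lemma ReC_le z : realC `|ReC z| <= `|z|. Proof. exact: normc_ge_Re. Qed.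
Lemma ImC_le z : realC `|ImC z| <= `|z|.
Proof.
have := ReC_le (- 'i * z); rewrite !CcompE oppr0 mul0r sub0r mulN1r opprK.
by rewrite normrM normrN normCi mul1r.
Qed.
Lemma norm1_le_norm z : realC (norm1 z) <= 2 * `|z|.
Proof. by rewrite realCD mulr_natl mulr2n lerD ?ReC_le ?ImC_le. Qed.

End ComplexBasics.
(** * Entire functions of quadratic growth *)

Section CDerive.
Variable R : realType.
Local Notation C := (Cplx R).

Definition cderive (F : R -> C) (t : R) (v : C) : Prop :=
  is_derive t (1:R) (fun s => ReC (F s)) (ReC v) /\
  is_derive t (1:R) (fun s => ImC (F s)) (ImC v).

Lemma cderive_eq F t v w : v = w -> cderive F t v -> cderive F t w.
Proof. by move=> ->. Qed.

Lemma cderive_cst c t : cderive (fun=> c) t 0.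
Proof. by split; apply: is_derive_cst. Qed.

Lemma cderiveD F G t v w : cderive F t v -> cderive G t w ->
  cderive (fun s => F s + G s) t (v + w).
Proof.
move=> [a b] [c d]; split.
  rewrite ReCD; under eq_fun do rewrite ReCD.
  exact: (@is_deriveD _ _ _ (fun s => ReC (F s)) (fun s => ReC (G s))).
rewrite ImCD; under eq_fun do rewrite ImCD.
exact: (@is_deriveD _ _ _ (fun s => ImC (F s)) (fun s => ImC (G s))).
Qed.

Lemma cderiveM F G t v w : cderive F t v -> cderive G t w ->
  cderive (fun s => F s * G s) t (v * G t + F t * w).
Proof.
move=> [a b] [c d]; split.
  under eq_fun do rewrite ReCM.
  apply: (is_derive_eq (@is_deriveB _ _ _ _ _ _ _ _ _ (is_deriveM a c) (is_deriveM b d))).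
  by rewrite !CcompE /GRing.scale /=; ring.
under eq_fun do rewrite ImCM.
apply: (is_derive_eq (@is_deriveD _ _ _ _ _ _ _ _ _ (is_deriveM a d) (is_deriveM b c))).
by rewrite !CcompE /GRing.scale /=; ring.
Qed.

Lemma cderiveZ c F t v : cderive F t v -> cderive (fun s => c * F s) t (c * v).
Proof.
move=> h; apply: cderive_eq (cderiveM (cderive_cst c t) h).
by rewrite mul0r add0r.
Qed.

Lemma cderiveN F t v : cderive F t v -> cderive (fun s => - F s) t (- v).
Proof.
move=> h; have := cderiveZ (-1) h; rewrite mulN1r.
by under eq_fun do rewrite mulN1r.
Qed.

Lemma cderiveB F G t v w : cderive F t v -> cderive G t w ->
  cderive (fun s => F s - G s) t (v - w).
Proof. by move=> a b; apply: cderiveD a _; apply: cderiveN. Qed.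

Lemma cderive_conj F t v : cderive F t v -> cderive (fun s => (F s)^*) t v^*.
Proof.
move=> [a b]; split.
  by rewrite ReC_conj; under eq_fun do rewrite ReC_conj.
by rewrite ImC_conj; under eq_fun do rewrite ImC_conj; apply: is_deriveN.
Qed.

Lemma cderive_real (f : R -> R) (t v : R) : is_derive t (1:R) f v ->
  cderive (fun s => realC (f s)) t (realC v).
Proof. by move=> h; split => //; apply: is_derive_cst. Qed.

Lemma cderive_id t : cderive (fun s => realC s) t 1.
Proof. exact: (@cderive_real id t 1 (is_derive_id _ _)). Qed.

Lemma cderive_near F G t v : (\forall s \near t, F s = G s) ->
  cderive F t v -> cderive G t v.
Proof.
move=> h [a b]; split.
  apply: (near_eq_is_derive _ a).
  by near=> s; congr ReC; near: s.
apply: (near_eq_is_derive _ b).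
by near=> s; congr ImC; near: s.
Unshelve. all: by end_near. Qed.

(** The rectangle argument below uses primitives along segments instead of line integrals, and the
    fundamental theorem of calculus enters only here. Integration starts at [- M], hence the bounded
    interval. *)
Lemma primitive (f : R -> R) (M : R) : continuous f ->
  exists F : R -> R, forall x, - M < x < M -> is_derive x (1:R) F (f x).
Proof.
move=> cf; set mu := @lebesgue_measure R.
exists (fun x => \int[mu]_(t in [set` `[- M, x]]) (f t))%R => x /andP[x1 x2].
have fi : mu.-integrable `[- M, M] (EFin \o f).
  apply: continuous_compact_integrable; first exact: segment_compact.
  exact: continuous_subspaceT.
have [d <-] := @continuous_FTC1_closed R f (-M) x M x2 fi x1 (cf x).
by rewrite derive1E; apply: derivableP.
Qed.

Lemma cprimitive (f : R -> C) (M : R) :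
  continuous (fun s => ReC (f s)) -> continuous (fun s => ImC (f s)) ->
  exists F : R -> C, forall x, - M < x < M -> cderive F x (f x).
Proof.
move=> /(@primitive _ M)[F1 h1] /(@primitive _ M)[F2 h2].
exists (fun s => realC (F1 s) + 'i * realC (F2 s)) => x hx; split.
  by under eq_fun do rewrite !CcompE mulr0 mul0r subrr addr0; apply: h1.
by under eq_fun do rewrite !CcompE mul1r mul0r !add0r; apply: h2.
Qed.

(** The mean value theorem is applied to the real and imaginary parts separately, which costs the
    factor 2. *)
Lemma cincrement (F g : R -> C) a b B : a <= b ->
  (forall x, a <= x <= b -> cderive F x (g x) /\ norm1 (g x) <= B) ->
  norm1 (F b - F a) <= 2 * B * (b - a).
Proof.
move=> ab h.
have key (u f : R -> R) : (forall x, a <= x <= b -> is_derive x (1:R) u (f x)) ->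
    (forall x, a <= x <= b -> `|f x| <= B) -> `|u b - u a| <= B * (b - a).
  move=> du fB.
  have [||c] := @MVT_segment R u f a b ab.
  - by move=> x; rewrite in_itv /= => /andP[? ?]; apply: du; rewrite !ltW.
  - apply: continuous_in_subspaceT => x; rewrite inE /= in_itv /= => hx.
    apply: differentiable_continuous; apply/derivable1_diffP.
    by have [] := du x hx.
  rewrite in_itv /= => hc ->; rewrite normrM [ `|b - a|]ger0_norm ?subr_ge0 //.
  by rewrite ler_wpM2r ?subr_ge0 // fB.
have h1 : `|ReC (F b) - ReC (F a)| <= B * (b - a).
  apply: (key (fun s => ReC (F s)) (fun s => ReC (g s))) => x /h [[] // _ _].
  by apply: le_trans; rewrite /norm1 lerDl.
have h2 : `|ImC (F b) - ImC (F a)| <= B * (b - a).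
  apply: (key (fun s => ImC (F s)) (fun s => ImC (g s))) => x /h [[] // _ _].
  by apply: le_trans; rewrite /norm1 lerDr.
by rewrite /norm1 !CcompE; lra.
Qed.

End CDerive.

(** * Complex differentiability by explicit estimates *)

Section CDiff.
Variable R : realType.
Local Notation C := (Cplx R).
Implicit Types (f g : C -> C) (a d : C).

(** Balls of [Cplx R] have radii in [Cplx R]; this trades them for real radii measured by
    [norm1]. *)
Lemma nearC (a : C) (P : C -> Prop) :
  (\forall z \near a, P z) <->
  exists2 e : R, 0 < e & forall z, norm1 (z - a) < e -> P z.
Proof.
split.
  move=> /nbhs_ballP[e /= e0 h]; exists (ReC e).
    have : 0 < realC (ReC e) by rewrite /realC /ReC RRe_real ?gtr0_real.
    by rewrite -realC0 realC_lt.
  move=> z hz; apply: h; rewrite -ball_normE /= distrC.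
  apply: le_lt_trans (norm_le_norm1 _) _.
  by rewrite -[ltRHS](@RRe_real R) ?gtr0_real //; rewrite realC_lt.
move=> [e e0 h]; apply/nbhs_ballP; exists (realC (e / 2)) => /=.
  by rewrite -realC0 realC_lt divr_gt0.
move=> z; rewrite -ball_normE /= distrC => hz; apply: h.
rewrite -realC_lt; apply: le_lt_trans (norm1_le_norm _) _.
rewrite mulr_natl mulr2n; apply: lt_le_trans (ltrD hz hz) _.
by rewrite -realCD -splitr.
Qed.

Lemma nearR (a : R) (P : R -> Prop) :
  (\forall z \near a, P z) <-> exists2 e : R, 0 < e & forall z, `|z - a| < e -> P z.
Proof.
split.
  move=> /nbhs_ballP[e /= e0 h]; exists e => // z hz; apply: h.
  by rewrite -ball_normE /= distrC.
move=> [e e0 h]; apply/nbhs_ballP; exists e => //= z.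
by rewrite -ball_normE /= distrC => hz; apply: h.
Qed.

Lemma cvgC (T : Type) (F : set_system T) {FF : Filter F} (f : T -> C) (l : C) :
  (f @ F --> l) <-> (forall e : R, 0 < e -> \forall s \near F, norm1 (f s - l) < e).
Proof.
split.
  move=> h e e0.
  have : \forall z \near l, norm1 (z - l) < e by apply/nearC; exists e.
  by move=> /h.
move=> h U /= /nearC[e e0 eU].
by have := h e e0; apply: filterS => s; apply: eU.
Qed.

Lemma continuousC (T : topologicalType) (t : T) (f : T -> C) :
  {for t, continuous f} <->
  (forall e : R, 0 < e -> \forall s \near t, norm1 (f s - f t) < e).
Proof. exact: cvgC. Qed.

Lemma continuous_ReC (T : topologicalType) (t : T) (f : T -> C) :
  {for t, continuous f} -> {for t, continuous (fun s => ReC (f s))}.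
Proof.
move=> /continuousC h; apply/cvgrPdist_lt => e /h; apply: filterS => s.
apply: le_lt_trans; rewrite distrC /norm1 !CcompE lerDl //.
Qed.

Lemma continuous_ImC (T : topologicalType) (t : T) (f : T -> C) :
  {for t, continuous f} -> {for t, continuous (fun s => ImC (f s))}.
Proof.
move=> /continuousC h; apply/cvgrPdist_lt => e /h; apply: filterS => s.
apply: le_lt_trans; rewrite distrC /norm1 !CcompE lerDr //.
Qed.

(** There is no division by [z - a], so a composition needs no case distinction on whether the inner
    increment vanishes. *)
Definition cder f a d : Prop := forall e : R, 0 < e -> exists2 del : R, 0 < del &
  forall z, norm1 (z - a) < del ->
    norm1 (f z - f a - d * (z - a)) <= e * norm1 (z - a).

Lemma derivable_cder f a : derivable f a 1 -> exists d, cder f a d.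
Proof.
move=> /cvg_ex[d /cvgC h]; exists d => e e0.
have /nearC[del del0 hd] := h e e0; exists del => // z hz.
have [->|za] := eqVneq z a; first by rewrite !subrr mulr0 subrr norm10 mulr0.
have := hd (z - a); rewrite subr0 => /(_ hz); rewrite subr_eq0 => /(_ za).
rewrite /GRing.scale /= mulr1 subrK => hl.
have -> : f z - f a - d * (z - a) = ((z - a)^-1 * (f z - f a) - d) * (z - a).
  by rewrite mulrBl mulrAC mulVf ?mul1r ?subr_eq0.
apply: le_trans (norm1M _ _) _; rewrite ler_wpM2r ?norm1_ge0 //.
exact: ltW.
Qed.

Lemma is_derive_dist (f : R -> R) (x v : R) : is_derive x (1:R) f v ->
  forall e : R, 0 < e -> exists2 del : R, 0 < del &
  forall h, `|h| < del -> `|f (x + h) - f x - v * h| <= e * `|h|.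
Proof.
move=> [/cvg_ex[l hl] dv] e e0.
have lv : l = v by rewrite -dv; apply/esym/cvg_lim.
move: hl; rewrite lv => /cvgrPdist_lt /(_ _ e0) /nearR[del del0 hd].
exists del => // h hh; have [->|h0] := eqVneq h 0.
  by rewrite addr0 subrr mulr0 subrr normr0 mulr0.
have := hd h; rewrite subr0 => /(_ hh h0); rewrite /GRing.scale /= mulr1 => hl.
have -> : f (x + h) - f x - v * h = - (v - h^-1 * (f (h + x) - f x)) * h.
  by rewrite [h + x]addrC opprB mulrBl mulrAC mulVf ?mul1r.
by rewrite normrM normrN ler_wpM2r // ltW.
Qed.

Lemma cder_cont f a d : cder f a d -> {for a, continuous f}.
Proof.
move=> h; apply/continuousC => e e0; apply/nearC.
have [del del0 hd] := h 1 ltr01.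
pose m := e / (2 + norm1 d).
have n0 := norm1_ge0 d.
have m0 : 0 < m by rewrite divr_gt0 //; lra.
exists (Num.min del m); first by rewrite lt_min del0.
move=> z; rewrite lt_min => /andP[h1 h2].
have {}hd := hd z h1.
have -> : f z - f a = (f z - f a - d * (z - a)) + d * (z - a) by ring.
apply: le_lt_trans (norm1D _ _) _.
have := norm1M d (z - a).
have : (1 + norm1 d) * norm1 (z - a) < e; last by lra.
have : (2 + norm1 d) * norm1 (z - a) < e.
  by rewrite mulrC -ltr_pdivlMr //; lra.
by have := norm1_ge0 (z - a); lra.
Qed.

Lemma cder_comp f g a d d' : cder g a d -> cder f (g a) d' ->
  cder (fun z => f (g z)) a (d' * d).
Proof.
move=> hg hf e e0; have n0 := norm1_ge0 d; have n0' := norm1_ge0 d'.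
pose e1 := e / (2 * (1 + norm1 d)); pose e2 := e / (2 * (1 + norm1 d')).
have e10 : 0 < e1 by rewrite divr_gt0 //; lra.
have e20 : 0 < e2 by rewrite divr_gt0 //; lra.
have [df df0 hdf] := hf e1 e10.
have [dg dg0 hdg] := hg (Num.min 1 e2) ltac:(by rewrite lt_min ltr01).
have [dc dc0 hdc] : exists2 e, 0 < e & forall z, norm1 (z - a) < e -> norm1 (g z - g a) < df.
  by apply/nearC; have /continuousC := cder_cont hg; apply.
exists (Num.min dg dc); first by rewrite lt_min dg0.
move=> z; rewrite lt_min => /andP[h1 h2].
have {hdf} A := hdf _ (hdc _ h2); have {hdg} B := hdg _ h1.
have -> : f (g z) - f (g a) - d' * d * (z - a) =
  (f (g z) - f (g a) - d' * (g z - g a)) + d' * (g z - g a - d * (z - a)) by ring.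
apply: le_trans (norm1D _ _) _; set N := norm1 (z - a) in B *.
have N0 : 0 <= N by apply: norm1_ge0.
have G : norm1 (g z - g a) <= (1 + norm1 d) * N.
  have -> : g z - g a = (g z - g a - d * (z - a)) + d * (z - a) by ring.
  apply: le_trans (norm1D _ _) _; rewrite mulrDl lerD ?norm1M //.
  by apply: le_trans B _; rewrite ler_wpM2r // ge_min lexx.
have A' : norm1 (f (g z) - f (g a) - d' * (g z - g a)) <= e / 2 * N.
  apply: le_trans A _; apply: le_trans (_ : _ <= e1 * ((1 + norm1 d) * N)) _.
    by rewrite ler_wpM2l // ltW.
  rewrite mulrA ler_wpM2r // /e1 le_eqVlt; apply/orP; left; apply/eqP.
  by field; lra.
have B' : norm1 (d' * (g z - g a - d * (z - a))) <= e / 2 * N.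
  apply: le_trans (norm1M _ _) _.
  apply: le_trans (_ : _ <= (1 + norm1 d') * (e2 * N)) _.
    rewrite ler_pM ?norm1_ge0 //; first lra.
    by apply: le_trans B _; rewrite ler_wpM2r // ge_min lexx orbT.
  rewrite mulrA ler_wpM2r // /e2 le_eqVlt; apply/orP; left; apply/eqP.
  by field; lra.
by apply: le_trans (lerD A' B') _; rewrite -mulrDl -splitr.
Qed.

End CDiff.

(** * Goursat's theorem for rectangles *)

Section Goursat.
Variable R : realType.
Local Notation C := (Cplx R).

Definition pt (x y : R) : C := realC x + 'i * realC y.

(** The counterclockwise integral of [K] around the rectangle with sides [a, b] and [c, d], when
    [H y] and [V x] are primitives of [K] along the horizontal line at height [y] and the vertical
    line at [x]. *)
Definition rect_int (H V : R -> R -> C) (a b c d : R) : C :=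
  (H c b - H c a) + 'i * (V b d - V b c) - (H d b - H d a) - 'i * (V a d - V a c).

Variables (K : C -> C) (M : R) (H V : R -> R -> C).
Hypothesis dH : forall x y, `|x| < M -> `|y| < M -> cderive (H y) x (K (pt x y)).
Hypothesis dV : forall x y, `|x| < M -> `|y| < M -> cderive (V x) y (K (pt x y)).

Let norm1D4 (x y z t : C) :
  norm1 (x + y + z + t) <= norm1 x + norm1 y + norm1 z + norm1 t.
Proof.
by do 2 (apply: le_trans (norm1D _ _) _; rewrite lerD2r); exact: norm1D.
Qed.

Let itvM a b x : - M < a -> b < M -> a <= x <= b -> `|x| < M.
Proof.
move=> h1 h2 /andP[h3 h4].
by rewrite ltr_norml (lt_le_trans h1 h3) (le_lt_trans h4 h2).
Qed.

Lemma rect_int_local x0 y0 k : cder K (pt x0 y0) k ->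
  forall e, 0 < e -> exists2 del, 0 < del & forall a b c d,
    - M < a -> b < M -> - M < c -> d < M ->
    a <= x0 <= b -> c <= y0 <= d -> (b - a) + (d - c) < del ->
    norm1 (rect_int H V a b c d) <= 4 * e * ((b - a) + (d - c)) ^+ 2.
Proof.
move=> hK e e0; have [del del0 hd] := hK e e0; exists del => // a b c d Ma Mb Mc Md ab cd.
set s := (b - a) + (d - c) => hs.
(* [al + k z] is the first order expansion of [K] at the marked point. It has the global primitives
   [PH], [PV], so its boundary integral vanishes and only the remainder, at most [e * s] on the
   rectangle, contributes. *)
pose al := K (pt x0 y0) - k * pt x0 y0.
have ab' : a <= b by case/andP: ab => [/le_trans]; apply.
have cd' : c <= d by case/andP: cd => [/le_trans]; apply.
have s0 : 0 <= s by rewrite addr_ge0 // subr_ge0.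
have bnd x y : a <= x <= b -> c <= y <= d -> norm1 (K (pt x y) - (al + k * pt x y)) <= e * s.
  move=> hx hy.
  have hn : norm1 (pt x y - pt x0 y0) <= s.
    rewrite /norm1 /pt !CcompE /s.
    have -> : x + (0 * y - 1 * 0) - (x0 + (0 * y0 - 1 * 0)) = x - x0 by ring.
    have -> : 0 + (0 * 0 + 1 * y) - (0 + (0 * 0 + 1 * y0)) = y - y0 by ring.
    move: ab cd hx hy => /andP[? ?] /andP[? ?] /andP[? ?] /andP[? ?].
    by apply: lerD; rewrite ler_norml; apply/andP; split; lra.
  have -> : K (pt x y) - (al + k * pt x y) =
     K (pt x y) - K (pt x0 y0) - k * (pt x y - pt x0 y0) by rewrite /al; ring.
  apply: le_trans (hd _ (le_lt_trans hn hs)) _.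
  by rewrite ler_wpM2l // ltW.
pose PH y x : C := al * realC x + k * (realC x * realC x / 2 + 'i * realC y * realC x).
pose PV x y : C := al * realC y + k * (realC x * realC y + 'i * (realC y * realC y / 2)).
have dPH x y : cderive (PH y) x (al + k * pt x y).
  have i := cderive_id x.
  apply: cderive_eq (cderiveD (cderiveZ al i) (cderiveZ k (cderiveD
     (cderiveM (cderiveM i i) (cderive_cst 2^-1 x)) (cderiveZ ('i * realC y) i)))).
  by rewrite /pt; field.
have dPV x y : cderive (PV x) y (al + k * ('i * pt x y) / 'i).
  have i := cderive_id y.
  apply: cderive_eq (cderiveD (cderiveZ al i) (cderiveZ k (cderiveD
     (cderiveZ (realC x) i) (cderiveZ 'i (cderiveM (cderiveM i i) (cderive_cst 2^-1 y)))))).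
  by rewrite /pt; field; rewrite neq0Ci.
have cancel0 : rect_int PH PV a b c d = 0.
  by rewrite /rect_int /PH /PV; field.
have rectB : rect_int H V a b c d =
  rect_int (fun y x => H y x - PH y x) (fun x y => V x y - PV x y) a b c d.
  by rewrite -[LHS]subr0 -cancel0 /rect_int; ring.
have bH y : c <= y <= d ->
    norm1 ((H y b - PH y b) - (H y a - PH y a)) <= 2 * (e * s) * (b - a).
  move=> hy; apply: (@cincrement R (fun x => H y x - PH y x)
     (fun x => K (pt x y) - (al + k * pt x y))) => // x hx; split; last exact: bnd.
  by apply: cderiveB (dPH _ _); apply: dH; [exact: itvM hx|exact: itvM hy].
have bV x : a <= x <= b ->
    norm1 ((V x d - PV x d) - (V x c - PV x c)) <= 2 * (e * s) * (d - c).
  move=> hx; apply: (@cincrement R (fun y => V x y - PV x y)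
     (fun y => K (pt x y) - (al + k * pt x y))) => // y hy; split; last exact: bnd.
  have h : cderive (PV x) y (al + k * pt x y).
    by apply: cderive_eq (dPV x y); field; rewrite neq0Ci.
  by apply: cderiveB h; apply: dV; [exact: itvM hx|exact: itvM hy].
rewrite rectB /rect_int.
apply: le_trans (norm1D4 _ _ _ _) _; rewrite !norm1N !norm1i.
have := bH c; have := bH d; have := bV a; have := bV b.
rewrite !lexx !ab' !cd' /= => /(_ isT) h1 /(_ isT) h2 /(_ isT) h3 /(_ isT) h4.
apply: le_trans (lerD (lerD (lerD h4 h1) h3) h2) _.
by rewrite le_eqVlt; apply/orP; left; apply/eqP; rewrite /s; ring.
Qed.

Lemma half_pow_lt (s del : R) : 0 <= s -> 0 < del -> exists n, s / 2 ^+ n < del.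
Proof.
move=> s0 del0; exists (Num.truncn (s / del)).+1.
rewrite ltr_pdivrMr ?exprn_gt0 // mulrC -ltr_pdivrMr //.
have := truncnS_gt (s / del) => /lt_le_trans; apply.
by rewrite -natrX ler_nat ltnW // ltn_expl.
Qed.

Lemma goursat a b c d : (forall w, exists k, cder K w k) ->
  a <= b -> c <= d -> - M < a -> b < M -> - M < c -> d < M ->
  rect_int H V a b c d = 0.
Proof.
move=> hK ab cd Ma Mb Mc Md; apply/eqP; rewrite -norm1_eq0.
apply/negPn/negP => N0; set eta := norm1 _ in N0.
have eta0 : 0 < eta by rewrite lt_neqAle eq_sym N0 norm1_ge0.
(* Bisection: one of the four quarters carries at least a quarter of the integral, so at stage [n]
   the integral is still [eta / 4 ^+ n] while the sides have shrunk by [2 ^+ n]. *)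
pose Bad n (Q : R * R * R * R) := let: (a', b', c', d') := Q in
  [/\ a <= a' <= b', b' <= b, c <= c' <= d', d' <= d &
   [/\ b' - a' = (b - a) / 2 ^+ n, d' - c' = (d - c) / 2 ^+ n &
   eta / 4 ^+ n <= norm1 (rect_int H V a' b' c' d')]].
pose nested (Q Q' : R * R * R * R) := let: (a1, b1, c1, d1) := Q in
  let: (a2, b2, c2, d2) := Q' in [/\ a1 <= a2, b2 <= b1, c1 <= c2 & d2 <= d1].
have step n Q : Bad n Q -> exists Q', Bad n.+1 Q' /\ nested Q Q'.
  case: Q => [[[a1 b1] c1] d1] [/andP[h1 h2] h3 /andP[h4 h5] h6 [h7 h8 h9]].
  pose m := (a1 + b1) / 2; pose l := (c1 + d1) / 2.
  have am : a1 <= m <= b1 by rewrite /m; apply/andP; split; lra.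
  have cl : c1 <= l <= d1 by rewrite /l; apply/andP; split; lra.
  case/andP: (am) => am1 am2; case/andP: (cl) => cl1 cl2.
  have h7a : m - a1 = (b - a) / 2 ^+ n.+1 /\ b1 - m = (b - a) / 2 ^+ n.+1.
    rewrite exprSr invfM mulrA -h7 /m; split; lra.
  have h8a : l - c1 = (d - c) / 2 ^+ n.+1 /\ d1 - l = (d - c) / 2 ^+ n.+1.
    rewrite exprSr invfM mulrA -h8 /l; split; lra.
  have e4 : eta / 4 ^+ n = 4 * (eta / 4 ^+ n.+1).
    by rewrite exprSr invfM; field; rewrite expf_neq0 // pnatr_eq0.
  have sum4 : rect_int H V a1 b1 c1 d1 = rect_int H V a1 m c1 l +
     rect_int H V m b1 c1 l + rect_int H V a1 m l d1 + rect_int H V m b1 l d1.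
    by rewrite /rect_int; ring.
  have h10 : 4 * (eta / 4 ^+ n.+1) <= norm1 (rect_int H V a1 m c1 l) +
     norm1 (rect_int H V m b1 c1 l) + norm1 (rect_int H V a1 m l d1) +
     norm1 (rect_int H V m b1 l d1).
    rewrite -e4; apply: le_trans h9 _; rewrite sum4.
    exact: norm1D4.
  case: h7a h8a => [u1 u2] [u3 u4].
  have [g1|g1] := leP (eta / 4 ^+ n.+1) (norm1 (rect_int H V a1 m c1 l)).
    exists (a1, m, c1, l); split; split => //; rewrite ?h1 ?h4 ?am1 ?cl1 //; lra.
  have [g2|g2] := leP (eta / 4 ^+ n.+1) (norm1 (rect_int H V m b1 c1 l)).
    exists (m, b1, c1, l); split; split => //; rewrite ?h4 ?am2 ?cl1 ?(le_trans h1 am1) //; lra.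
  have [g3|g3] := leP (eta / 4 ^+ n.+1) (norm1 (rect_int H V a1 m l d1)).
    exists (a1, m, l, d1); split; split => //; rewrite ?h1 ?am1 ?cl2 ?(le_trans h4 cl1) //; lra.
  have [g4|g4] := leP (eta / 4 ^+ n.+1) (norm1 (rect_int H V m b1 l d1)).
    exists (m, b1, l, d1); split; split => //;
      rewrite ?am2 ?cl2 ?(le_trans h1 am1) ?(le_trans h4 cl1) //; lra.
  lra.
have bad0 : Bad 0 (a, b, c, d).
  by split; rewrite ?lexx ?ab ?cd //; split; rewrite expr0 divr1.
pose nxt n (Q : {Q | Bad n Q}) : {Q | Bad n.+1 Q} :=
  let s := cid (step n (sval Q) (svalP Q)) in exist _ (sval s) (svalP s).1.
pose q := fix q n : {Q | Bad n Q} :=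
  if n is m.+1 then nxt m (q m) else exist _ (a, b, c, d) bad0.
pose A n := (sval (q n)).1.1.1; pose B n := (sval (q n)).1.1.2.
pose Cc n := (sval (q n)).1.2; pose D n := (sval (q n)).2.
have qbad n : Bad n (A n, B n, Cc n, D n).
  by rewrite /A /B /Cc /D; case: (q n) => [[[[? ?] ?] ?] ?].
have qnest n : nested (A n, B n, Cc n, D n) (A n.+1, B n.+1, Cc n.+1, D n.+1).
  rewrite /A /B /Cc /D /=; case: (cid _) => [[[[? ?] ?] ?] /= [_]].
  by case: (q n) => [[[[? ?] ?] ?] ?].
have mono n m : (n <= m)%N -> [/\ A n <= A m, B m <= B n, Cc n <= Cc m & D m <= D n].
  elim: m => [|m IH]; first by rewrite leqn0 => /eqP ->.
  rewrite leq_eqVlt => /orP[/eqP -> //|]; rewrite ltnS => /IH[i1 i2 i3 i4].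
  have [j1 j2 j3 j4] := qnest m.
  by split; [exact: le_trans i1 _|exact: le_trans i2|exact: le_trans i3 _|exact: le_trans i4].
have AB n m : A n <= B m.
  have [k1 k2 _ _] := mono n (maxn n m) (leq_maxl _ _).
  have [_ k4 _ _] := mono m (maxn n m) (leq_maxr _ _).
  have [/andP[_ k5] _ _ _ _] := qbad (maxn n m).
  exact: le_trans k1 (le_trans k5 k4).
have CD n m : Cc n <= D m.
  have [_ _ k1 k2] := mono n (maxn n m) (leq_maxl _ _).
  have [_ _ _ k4] := mono m (maxn n m) (leq_maxr _ _).
  have [_ _ /andP[_ k5] _ _] := qbad (maxn n m).
  exact: le_trans k1 (le_trans k5 k4).
have mid (u v : nat -> R) : (forall n m, u n <= v m) ->
    exists x, forall n, u n <= x <= v n.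
  move=> uv; exists (sup (range u)) => n; apply/andP; split.
    apply: ub_le_sup; last by exists n.
    by exists (v 0) => _ [m _ <-].
  apply: ge_sup; first by exists (u 0); exists 0.
  by move=> _ [m _ <-].
have [x0 hx0] := mid _ _ AB; have [y0 hy0] := mid _ _ CD.
pose s := (b - a) + (d - c).
have s0 : 0 <= s by rewrite addr_ge0 // subr_ge0.
have [k hk] := hK (pt x0 y0).
(* This makes the local bound [4 * e * s ^+ 2] smaller than [eta]; the summand 1 keeps the
   denominator positive for a degenerate rectangle. *)
pose e := eta / (8 * (1 + s) ^+ 2).
have s1 : 0 < 8 * (1 + s) ^+ 2 by rewrite mulr_gt0 // exprn_gt0 //; lra.
have e0 : 0 < e by rewrite divr_gt0.
have [del del0 hdel] := rect_int_local hk e0.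
have [n hn] := half_pow_lt s0 del0.
have [/andP[k1 k2] k3 /andP[k4 k5] k6 [k7 k8 k9]] := qbad n.
have hA : - M < A n by apply: lt_le_trans k1.
have hB : B n < M by apply: le_lt_trans k3 _.
have hC : - M < Cc n by apply: lt_le_trans k4.
have hD : D n < M by apply: le_lt_trans k6 _.
have := hdel _ _ _ _ hA hB hC hD (hx0 n) (hy0 n).
rewrite k7 k8 -mulrDl -/s => /(_ hn) hh.
have := le_trans k9 hh.
have -> : (s / 2 ^+ n) ^+ 2 = s ^+ 2 / 4 ^+ n.
  by rewrite expr_div_n -exprM mulnC exprM; congr (_ / _ ^+ _); ring.
rewrite mulrA ler_pM2r ?invr_gt0 ?exprn_gt0 //.
rewrite /e; apply/negP; rewrite -ltNge.
have -> : 4 * (eta / (8 * (1 + s) ^+ 2)) * s ^+ 2 = eta * (4 * s ^+ 2 / (8 * (1 + s) ^+ 2)).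
  by field; lra.
rewrite gtr_pMr // ltr_pdivrMr // mul1r.
have ss : 0 <= s ^+ 2 by exact: sqr_ge0.
have -> : (1 + s) ^+ 2 = 1 + 2 * s + s ^+ 2 by ring.
by move: s0 ss; clear; move: (s ^+ 2) (s) => x y; lra.
Qed.

End Goursat.

(** * The exponential and functions on the punctured plane *)

Section Liouville.
Variable R : realType.
Local Notation C := (Cplx R).
Implicit Types (f g : C -> C) (a d w z : C).

Definition cexp w : C := realC (expR (ReC w)) * pt (cos (ImC w)) (sin (ImC w)).

Lemma cexpD w z : cexp (w + z) = cexp w * cexp z.
Proof.
apply: Ceq; rewrite /cexp /pt !CcompE expRD cosD sinD; ring.
Qed.

Lemma cexp_neq0 w : cexp w != 0.
Proof.
apply/eqP => h; have : cexp w * cexp (- w) = 0 by rewrite h mul0r.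
rewrite -cexpD subrr /cexp !CcompE expR0 cos0 sin0 /pt => /(congr1 (@ReC R)).
by rewrite !CcompE; apply/eqP; rewrite gt_eqF //; lra.
Qed.

Lemma norm1_cexp w : expR (ReC w) <= norm1 (cexp w) <= 2 * expR (ReC w).
Proof.
have e0 := expR_gt0 (ReC w).
have -> : norm1 (cexp w) = expR (ReC w) * (`|cos (ImC w)| + `|sin (ImC w)|).
  rewrite /norm1 /cexp /pt !CcompE.
  have ee x y : y = expR (ReC w) * x -> `|y| = expR (ReC w) * `|x|.
    by move=> ->; rewrite normrM (ger0_norm (ltW e0)).
  by rewrite [RHS]mulrDr; congr (_ + _); apply: ee; ring.
have c1 : `|cos (ImC w)| <= 1 by rewrite ler_norml cos_geN1 cos_le1.
have s1 : `|sin (ImC w)| <= 1 by rewrite ler_norml sin_geN1 sin_le1.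
have cs : 1 <= `|cos (ImC w)| + `|sin (ImC w)|.
  rewrite -(cos2Dsin2 (ImC w)) -(real_normK (num_real (cos _))) -(real_normK (num_real (sin _))) !expr2.
  by apply: lerD; rewrite ler_piMr.
by apply/andP; split; nra.
Qed.

Lemma cexp0 : cexp 0 = 1.
Proof. by apply: Ceq; rewrite /cexp /pt !CcompE expR0 cos0 sin0; ring. Qed.

Lemma cexp_period x : cexp (pt x (2 * pi)) = cexp (pt x 0).
Proof.
apply: Ceq; rewrite /cexp /pt !CcompE.
all: have -> : 0 + (0 * 0 + 1 * (2 * pi)) = (0 : R) + pi *+ 2 by rewrite mulr2n; ring.
all: have -> : 0 + (0 * 0 + 1 * 0) = (0 : R) by ring.
all: by rewrite !mul0r ?cosD2pi ?sinD2pi.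
Qed.

Lemma cder_cexp0 : cder cexp 0 1.
Proof.
(* The terms of the error bounded by multiples of the imaginary part add up to at most eight times
   [e1] (1 + 2 + 1 + 4), whence [e / 8]. *)
move=> e e0; pose e1 := Num.min 1 (e / 8).
have e10 : 0 < e1 by rewrite lt_min ltr01 divr_gt0.
have e11 : e1 <= 1 by rewrite ge_min lexx.
have e18 : e1 <= e / 8 by rewrite ge_min lexx orbT.
clearbody e1.
have [d1 d10 h1] := is_derive_dist (is_derive_expR (0:R)) e10.
have [d2 d20 h2] := is_derive_dist (is_derive_cos (0:R)) e10.
have [d3 d30 h3] := is_derive_dist (is_derive_sin (0:R)) e10.
exists (Num.min e1 (Num.min d1 (Num.min d2 d3))); first by rewrite !lt_min e10 d10 d20 d30.
move=> z; rewrite subr0 !lt_min => /and4P[z0 z1 z2 z3].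
have nr : `|ReC z| <= norm1 z by rewrite /norm1 lerDl.
have ni : `|ImC z| <= norm1 z by rewrite /norm1 lerDr.
have {h1} := h1 _ (le_lt_trans nr z1); rewrite add0r expR0 mul1r => h1.
have {h2} := h2 _ (le_lt_trans ni z2); rewrite add0r cos0 sin0 oppr0 mul0r subr0 => h2.
have {h3} := h3 _ (le_lt_trans ni z3); rewrite add0r cos0 sin0 subr0 mul1r => h3.
rewrite cexp0 mul1r /cexp /pt /norm1 !CcompE.
move: h1 h2 h3 z0; rewrite /norm1.
set a := ReC z; set b := ImC z; set p := expR a; set u := cos b; set s := sin b.
move=> h1 h2 h3 z0.
have -> : p * (u + (0 * s - 1 * 0)) - 0 * (0 + (0 * 0 + 1 * s)) - 1 - a
  = (p - 1 - a) + (u - 1) + (p - 1) * (u - 1) by ring.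
have -> : p * (0 + (0 * 0 + 1 * s)) + 0 * (u + (0 * s - 1 * 0)) - 0 - b
  = (s - b) + (p - 1) * s by ring.
have a0 : 0 <= `|a| by []. have b0 : 0 <= `|b| by [].
have hp : `|p - 1| <= 2 * `|a|.
  have -> : p - 1 = (p - 1 - a) + a by ring.
  by apply: le_trans (ler_normD _ _) _; have := ler_wpM2r a0 e11; lra.
have hs : `|s| <= 2 * `|b|.
  have -> : s = (s - b) + b by ring.
  by apply: le_trans (ler_normD _ _) _; have := ler_wpM2r b0 e11; lra.
have hpu : `|(p - 1) * (u - 1)| <= 2 * e1 * `|b|.
  rewrite normrM; apply: le_trans (ler_pM _ _ hp h2) _ => //.
  have aa : `|a| <= 1 by lra.
  by have := ler_wpM2r (mulr_ge0 (ltW e10) b0) aa; lra.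
have hps : `|(p - 1) * s| <= 4 * e1 * `|b|.
  rewrite normrM; apply: le_trans (ler_pM _ _ hp hs) _ => //.
  have aa : `|a| <= e1 by lra.
  by have := ler_wpM2r b0 aa; lra.
have t1 := ler_normD (p - 1 - a + (u - 1)) ((p - 1) * (u - 1)).
have t2 := ler_normD (p - 1 - a) (u - 1).
have t3 := ler_normD (s - b) ((p - 1) * s).
have t4 := ler_wpM2r a0 e18; have t5 := ler_wpM2r b0 e18.
have t6 := mulr_ge0 (ltW e0) a0; rewrite [leRHS]mulrDr.
by lra.
Qed.

Lemma cder_cexp w : cder cexp w (cexp w).
Proof.
move=> e e0; have n0 := norm1_ge0 (cexp w).
have e10 : 0 < e / (1 + norm1 (cexp w)) by rewrite divr_gt0 //; lra.
have [del del0 h] := cder_cexp0 e10; exists del => // z hz.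
have := h (z - w); rewrite subr0 => /(_ hz) {}h.
have -> : cexp z - cexp w - cexp w * (z - w) =
   cexp w * (cexp (z - w) - cexp 0 - 1 * (z - w)).
  by rewrite -{1}(subrK w z) addrC cexpD cexp0; ring.
apply: le_trans (norm1M _ _) _; apply: le_trans (ler_wpM2l n0 h) _.
rewrite mulrA ler_wpM2r ?norm1_ge0 // mulrA ler_pdivrMr; last lra.
by rewrite [leRHS]mulrDr; lra.
Qed.

(** The pullback [K] of [f] by [cexp] has period 2 pi i. Around a rectangle of height 2 pi the
    horizontal sides cancel, so the integrals over the two vertical sides agree. Far to the left [K]
    is close to [al], far to the right to [be]. *)
Lemma annulus f (al be : C) :
  (forall z, z != 0 -> exists d, cder f z d) ->
  (forall e : R, 0 < e -> exists2 del, 0 < del &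
     forall z, z != 0 -> norm1 z < del -> norm1 (f z - al) <= e) ->
  (forall e : R, 0 < e -> exists N, forall z, N < norm1 z -> norm1 (f z - be) <= e) ->
  al = be.
Proof.
move=> df h0 hoo; apply/eqP; rewrite -subr_eq0 -norm1_eq0; apply/negPn/negP => N0.
have eta0 : 0 < norm1 (al - be) by rewrite lt_neqAle eq_sym N0 norm1_ge0.
(* The two vertical sides will be off by at most [8 * pi * e] in total, against a difference of
   [10 * pi * e]. *)
pose e := norm1 (al - be) / 5.
have e0 : 0 < e by rewrite divr_gt0.
(* [norm1 (cexp w)] lies between [expR (ReC w)] and twice it, so the bounds [del / 3] and [|N| + 1]
   put the two vertical lines in the regions near 0 and near infinity. Comparison with 0 ensures
   [s1 <= s2]. *)
have [del del0 {}h0] := h0 e e0; have [N {}hoo] := hoo e e0.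
pose s1 := Num.min 0 (ln (del / 3)); pose s2 := Num.max 0 (ln (`|N| + 1)).
have hs1 y : norm1 (f (cexp (pt s1 y)) - al) <= e.
  apply: h0; first exact: cexp_neq0.
  have /andP[_ /le_lt_trans] := norm1_cexp (pt s1 y); apply.
  rewrite /pt !CcompE; have -> : s1 + (0 * y - 1 * 0) = s1 by ring.
  have : expR s1 <= del / 3.
    have d3 : del / 3 \is Num.pos by rewrite posrE divr_gt0.
    by rewrite -[leRHS]lnK // ler_expR ge_min lexx orbT.
  by lra.
have hs2 y : norm1 (f (cexp (pt s2 y)) - be) <= e.
  apply: hoo.
  have /andP[+ _] := norm1_cexp (pt s2 y); apply: lt_le_trans.
  rewrite /pt !CcompE; have -> : s2 + (0 * y - 1 * 0) = s2 by ring.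
  have : `|N| + 1 <= expR s2.
    have d3 : `|N| + 1 \is Num.pos by rewrite posrE addrC ltr_pwDl.
    by rewrite -[leLHS]lnK // ler_expR le_max lexx orbT.
  by have := ler_norm N; lra.
have s120 : s1 <= 0 by rewrite ge_min lexx.
have s220 : 0 <= s2 by rewrite le_max lexx.
pose M := s2 - s1 + 2 * pi + 1.
have pi0 := pi_gt0 R.
pose K w := f (cexp w).
have dK w : exists k, cder K w k.
  have [d hd] := df _ (cexp_neq0 w).
  by exists (d * cexp w); apply: cder_comp hd; exact: cder_cexp.
have cK w : {for w, continuous K} by have [k /cder_cont] := dK w.
have ptx y : continuous (fun x : R => pt x y).
  move=> t; apply/continuousC => e' e0'; apply/nearR; exists e' => // s hs.
  by have -> : pt s y - pt t y = realC (s - t); rewrite ?norm1r // /pt realCD realCN; ring.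
have pty x : continuous (fun y : R => pt x y).
  move=> t; apply/continuousC => e' e0'; apply/nearR; exists e' => // s hs.
  have -> : pt x s - pt x t = 'i * realC (s - t) by rewrite /pt realCD realCN; ring.
  by rewrite norm1i norm1r.
have cKx y : continuous (fun x => K (pt x y)).
  by move=> t; apply: continuous_comp (ptx y t) (cK _).
have cKy x : continuous (fun y => K (pt x y)).
  by move=> t; apply: continuous_comp (pty x t) (cK _).
have /boolp.choice[H0 hH0] y : exists F : R -> C, forall x, - M < x < M -> cderive F x (K (pt x y)).
  by apply: cprimitive => t;
    [exact: (continuous_ReC (cKx y t))|exact: (continuous_ImC (cKx y t))].
have /boolp.choice[V hV] x : exists F : R -> C, forall y, - M < y < M -> cderive F y (K (pt x y)).
  by apply: cprimitive => t;
    [exact: (continuous_ReC (cKy x t))|exact: (continuous_ImC (cKy x t))].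
(* The primitive at height 2 pi is replaced by the one at height 0, legitimate by periodicity, so
   that the horizontal sides cancel literally. *)
pose H y := H0 (if y == 2 * pi then 0 else y).
have dH x y : `|x| < M -> `|y| < M -> cderive (H y) x (K (pt x y)).
  rewrite ltr_norml => hx _; rewrite /H; case: eqP => [->|_]; last exact: hH0.
  by rewrite /K cexp_period; apply: hH0.
have dV x y : `|x| < M -> `|y| < M -> cderive (V x) y (K (pt x y)).
  by rewrite ltr_norml => _; rewrite ltr_norml => hy; apply: hV.
have := @goursat R K M H V dH dV s1 s2 0 (2 * pi) dK.
rewrite /M; do 6 (move=> /(_ ltac:(lra))).
rewrite /rect_int /H eqxx; have -> : (0 == 2 * pi :> R) = false by apply/negbTE; rewrite lt_eqF //; lra.
have lin (b : C) x : (forall y, norm1 (f (cexp (pt x y)) - b) <= e) ->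
    norm1 ((V x (2 * pi) - b * realC (2 * pi)) - (V x 0 - b * realC 0)) <= 2 * e * (2 * pi - 0).
  move=> hb; apply: (@cincrement R (fun y => V x y - b * realC y)
     (fun y => K (pt x y) - b)); first lra.
  move=> y hy; split; last exact: hb.
  have hc : cderive (fun y => b * realC y) y b.
    by apply: cderive_eq (cderiveZ b (cderive_id y)); rewrite mulr1.
  by apply: cderiveB hc; apply: hV; rewrite /M; apply/andP; split; lra.
have := lin _ _ hs1; have := lin _ _ hs2.
rewrite !realC0 !mulr0 !subr0.
set A := V s2 _; set B := V s2 _; set A' := V s1 _; set B' := V s1 _ => l2 l1 eq0.
have AB : A - B = A' - B'.
  have i0 : 'i != 0 :> C by exact: neq0Ci.
  by apply: (mulfI i0); rewrite -[LHS]subr0 -eq0; ring.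
have : norm1 ((al - be) * realC (2 * pi)) <= 2 * e * (2 * pi) + 2 * e * (2 * pi).
  have -> : (al - be) * realC (2 * pi) = (A - be * realC (2 * pi) - B) - (A' - al * realC (2 * pi) - B').
    have -> : A - be * realC (2 * pi) - B = (A - B) - be * realC (2 * pi) by ring.
    by rewrite AB; ring.
  exact: le_trans (norm1B _ _) (lerD l2 l1).
have -> : norm1 ((al - be) * realC (2 * pi)) = norm1 (al - be) * (2 * pi).
  by rewrite norm1Mr ger0_norm //; lra.
have -> : norm1 (al - be) = 5 * e by rewrite /e; field.
by nra.
Qed.

End Liouville.

(** * Liouville's theorem with quadratic growth *)

Section Liouville2.
Variable R : realType.
Local Notation C := (Cplx R).
Implicit Types (f g : C -> C) (a d w z : C).

Lemma dist_is_derive (f : R -> R) (x v : R) :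
  (forall e : R, 0 < e -> exists2 del : R, 0 < del &
    forall h, `|h| < del -> `|f (x + h) - f x - v * h| <= e * `|h|) ->
  is_derive x (1:R) f v.
Proof.
move=> H.
have hc : (fun h => h^-1 *: (f (h *: (1:R) + x) - f x)) @ 0^' --> v.
  apply/cvgrPdist_lt => e e0.
  have e20 : 0 < e / 2 by rewrite divr_gt0.
  have [del del0 hd] := H _ e20.
  apply/nearR; exists del => // h; rewrite subr0 => hh h0.
  rewrite /GRing.scale /= mulr1 [h + x]addrC.
  have -> : v - h^-1 * (f (x + h) - f x) = - (h^-1 * (f (x + h) - f x - v * h)).
    rewrite [in RHS]mulrBr [v * h]mulrC mulrA [h^-1 * h]mulVf // mul1r opprB //.
  rewrite normrN normrM normfV ltr_pdivrMl ?normr_gt0 //.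
  apply: le_lt_trans (hd _ hh) _; rewrite mulrC ltr_pM2l ?normr_gt0 //.
  by rewrite ltr_pdivrMr // mulr_natr mulr2n; lra.
have dv : derivable f x 1 by apply/cvg_ex; exists v.
by apply: DeriveDef => //; apply: cvg_lim hc.
Qed.

Lemma cderive_dist (F : R -> C) (t : R) v :
  (forall e : R, 0 < e -> exists2 del : R, 0 < del &
    forall h, `|h| < del -> norm1 (F (t + h) - F t - v * realC h) <= e * `|h|) ->
  cderive F t v.
Proof.
move=> H; split; apply: dist_is_derive => e e0; have [del del0 hd] := H e e0;
  exists del => // h hh; apply: le_trans (hd h hh); rewrite /norm1 !CcompE !mulr0 subr0 add0r.
  by rewrite lerDl.
by rewrite lerDr.
Qed.

Lemma dist_cderive (F : R -> C) (t : R) v : cderive F t v ->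
  forall e : R, 0 < e -> exists2 del : R, 0 < del &
    forall h, `|h| < del -> norm1 (F (t + h) - F t - v * realC h) <= e * `|h|.
Proof.
move=> [d1 d2] e e0; have e20 : 0 < e / 2 by rewrite divr_gt0.
have [a a0 ha] := is_derive_dist d1 e20; have [b b0 hb] := is_derive_dist d2 e20.
exists (Num.min a b); first by rewrite lt_min a0.
move=> h; rewrite lt_min => /andP[/ha {}ha /hb {}hb].
rewrite /norm1 !CcompE !mulr0 subr0 add0r.
by rewrite [e]splitr mulrDl; apply: lerD.
Qed.

Lemma cder_line f a v d (t : R) : cder f (a + realC t * v) d ->
  cderive (fun s => f (a + realC s * v)) t (d * v).
Proof.
move=> hf; apply: cderive_dist => e e0.
have n0 := norm1_ge0 v.
have e1 : 0 < e / (1 + norm1 v) by rewrite divr_gt0 //; lra.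
have [del del0 hd] := hf _ e1.
have dz (h : R) : a + realC (t + h) * v - (a + realC t * v) = realC h * v.
  by rewrite realCD; ring.
have nh (h : R) : norm1 (realC h * v) = norm1 v * `|h| by rewrite mulrC norm1Mr.
exists (del / (1 + norm1 v)); first by rewrite divr_gt0 //; lra.
move=> h; rewrite ltr_pdivlMr; last lra; move=> hh.
have h0 : 0 <= `|h| by [].
have := hd (a + realC (t + h) * v); rewrite dz nh.
have lt : norm1 v * `|h| < del by lra.
move=> /(_ lt); have -> : d * (realC h * v) = d * v * realC h by ring.
move=> hl; apply: le_trans hl _.
rewrite mulrA ler_wpM2r // mulrAC ler_pdivrMr; last lra.
by rewrite [leRHS]mulrDr; lra.
Qed.

Lemma cdiffB f g a : derivable f a 1 -> derivable g a 1 ->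
  derivable (fun z => f z - g z) a 1.
Proof. by move=> hf hg; apply: (derivableB hf hg). Qed.

Lemma cdiffD f g a : derivable f a 1 -> derivable g a 1 ->
  derivable (fun z => f z + g z) a 1.
Proof. by move=> hf hg; apply: (derivableD hf hg). Qed.

Lemma cdiffM f g a : derivable f a 1 -> derivable g a 1 ->
  derivable (fun z => f z * g z) a 1.
Proof. by move=> hf hg; apply: (derivableM hf hg). Qed.

Lemma cdiff_id a : derivable (fun z : C => z) a 1.
Proof. exact: derivable_id. Qed.

Lemma cdiff_cst (c : C) a : derivable (fun=> c) a 1.
Proof. exact: derivable_cst. Qed.

Lemma cder_const f : (forall a, cder f a 0) -> forall z, f z = f 0.
Proof.
move=> hf z; have h : norm1 (f (0 + realC 1 * z) - f (0 + realC 0 * z)) <= 2 * 0 * (1 - 0).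
  apply: (@cincrement R (fun t => f (0 + realC t * z)) (fun=> 0)) => // t _.
  by rewrite norm10; split => //; rewrite -(mul0r z); apply: cder_line.
move: h; rewrite mulr0 mul0r !add0r mul0r mul1r => h.
apply/eqP; rewrite -subr_eq0 -norm1_eq0; apply/eqP/le_anti.
by rewrite h norm1_ge0.
Qed.

Lemma norm1V z : norm1 z^-1 * norm1 z <= 4.
Proof.
have [->|z0] := eqVneq z 0; first by rewrite norm10 mulr0.
rewrite -realC_le realCM.
apply: le_trans (ler_pM _ _ (norm1_le_norm _) (norm1_le_norm _)) _.
- by rewrite realC_ge0 norm1_ge0.
- by rewrite realC_ge0 norm1_ge0.
rewrite mulrACA -normrM mulVf // normr1 mulr1.
by rewrite (realCn R 4) -natrM.
Qed.

(** The linear coefficient is the derivative of [g] at 0. Subtracting the linear and quadratic terms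
    leaves an entire [F] with [F z = o(z)] at infinity. For fixed [w] the quotient
    [(F (w + z) - F w) / z] tends to the derivative of [F] at [w] as [z] tends to 0, and to 0 at
    infinity; by [annulus] that derivative vanishes. *)
Theorem entire_quadratic f g :
  (forall z, derivable f z 1) -> derivable g 0 1 ->
  (\forall m \near (0 : C), m != 0 -> m ^+ 2 * f m^-1 = g m) ->
  exists c, forall z, f z = f 0 + c * z + g 0 * z ^+ 2.
Proof.
move=> df dg /nearC[rho rho0 hfg].
have [g1 hg1] := derivable_cder dg.
exists g1; pose F z := f z - (g1 * z + g 0 * (z * z)).
suff FF : forall z, F z = F 0.
  move=> z; have := FF z; rewrite /F !mulr0 addr0 subr0 => <-.
  by rewrite expr2; ring.
have dF z : derivable F z 1.
  have di := @cdiff_id z; have dc c := @cdiff_cst c z.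
  exact: cdiffB (df z) (cdiffD (cdiffM (dc g1) di) (cdiffM (dc (g 0)) (cdiffM di di))).
have small (e : R) : 0 < e -> exists2 N, 0 < N & forall z, N < norm1 z ->
    norm1 (F z) <= e * norm1 z.
  move=> e0; have e40 : 0 < e / 4 by rewrite divr_gt0.
  have [del del0 hd] := hg1 _ e40.
  (* Since [norm1 z^-1] is at most [4 / norm1 z], any constant above 4 puts [z^-1] in both
     neighbourhoods. *)
  exists (5 / Num.min rho del); first by rewrite divr_gt0 // lt_min rho0.
  move=> z hz.
  have mp : 0 < Num.min rho del by rewrite lt_min rho0.
  have nz : 0 < norm1 z by apply: lt_trans hz; rewrite divr_gt0.
  have z0 : z != 0 by rewrite -norm1_eq0 gt_eqF.
  have zi : norm1 z^-1 < Num.min rho del.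
    have h1 : norm1 z^-1 <= 4 / norm1 z by rewrite ler_pdivlMr // norm1V.
    apply: le_lt_trans h1 _; rewrite ltr_pdivrMr //.
    by move: hz; rewrite ltr_pdivrMr // mulrC; lra.
  move: zi; rewrite lt_min => /andP[zr zd].
  have := hfg z^-1; rewrite subr0 invrK invr_eq0 => /(_ zr z0) E.
  have := hd z^-1; rewrite subr0 => /(_ zd) H.
  have -> : F z = z * z * (g z^-1 - g 0 - g1 * z^-1).
    by rewrite -E /F; field.
  have nn := norm1_ge0 z.
  apply: le_trans (norm1M _ _) _.
  apply: le_trans (ler_pM (norm1_ge0 _) (norm1_ge0 _) (norm1M _ _) H) _.
  have -> : norm1 z * norm1 z * (e / 4 * norm1 z^-1) =
    e / 4 * norm1 z * (norm1 z^-1 * norm1 z) by ring.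
  apply: le_trans (ler_wpM2l _ (norm1V z)) _; first by rewrite mulr_ge0 // ltW.
  by rewrite le_eqVlt; apply/orP; left; apply/eqP; field.
apply: cder_const => w; have [d hd] := derivable_cder (dF w).
suff <- : d = 0 by [].
apply: (@annulus R (fun z => (F (w + z) - F w) / z)).
- move=> z z0; apply: derivable_cder.
  have dz : derivable (fun z => F (w + z)) z 1.
    have e : (fun h : C => h^-1 *: (F (w + (h *: 1 + z)) - F (w + z))) =
             (fun h => h^-1 *: (F (h *: 1 + (w + z)) - F (w + z))).
      by apply/funext => h; rewrite addrCA.
    by rewrite /derivable /= e; exact: dF.
  apply: cdiffM (cdiffB dz (@cdiff_cst (F w) z)) _.
  exact: derivableV z0 (@cdiff_id z).
- move=> e e0; have e40 : 0 < e / 4 by rewrite divr_gt0.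
  have [del del0 h] := hd _ e40; exists del => // z z0 hz.
  have := h (w + z); have -> : w + z - w = z by ring.
  move=> /(_ hz) {}h.
  have -> : (F (w + z) - F w) / z - d = (F (w + z) - F w - d * z) * z^-1 by field.
  apply: le_trans (norm1M _ _) _.
  apply: le_trans (ler_wpM2r (norm1_ge0 _) h) _.
  have -> : e / 4 * norm1 z * norm1 z^-1 = e / 4 * (norm1 z^-1 * norm1 z) by ring.
  apply: le_trans (ler_wpM2l (ltW e40) (norm1V z)) _.
  by rewrite le_eqVlt; apply/orP; left; apply/eqP; field.
move=> e e0; have e160 : 0 < e / 16 by rewrite divr_gt0.
have [N N0 hN] := small _ e160.
have w0 := norm1_ge0 w; have Fw0 := norm1_ge0 (F w).
(* The three summands give, in turn with [norm1 w], that [w + z] lies beyond [N], that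
   [norm1 (w + z)] is at most [2 * norm1 z], and that [norm1 (F w)] is at most [e / 8 * norm1 z]. *)
exists (N + norm1 w + 8 * norm1 (F w) / e) => z hz.
have q0 : 0 <= 8 * norm1 (F w) / e by rewrite divr_ge0 // ?(ltW e0) // mulr_ge0.
have nz : 0 < norm1 z by lra.
have z0 : z != 0 by rewrite -norm1_eq0 gt_eqF.
have wz : norm1 z <= norm1 (w + z) + norm1 w.
  by have := norm1B (w + z) w; have -> : w + z - w = z by ring.
have big : N < norm1 (w + z) by lra.
have wz' : norm1 (w + z) <= 2 * norm1 z by have := norm1D w z; lra.
have k1 := hN _ big.
rewrite subr0; apply: le_trans (norm1M _ _) _.
have k2 : norm1 (F (w + z) - F w) <= e / 4 * norm1 z.
  apply: le_trans (norm1B _ _) _.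
  have k3 : norm1 (F (w + z)) <= e / 8 * norm1 z.
    apply: le_trans k1 _; have -> : e / 8 * norm1 z = e / 16 * (2 * norm1 z) by field.
    by rewrite ler_wpM2l // ltW.
  have k4 : norm1 (F w) <= e / 8 * norm1 z.
    have : 8 * norm1 (F w) / e <= norm1 z by lra.
    by rewrite ler_pdivrMr //; lra.
  by have := lerD k3 k4; lra.
apply: le_trans (ler_wpM2r (norm1_ge0 _) k2) _.
have -> : e / 4 * norm1 z * norm1 z^-1 = e / 4 * (norm1 z^-1 * norm1 z) by ring.
have e40 : 0 < e / 4 by rewrite divr_gt0.
apply: le_trans (ler_wpM2l (ltW e40) (norm1V z)) _.
by rewrite le_eqVlt; apply/orP; left; apply/eqP; field.
Qed.

End Liouville2.
(** * Calculus in charts *)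

Section CDeriveMore.
Variable R : realType.
Local Notation C := (Cplx R).

Lemma cderive_shift (F : R -> C) t v : cderive (fun s => F (t + s)) 0 v <-> cderive F t v.
Proof.
split=> h; apply: cderive_dist => e e0; have [del del0 hd] := dist_cderive h e0;
  exists del => // s /hd; by rewrite add0r ?addr0.
Qed.

(** The inverse is the conjugate divided by the real function |F|^2, which reduces the rule to the
    real one. *)
Lemma cderiveV (F : R -> C) t v : F t != 0 -> cderive F t v ->
  cderive (fun s => (F s)^-1) t (- v / F t ^+ 2).
Proof.
move=> F0 hF; pose N s := ReC (F s) ^+ 2 + ImC (F s) ^+ 2.
have NE s : realC (N s) = F s * (F s)^*.
  by apply: Ceq; rewrite !CcompE /N; ring.
have N0 : N t != 0 by rewrite -realC_eq0 NE mulf_neq0 // fmorph_eq0.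
have inv s : (F s)^-1 = (F s)^* * realC (N s)^-1.
  rewrite realCV NE; have [->|Fs] := eqVneq (F s) 0; first by rewrite invr0 rmorph0 mul0r.
  by rewrite invfM mulrCA divff ?mulr1 // fmorph_eq0.
have dN : is_derive t (1:R) N (2 * ReC (F t) * ReC v + 2 * ImC (F t) * ImC v).
  case: hF => a b.
  apply: (is_derive_eq (@is_deriveD _ _ _ _ _ _ _ _ _ (is_deriveM a a) (is_deriveM b b))).
  by rewrite /GRing.scale /=; ring.
have dNC := cderive_real (is_deriveV N0 dN).
have h := cderiveM (cderive_conj hF) dNC.
under eq_fun do rewrite inv.
apply: cderive_eq h.
have -> : realC (N t)^-1 = (F t)^-1 * ((F t)^*)^-1 by rewrite realCV NE invfM.
rewrite /GRing.scale /= realCM realCN -exprVn.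
have -> : realC ((N t)^-1 ^+ 2) = ((F t)^-1 * ((F t)^*)^-1) ^+ 2.
  by rewrite expr2 realCM realCV NE invfM [RHS]expr2.
have -> : realC (2 * ReC (F t) * ReC v + 2 * ImC (F t) * ImC v) = F t * v^* + (F t)^* * v.
  by apply: Ceq; rewrite !CcompE; ring.
by field; rewrite F0 fmorph_eq0.
Qed.

Lemma cincrement_abs (F g : R -> C) (a b B : R) :
  (forall x, Num.min a b <= x <= Num.max a b -> cderive F x (g x) /\ norm1 (g x) <= B) ->
  norm1 (F b - F a) <= 2 * B * `|b - a|.
Proof.
have [ab|ba] := leP a b => h.
  rewrite ger0_norm ?subr_ge0 //; exact: cincrement h.
rewrite -norm1N opprB ler0_norm ?subr_le0 ?(ltW ba) // opprB.
by apply: cincrement h; apply: ltW.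
Qed.

End CDeriveMore.

(** * Partial derivatives in a chart *)

Section ChartCalculus.
Variables (R : realType) (S : riemannSurface R).
Local Notation C := (Cplx R).
Implicit Types (i j : rs_idx S) (f g : S -> C) (p x : S) (b : bool) (v : C).

Lemma has_pdP i v f p d : cderive (coord_line i v f p) 0 d <->
  has_pd i v f p /\ pd i v f p = d.
Proof.
split.
  move=> [[a1 a2] [b1 b2]]; split; first by split.
  by rewrite /pd !derive1E a2 b2 -Cdecomp.
move=> [[a b] <-]; rewrite /pd !derive1E; split; rewrite !CcompE.
  by rewrite mulr0 mul0r subrr addr0; apply: derivableP.
by rewrite mul1r mulr0 add0r add0r; apply: derivableP.
Qed.

Lemma pd_cderive i v f p : has_pd i v f p -> cderive (coord_line i v f p) 0 (pd i v f p).
Proof. by move=> h; apply/has_pdP. Qed.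

Lemma rs_zinvK i w : (rs_z i @` rs_dom i) w ->
  rs_dom i (rs_zinv i w) /\ rs_z i (rs_zinv i w) = w.
Proof. by move=> [x dx <-]; rewrite rs_zK. Qed.

Lemma near_zinv i p (A : set S) : rs_dom i p -> nbhs p A ->
  \forall w \near rs_z i p, (rs_z i @` rs_dom i) w /\ A (rs_zinv i w).
Proof.
move=> dp Ap; have im : (rs_z i @` rs_dom i) (rs_z i p) by exists p.
apply: filterI; first by apply: open_nbhs_nbhs; split => //; exact: rs_open_img.
apply: (rs_zinv_cont im); by rewrite rs_zK.
Qed.

Lemma near_coord i p v (A : set S) : rs_dom i p -> nbhs p A ->
  \forall t \near (0 : R), A (rs_zinv i (rs_z i p + realC t * v)).
Proof.
move=> dp Ap; have /nearC[e e0 h] := near_zinv dp Ap.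
have n0 := norm1_ge0 v.
apply/nearR; exists (e / (1 + norm1 v)); first by rewrite divr_gt0 //; lra.
move=> t; rewrite subr0 ltr_pdivlMr; last lra; move=> ht.
suff lt : norm1 (rs_z i p + realC t * v - rs_z i p) < e by have [] := h _ lt.
have -> : rs_z i p + realC t * v - rs_z i p = v * realC t by ring.
rewrite norm1Mr; have t0 : 0 <= `|t| by [].
by lra.
Qed.

Lemma coord_line0 i v f p : rs_dom i p -> coord_line i v f p 0 = f p.
Proof. by move=> dp; rewrite /coord_line realC0 mul0r addr0 rs_zK. Qed.

Lemma cderive_local i v f g p d : rs_dom i p -> (\forall x \near p, f x = g x) ->
  cderive (coord_line i v f p) 0 d -> cderive (coord_line i v g p) 0 d.
Proof.
move=> dp fg; apply: cderive_near.
exact: (near_coord v dp fg).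
Qed.

Lemma pd_local i v f g p : rs_dom i p -> (\forall x \near p, f x = g x) ->
  has_pd i v f p -> has_pd i v g p /\ pd i v g p = pd i v f p.
Proof.
by move=> dp fg /pd_cderive h; apply/has_pdP; apply: cderive_local h.
Qed.

Lemma pd_near_eq i v f g p : rs_dom i p -> (\forall x \near p, f x = g x) ->
  pd i v f p = pd i v g p.
Proof.
move=> dp fg; rewrite /pd.
have e : \forall t \near (0:R), coord_line i v f p t = coord_line i v g p t.
  exact: (near_coord v dp fg).
by congr (realC _ + 'i * realC _); rewrite !derive1E; apply: near_eq_derive;
  near=> t; rewrite (near e t).
Unshelve. all: by end_near. Qed.

Lemma pdD i v f g p : has_pd i v f p -> has_pd i v g p ->
  has_pd i v (fun x => f x + g x) p /\
  pd i v (fun x => f x + g x) p = pd i v f p + pd i v g p.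
Proof. by move=> /pd_cderive h /pd_cderive k; apply/has_pdP; apply: cderiveD. Qed.

Lemma pdN i v f p : has_pd i v f p ->
  has_pd i v (fun x => - f x) p /\ pd i v (fun x => - f x) p = - pd i v f p.
Proof. by move=> /pd_cderive h; apply/has_pdP; apply: cderiveN. Qed.

Lemma pdM i v f g p : rs_dom i p -> has_pd i v f p -> has_pd i v g p ->
  has_pd i v (fun x => f x * g x) p /\
  pd i v (fun x => f x * g x) p = pd i v f p * g p + f p * pd i v g p.
Proof.
move=> dp /pd_cderive h /pd_cderive k; apply/has_pdP.
by have := cderiveM h k; rewrite !coord_line0.
Qed.

Lemma pd_cst i v (c : C) p :
  has_pd i v (fun=> c) p /\ pd i v (fun=> c : C) p = 0.
Proof. by apply/has_pdP; apply: cderive_cst. Qed.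

Lemma pd_conj i v f p : has_pd i v f p ->
  has_pd i v (fun x => (f x)^*) p /\ pd i v (fun x => (f x)^*) p = (pd i v f p)^*.
Proof. by move=> /pd_cderive h; apply/has_pdP; apply: cderive_conj. Qed.

Lemma pdV i v f p : rs_dom i p -> f p != 0 -> has_pd i v f p ->
  has_pd i v (fun x => (f x)^-1) p /\
  pd i v (fun x => (f x)^-1) p = - pd i v f p / f p ^+ 2.
Proof.
move=> dp f0 /pd_cderive h; apply/has_pdP.
by have := @cderiveV R _ _ _ _ h; rewrite !coord_line0 //; apply.
Qed.

End ChartCalculus.

(** * Smooth functions in a chart and the operators d/dz, d/dzbar *)

Section ChartSmooth.
Variables (R : realType) (S : riemannSurface R).
Local Notation C := (Cplx R).
Implicit Types (i j : rs_idx S) (f g : S -> C) (p x : S) (b : bool) (v : C).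
Implicit Types (U W : set S) (n : nat).

(* C^n in the single chart [i] *)
Fixpoint smn i U n f : Prop :=
  (forall p, U p -> {for p, continuous f}) /\
  if n is m.+1 then
    (forall p, U p -> forall b, has_pd i (dir R b) f p) /\
    forall b, smn i U m (pd i (dir R b) f)
  else True.

Definition sm i U f : Prop := forall n, smn i U n f.

Lemma pds_rcons i s b f : pds i (rcons s b) f = pds i s (pd i (dir R b) f).
Proof. by rewrite /pds foldr_rcons. Qed.

(** [pds] applies the last direction of the list first, and that is the derivative which [smn] peels
    off; hence the induction from the right end of the list. *)
Lemma smn_pds i U f : sm i U f <-> (forall s p, U p ->
  (forall b, has_pd i (dir R b) (pds i s f) p) /\ {for p, continuous (pds i s f)}).
Proof.
split=> [h s p Up|h n].
  elim/last_ind: s f h => [|s b IH] f h.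
    have [c0 [d0 _]] := h 1%N; split; last exact: c0.
    by move=> b; apply: d0.
  rewrite pds_rcons; apply: IH => n.
  by have [_ [_]] := h n.+1; apply.
elim: n f h => [|n IH] f h; split=> //; try by move=> p /(h [::])[].
split=> [p Up b|b]; first by have [] := h [::] p Up.
by apply: IH => s p Up; rewrite -pds_rcons; apply: h.
Qed.

Lemma smooth_sm W f : smooth W f <-> (forall i, sm i (W `&` rs_dom i) f).
Proof.
split=> [h i|h i s p Wp dp].
  by apply/smn_pds => s p [Wp dp]; apply: h.
by have /smn_pds := h i; apply.
Qed.

Lemma smn_pd i U f n b : smn i U n.+1 f -> smn i U n (pd i (dir R b) f).
Proof. by case=> _ [_]; apply. Qed.
Lemma smn_has i U f n p b : smn i U n.+1 f -> U p -> has_pd i (dir R b) f p.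
Proof. by case=> _ [h _] Up; apply: h. Qed.
Lemma smn_cont i U f n p : smn i U n f -> U p -> {for p, continuous f}.
Proof. by case: n => [|n] [h _]; apply: h. Qed.
Lemma smnS i U f n : smn i U n.+1 f -> smn i U n f.
Proof.
elim: n f => [|n IH] f h; split=> //; try by move=> p; apply: smn_cont h.
split=> [p Up b|b]; first exact: smn_has h Up.
by apply: IH; apply: smn_pd.
Qed.
Lemma sm_pd i U f b : sm i U f -> sm i U (pd i (dir R b) f).
Proof. by move=> h n; apply: smn_pd. Qed.
Lemma sm_has i U f p b : sm i U f -> U p -> has_pd i (dir R b) f p.
Proof. by move=> h; apply: smn_has (h 1%N). Qed.
Lemma sm_cont i U f p : sm i U f -> U p -> {for p, continuous f}.
Proof. by move=> h; apply: smn_cont (h 0%N). Qed.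

Lemma smn_sub i U W f n : W `<=` U -> smn i U n f -> smn i W n f.
Proof.
move=> UW; elim: n f => [|n IH] f h; split=> //; try by move=> p /UW; apply: smn_cont h.
split=> [p /UW Up b|b]; first exact: smn_has h Up.
by apply: IH; apply: smn_pd h.
Qed.
Lemma sm_sub i U W f : W `<=` U -> sm i U f -> sm i W f.
Proof. by move=> WU h n; apply: smn_sub (h n). Qed.

Section Fixed.
Variables (i : rs_idx S) (U : set S).
Hypotheses (oU : open U) (Ud : U `<=` rs_dom i).

Let nearU p : U p -> \forall x \near p, U x.
Proof. by move=> Up; apply: open_nbhs_nbhs. Qed.

Lemma smn_ext f g n : (forall x, U x -> f x = g x) -> smn i U n f -> smn i U n g.
Proof.
have near_eq f' g' p : (forall x, U x -> f' x = g' x) -> U p -> \forall x \near p, f' x = g' x.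
  by move=> fg Up; near=> x; apply: fg; near: x; apply: nearU.
have cg f' g' p m : (forall x, U x -> f' x = g' x) -> smn i U m f' -> U p ->
    {for p, continuous g'}.
  move=> fg h Up; have /continuousC hc := smn_cont h Up.
  apply/continuousC => e /hc; rewrite -(fg p Up).
  by apply: filterS2 (nearU Up) => x Ux; rewrite (fg x Ux).
elim: n f g => [|n IH] f g fg h; split=> //; try by move=> p; apply: cg fg h.
split=> [p Up b|b].
  by have [] := pd_local (Ud Up) (near_eq _ _ _ fg Up) (smn_has b h Up).
apply: IH (smn_pd b h) => x Ux.
by have [_ ->] := pd_local (Ud Ux) (near_eq _ _ _ fg Ux) (smn_has b h Ux).
Unshelve. all: by end_near. Qed.

Lemma sm_ext f g : (forall x, U x -> f x = g x) -> sm i U f -> sm i U g.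
Proof. by move=> fg h n; apply: smn_ext fg (h n). Qed.

Lemma smn_cst (c : C) n : smn i U n (fun=> c).
Proof.
elim: n c => [|n IH] c; split => //; try by move=> p _; exact: cst_continuous.
split=> [p Up b|b]; first by have [] := pd_cst i (dir R b) c p.
apply: (@smn_ext (fun=> 0)); last exact: IH.
by move=> x _; have [_ ->] := pd_cst i (dir R b) c x.
Qed.

Lemma smnD f g n : smn i U n f -> smn i U n g -> smn i U n (fun x => f x + g x).
Proof.
elim: n f g => [|n IH] f g hf hg; split=> //.
all: try by move=> p Up; apply: cvgD; [exact: smn_cont hf Up|exact: smn_cont hg Up].
split=> [p Up b|b].
  by have [] := pdD (smn_has b hf Up) (smn_has b hg Up).
apply: smn_ext (IH _ _ (smn_pd b hf) (smn_pd b hg)).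
by move=> x Ux; have [_ ->] := pdD (smn_has b hf Ux) (smn_has b hg Ux).
Qed.

Lemma smnM f g n : smn i U n f -> smn i U n g -> smn i U n (fun x => f x * g x).
Proof.
elim: n f g => [|n IH] f g hf hg; split=> //.
all: try by move=> p Up; apply: cvgM; [exact: smn_cont hf Up|exact: smn_cont hg Up].
split=> [p Up b|b].
  by have [] := pdM (Ud Up) (smn_has b hf Up) (smn_has b hg Up).
apply: smn_ext (smnD (IH _ _ (smn_pd b hf) (smnS hg)) (IH _ _ (smnS hf) (smn_pd b hg))).
by move=> x Ux; have [_ ->] := pdM (Ud Ux) (smn_has b hf Ux) (smn_has b hg Ux).
Qed.

Lemma smnV f n : (forall x, U x -> f x != 0) -> smn i U n f ->
  smn i U n (fun x => (f x)^-1).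
Proof.
move=> f0; elim: n => [|n IH] hf; split=> //.
all: try by move=> p Up; apply: cvgV; [exact: f0|exact: smn_cont hf Up].
have k := IH (smnS hf).
split=> [p Up b|b].
  by have [] := pdV (Ud Up) (f0 _ Up) (smn_has b hf Up).
apply: smn_ext (smnM (smnM (smn_cst (-1) n) (smn_pd b hf)) (smnM k k)).
move=> x Ux; have [_ ->] := pdV (Ud Ux) (f0 _ Ux) (smn_has b hf Ux).
by rewrite mulN1r expr2 invfM.
Qed.

Lemma sm_cst (c : C) : sm i U (fun=> c). Proof. by move=> n; apply: smn_cst. Qed.
Lemma smD f g : sm i U f -> sm i U g -> sm i U (fun x => f x + g x).
Proof. by move=> a b n; apply: smnD. Qed.
Lemma smM f g : sm i U f -> sm i U g -> sm i U (fun x => f x * g x).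
Proof. by move=> a b n; apply: smnM. Qed.
Lemma smN f : sm i U f -> sm i U (fun x => - f x).
Proof.
move=> h; apply: sm_ext (smM (sm_cst (-1)) h) => x _; exact: mulN1r.
Qed.
Lemma smV f : (forall x, U x -> f x != 0) -> sm i U f -> sm i U (fun x => (f x)^-1).
Proof. by move=> a h n; apply: smnV. Qed.
Lemma sm_sum (I : Type) (r : seq I) (F : I -> S -> C) :
  (forall k, sm i U (F k)) -> sm i U (fun x => \sum_(k <- r) F k x).
Proof.
move=> h; elim: r => [|k r IH].
  by apply: sm_ext (sm_cst 0) => x _; rewrite big_nil.
by apply: sm_ext (smD (h k) IH) => x _; rewrite big_cons.
Qed.

End Fixed.

(* [true] for d/dz, [false] for d/dzbar *)
Definition cd b i f p : C := if b then dz i f p else dzb i f p.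

Lemma cdE b i f p : cd b i f p =
  (pd i 1 f p + (if b then - 'i else 'i) * pd i 'i f p) / 2.
Proof. by case: b; rewrite /cd /dz /dzb ?mulNr. Qed.

Definition C1 i f p : Prop := has_pd i 1 f p /\ has_pd i 'i f p.

Lemma sm_C1 i U f p : sm i U f -> U p -> C1 i f p.
Proof. by move=> h Up; split; [exact: (sm_has false h Up)|exact: (sm_has true h Up)]. Qed.

Lemma sm_cd i U f b : open U -> U `<=` rs_dom i -> sm i U f -> sm i U (cd b i f).
Proof.
move=> oU Ud h.
have h1 : sm i U (pd i 1 f) by apply: (sm_pd false h).
have h2 : sm i U (pd i 'i f) by apply: (sm_pd true h).
have c (a : C) := sm_cst oU Ud a.
apply: (sm_ext oU Ud _ (smM oU Ud (smD oU Ud h1 (smM oU Ud (c _) h2)) (c 2^-1))).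
by move=> x _; rewrite cdE.
Qed.

Section Rules.
Variables (i : rs_idx S) (p : S).
Hypothesis dp : rs_dom i p.

Lemma C1D f g : C1 i f p -> C1 i g p -> C1 i (fun x => f x + g x) p.
Proof. by move=> [a1 a2] [b1 b2]; split; [have [] := pdD a1 b1|have [] := pdD a2 b2]. Qed.
Lemma C1M f g : C1 i f p -> C1 i g p -> C1 i (fun x => f x * g x) p.
Proof. by move=> [a1 a2] [b1 b2]; split; [have [] := pdM dp a1 b1|have [] := pdM dp a2 b2]. Qed.
Lemma C1_cst (c : C) : C1 i (fun=> c) p.
Proof. by split; [have [] := pd_cst i 1 c p|have [] := pd_cst i 'i c p]. Qed.
Lemma C1V f : f p != 0 -> C1 i f p -> C1 i (fun x => (f x)^-1) p.
Proof. by move=> f0 [a1 a2]; split; [have [] := pdV dp f0 a1|have [] := pdV dp f0 a2]. Qed.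
Lemma C1_local f g : (\forall x \near p, f x = g x) -> C1 i f p -> C1 i g p.
Proof. by move=> h [a1 a2]; split; [have [] := pd_local dp h a1|have [] := pd_local dp h a2]. Qed.

Lemma cd_local b f g : (\forall x \near p, f x = g x) -> cd b i f p = cd b i g p.
Proof. by move=> h; rewrite !cdE !(pd_near_eq _ dp h). Qed.
Lemma cdD b f g : C1 i f p -> C1 i g p ->
  cd b i (fun x => f x + g x) p = cd b i f p + cd b i g p.
Proof.
move=> [a1 a2] [b1 b2]; rewrite !cdE.
have [_ ->] := pdD a1 b1; have [_ ->] := pdD a2 b2.
by move: (pd _ _ f p) (pd _ _ g p) (pd _ _ f p) (pd _ _ g p) => x1 x2 x3 x4; field.
Qed.
Lemma cdN b f : C1 i f p -> cd b i (fun x => - f x) p = - cd b i f p.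
Proof.
by move=> [a1 a2]; rewrite !cdE; have [_ ->] := pdN a1; have [_ ->] := pdN a2; field.
Qed.
Lemma cdM b f g : C1 i f p -> C1 i g p ->
  cd b i (fun x => f x * g x) p = cd b i f p * g p + f p * cd b i g p.
Proof.
move=> [a1 a2] [b1 b2]; rewrite !cdE.
have [_ ->] := pdM dp a1 b1; have [_ ->] := pdM dp a2 b2.
by move: (pd _ _ f p) (pd _ _ g p) (pd _ _ f p) (pd _ _ g p) => x1 x2 x3 x4; field.
Qed.
Lemma cd_cst b (c : C) : cd b i (fun=> c) p = 0.
Proof.
rewrite !cdE; have [_ ->] := pd_cst i 1 c p; have [_ ->] := pd_cst i 'i c p.
by rewrite mulr0 addr0 mul0r.
Qed.
Lemma cd_conj b f : C1 i f p -> cd b i (fun x => (f x)^*) p = (cd (~~ b) i f p)^*.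
Proof.
move=> [a1 a2]; rewrite !cdE; have [_ ->] := pd_conj a1; have [_ ->] := pd_conj a2.
move: (pd i 1 f p) (pd i 'i f p) => x y.
rewrite rmorphM rmorphD rmorphM /= fmorphV rmorph_nat.
by case: b => /=; rewrite ?rmorphN /= conjCi ?opprK.
Qed.
End Rules.
End ChartSmooth.

(** * Symmetry of second derivatives and first order expansion *)

Section Schwarz.
Variables (R : realType) (S : riemannSurface R) (i : rs_idx S) (U : set S).
Local Notation C := (Cplx R).
Hypotheses (oU : open U) (Ud : U `<=` rs_dom i).
Implicit Types (f : S -> C) (p : S) (b : bool) (v : C).

Lemma norm1_conj (z : C) : norm1 z^* = norm1 z.
Proof. by rewrite /norm1 !CcompE normrN. Qed.

Lemma line_cderive f (a v : C) (t : R) (w := a + realC t * v) :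
  (rs_z i @` rs_dom i) w -> has_pd i v f (rs_zinv i w) ->
  cderive (fun s => f (rs_zinv i (a + realC s * v))) t (pd i v f (rs_zinv i w)).
Proof.
move=> /rs_zinvK[_ zw] /pd_cderive h; apply/cderive_shift.
have e : coord_line i v f (rs_zinv i w) = fun s => f (rs_zinv i (a + realC (t + s) * v)).
  by apply/funext => s; rewrite /coord_line zw /w realCD mulrDl addrA.
by rewrite -e.
Qed.

Lemma near_zinvU p : U p -> exists2 rho : R, 0 < rho & forall w : C,
  norm1 (w - rs_z i p) < rho -> (rs_z i @` rs_dom i) w /\ U (rs_zinv i w).
Proof.
move=> Up; apply/nearC; apply: near_zinv; first exact: Ud.
exact: open_nbhs_nbhs.
Qed.

Lemma chart_cont f p : U p -> {for p, continuous f} -> forall e : R, 0 < e ->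
  exists2 rho : R, 0 < rho & forall w : C,
  norm1 (w - rs_z i p) < rho -> norm1 (f (rs_zinv i w) - f p) < e.
Proof.
move=> Up /continuousC h e /h he; apply/nearC.
by have := near_zinv (Ud Up) he; apply: filterS => w [].
Qed.

(** The mean value estimate, applied in one variable after the other, compares the second difference
    over a square of side [h] with [h ^+ 2] times a mixed derivative. The two values of [b] give the
    two orders of differentiation for the same second difference. *)
Lemma mixed_difference b f p e (d1 := dir R b) (d2 := dir R (~~ b))
    (G := fun s t : R => f (rs_zinv i (rs_z i p + realC s * d1 + realC t * d2))) :
  smn i U 2 f -> U p -> 0 < e -> exists2 del : R, 0 < del & forall h, 0 < h < del ->
  norm1 (G h h - G h 0 - (G 0 h - G 0 0)
    - realC h * realC h * pd i d2 (pd i d1 f) p) <= 4 * e * h * h.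
Proof.
move=> hf Up e0; set c := pd i d2 (pd i d1 f) p.
have hf1 : smn i U 1 (pd i d1 f) by apply: smn_pd hf.
have hf2 : smn i U 0 (pd i d2 (pd i d1 f)) by apply: smn_pd hf1.
have [r1 r10 h1] := near_zinvU Up.
have [r2 r20 h2] := chart_cont Up (smn_cont hf2 Up) e0.
exists (Num.min r1 r2 / 2); first by rewrite divr_gt0 // lt_min r10.
move=> h /andP[h0]; rewrite ltr_pdivlMr // lt_min => /andP[hr1 hr2].
have ndir b' (t : R) : norm1 (realC t * dir R b') = `|t|.
  by case: b' => /=; rewrite ?mulr1 1?mulrC ?norm1i norm1r.
have nd s t : 0 <= s <= h -> 0 <= t <= h ->
    norm1 (rs_z i p + realC s * d1 + realC t * d2 - rs_z i p) <= h * 2.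
  move=> /andP[s0 sh] /andP[t0 th].
  have -> : rs_z i p + realC s * d1 + realC t * d2 - rs_z i p = realC s * d1 + realC t * d2 by ring.
  apply: le_trans (norm1D _ _) _.
  by rewrite !ndir !ger0_norm //; lra.
have pdF b' (g : S -> C) s t : smn i U 1 g -> 0 <= s <= h -> 0 <= t <= h ->
   has_pd i (dir R b') g (rs_zinv i (rs_z i p + realC s * d1 + realC t * d2)).
  move=> hg hs ht; have [_ hU] := h1 _ (le_lt_trans (nd s t hs ht) hr1).
  exact: smn_has hg hU.
have im s t hs ht := (h1 _ (le_lt_trans (nd s t hs ht) hr1)).1.
have h0h : 0 <= h <= h by rewrite lexx ltW.
have h00 : (0:R) <= 0 <= h by apply/andP; split; [exact: lexx|exact: ltW].
pose P1 s t := pd i d1 f (rs_zinv i (rs_z i p + realC s * d1 + realC t * d2)).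
have dpsi s t : 0 <= s <= h -> 0 <= t <= h ->
  cderive (fun t => P1 s t) t (pd i d2 (pd i d1 f) (rs_zinv i (rs_z i p + realC s * d1 + realC t * d2))).
  by move=> hs ht; apply: line_cderive; [exact: im|exact: pdF].
have dphi s t : 0 <= s <= h -> 0 <= t <= h -> cderive (fun s => G s t) s (P1 s t).
  move=> hs ht; rewrite /G /P1.
  have -> : (fun s => f (rs_zinv i (rs_z i p + realC s * d1 + realC t * d2))) =
     (fun s => f (rs_zinv i (rs_z i p + realC t * d2 + realC s * d1))).
    by apply/funext => s'; rewrite addrAC.
  have := im s t hs ht; have := pdF b f s t (smnS hf) hs ht; rewrite [_ + _ + _]addrAC.
  by move=> A B; apply: line_cderive.
have bound1 s : 0 <= s <= h -> norm1 (P1 s h - P1 s 0 - realC h * c) <= 2 * e * h.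
  move=> hs.
  have := @cincrement R (fun t => P1 s t - c * realC t)
    (fun t => pd i d2 (pd i d1 f) (rs_zinv i (rs_z i p + realC s * d1 + realC t * d2)) - c)
    0 h e (ltW h0).
  rewrite realC0 !mulr0 !subr0 => H; have -> : P1 s h - P1 s 0 - realC h * c = P1 s h - c * realC h - P1 s 0.
    by rewrite addrAC [realC h * c]mulrC.
  apply: H => t ht; split.
    apply: cderiveB; first exact: dpsi.
    by apply: cderive_eq (cderiveZ c (cderive_id t)); rewrite mulr1.
  by apply: ltW; apply: h2; apply: le_lt_trans (nd s t hs ht) hr2.
have := @cincrement R (fun s => G s h - G s 0 - realC s * (realC h * c))
    (fun s => P1 s h - P1 s 0 - realC h * c) 0 h (2 * e * h) (ltW h0).
rewrite realC0 mul0r !subr0 => H.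
have -> : G h h - G h 0 - (G 0 h - G 0 0) - realC h * realC h * c =
  G h h - G h 0 - realC h * (realC h * c) - (G 0 h - G 0 0) by ring.
have -> : 4 * e * h * h = 2 * (2 * e * h) * h by ring.
apply: H => s hs; split; last exact: bound1.
apply: cderiveB; first by apply: cderiveB; apply: dphi.
have := cderiveM (cderive_id s) (cderive_cst (realC h * c) s).
by apply: cderive_eq; rewrite mul1r mulr0 addr0.
Qed.

Let absurd (x y : R) : 0 < x * (y * y) ->
  9 * x * (y * y) <= 4 * x * y * y + 4 * x * y * y -> False.
Proof. by move=> *; lra. Qed.

Lemma pd_comm f p : smn i U 2 f -> U p ->
  pd i 'i (pd i 1 f) p = pd i 1 (pd i 'i f) p.
Proof.
move=> hf Up; set c := LHS; set c' := RHS.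
apply/eqP; rewrite -subr_eq0 -norm1_eq0; apply/negPn/negP => N0.
have eta0 : 0 < norm1 (c - c') by rewrite lt_neqAle eq_sym N0 norm1_ge0.
(* Each of the two estimates allows an error [4 * e * h * h]; their sum 8 stays below 9. *)
pose e := norm1 (c - c') / 9.
have e0 : 0 < e by rewrite divr_gt0.
have [a a0 ha] := mixed_difference false hf Up e0.
have [b b0 hb] := mixed_difference true hf Up e0.
pose h := Num.min a b / 2.
have h0 : 0 < h by rewrite divr_gt0 // lt_min a0.
have hab : h < Num.min a b.
  have m0 : 0 < Num.min a b by rewrite lt_min a0.
  by rewrite /h; lra.
move: hab; rewrite lt_min => /andP[h_a h_b].
have {ha} := ha h; rewrite h0 h_a => /(_ isT).
have {hb} := hb h; rewrite h0 h_b => /(_ isT) /=.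
rewrite -/c -/c' !realC0 !mul0r !addr0.
rewrite [rs_z i p + realC h * 'i + _]addrAC.
set X := f _; set Y := f _; set Z := f _; set T := f _ => k1 k2.
have : norm1 ((c - c') * realC (h * h)) <= 4 * e * h * h + 4 * e * h * h.
  have -> : (c - c') * realC (h * h) = (X - Y - (Z - T) - realC h * realC h * c') -
      (X - Z - (Y - T) - realC h * realC h * c) by rewrite realCM; ring.
  exact: le_trans (norm1B _ _) (lerD k1 k2).
rewrite norm1Mr ger0_norm; last by rewrite mulr_ge0 // ltW.
have -> : norm1 (c - c') = 9 * e by rewrite /e; field.
exact: absurd (mulr_gt0 e0 (mulr_gt0 h0 h0)).
Qed.

Lemma cd_comm f p : smn i U 2 f -> U p ->
  cd true i (cd false i f) p = cd false i (cd true i f) p.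
Proof.
move=> hf Up; have dp := Ud Up.
have hx : C1 i (pd i 1 f) p.
  split; [exact: (smn_has false (smn_pd false hf) Up)|exact: (smn_has true (smn_pd false hf) Up)].
have hy : C1 i (pd i 'i f) p.
  split; [exact: (smn_has false (smn_pd true hf) Up)|exact: (smn_has true (smn_pd true hf) Up)].
have lin b (a c : C) : cd b i (fun x => (pd i 1 f x + a * pd i 'i f x) * c) p =
    (cd b i (pd i 1 f) p + a * cd b i (pd i 'i f) p) * c.
  have k (x : C) := C1_cst i p x; have m := C1M dp (k a) hy.
  rewrite (cdM dp b (C1D hx m) (k c)) (cdD b hx m) (cdM dp b (k a) hy) !cd_cst.
  by rewrite mul0r mulr0 add0r addr0.
have -> : cd false i f = fun x => (pd i 1 f x + 'i * pd i 'i f x) * 2^-1.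
  by apply/funext => x; rewrite cdE.
have -> : cd true i f = fun x => (pd i 1 f x + - 'i * pd i 'i f x) * 2^-1.
  by apply/funext => x; rewrite cdE.
rewrite !lin.
rewrite !cdE (pd_comm hf Up).
move: (pd i 1 (pd i 1 f) p) (pd i 1 (pd i 'i f) p) (pd i 'i (pd i 'i f) p) => a b c.
ring.
Qed.

(** Continuous partial derivatives give a total derivative: a step in the y direction followed by
    one in the x direction. In terms of dz and dzbar it is a linear plus a conjugate linear map. *)
Lemma C1_approx f p : smn i U 1 f -> U p -> forall e : R, 0 < e ->
  exists2 del : R, 0 < del & forall h : C, norm1 h < del ->
  norm1 (f (rs_zinv i (rs_z i p + h)) - f p - (cd true i f p * h + cd false i f p * h^*))
     <= e * norm1 h.
Proof.
move=> hf Up e e0; have e20 : 0 < e / 2 by rewrite divr_gt0.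
have [r r0 hr] := near_zinvU Up.
have [r1 r10 h1] := chart_cont Up (smn_cont (smn_pd false hf) Up) e20.
have [r2 r20 h2] := chart_cont Up (smn_cont (smn_pd true hf) Up) e20.
exists (Num.min r (Num.min r1 r2)); first by rewrite !lt_min r0 r10 r20.
move=> h; rewrite !lt_min => /and3P[hr0 hr1 hr2].
set x := ReC h; set y := ImC h; set Dx := pd i 1 f p; set Dy := pd i 'i f p.
have nh : norm1 h = `|x| + `|y| by [].
have -> : cd true i f p * h + cd false i f p * h^* = Dx * realC x + Dy * realC y.
  rewrite !cdE -/Dx -/Dy [h]Cdecomp -/x -/y.
  have -> : (realC x + 'i * realC y)^* = realC x - 'i * realC y.
    by apply: Ceq; rewrite !CcompE; ring.
  have ii := sqri R; move: ('i : C) (realC x) (realC y) ii => I X Y ii.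
  have -> : (Dx + - I * Dy) / 2 * (X + I * Y) + (Dx + I * Dy) / 2 * (X - I * Y) =
     Dx * X - (I * I) * (Dy * Y) by field.
  by rewrite ii; ring.
have itv (s t : R) : Num.min 0 s <= t <= Num.max 0 s -> `|t| <= `|s|.
  have [s0|s0] := leP 0 s => /andP[t0 t1]; first by rewrite !ger0_norm // (le_trans t0).
  by rewrite !ler0_norm ?lerN2 // ltW.
pose w s t : C := rs_z i p + realC s + realC t * 'i.
have nw s t : `|s| <= `|x| -> `|t| <= `|y| -> norm1 (w s t - rs_z i p) <= norm1 h.
  move=> hs ht; rewrite /w.
  have -> : rs_z i p + realC s + realC t * 'i - rs_z i p = realC s + 'i * realC t by ring.
  by apply: le_trans (norm1D _ _) _; rewrite norm1i !norm1r nh lerD.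
have l1 : norm1 (f (rs_zinv i (w x y)) - Dx * realC x - (f (rs_zinv i (w 0 y)) - Dx * realC 0)) <= 2 * (e / 2) * `|x - 0|.
  apply: (@cincrement_abs R (fun s => f (rs_zinv i (w s y)) - Dx * realC s)
    (fun s => pd i 1 f (rs_zinv i (w s y)) - Dx)) => s /itv sx.
  have n1 := nw s y sx (lexx _).
  split; last by apply: ltW; apply: h1; apply: le_lt_trans n1 hr1.
  apply: cderiveB; last by apply: cderive_eq (cderiveZ Dx (cderive_id s)); rewrite mulr1.
  have [A B] := hr _ (le_lt_trans n1 hr0).
  have E s' : w s' y = (rs_z i p + realC y * 'i) + realC s' * 1 by rewrite /w mulr1; ring.
  have -> : (fun s => f (rs_zinv i (w s y))) = (fun s => f (rs_zinv i ((rs_z i p + realC y * 'i) + realC s * 1))).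
    by apply/funext => s'; rewrite E.
  by rewrite E in A B *; apply: line_cderive => //; exact: (smn_has false hf B).
have l2 : norm1 (f (rs_zinv i (w 0 y)) - Dy * realC y - (f (rs_zinv i (w 0 0)) - Dy * realC 0)) <= 2 * (e / 2) * `|y - 0|.
  apply: (@cincrement_abs R (fun t => f (rs_zinv i (w 0 t)) - Dy * realC t)
    (fun t => pd i 'i f (rs_zinv i (w 0 t)) - Dy)) => t /itv ty.
  have n1 := nw 0 t ltac:(by rewrite normr0) ty.
  split; last by apply: ltW; apply: h2; apply: le_lt_trans n1 hr2.
  apply: cderiveB; last by apply: cderive_eq (cderiveZ Dy (cderive_id t)); rewrite mulr1.
  have [A B] := hr _ (le_lt_trans n1 hr0).
  by apply: line_cderive => //; exact: (smn_has true hf B).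
have -> : rs_z i p + h = w x y by rewrite {1}[h]Cdecomp /w -/x -/y; ring.
have w0 : w 0 0 = rs_z i p by rewrite /w realC0 mul0r !addr0.
rewrite w0 rs_zK in l2; last exact: Ud.
have -> : f (rs_zinv i (w x y)) - f p - (Dx * realC x + Dy * realC y) =
   (f (rs_zinv i (w x y)) - Dx * realC x - (f (rs_zinv i (w 0 y)) - Dx * realC 0)) +
   (f (rs_zinv i (w 0 y)) - Dy * realC y - (f p - Dy * realC 0)).
  by rewrite realC0; ring.
apply: le_trans (norm1D _ _) _; apply: le_trans (lerD l1 l2) _.
by rewrite !subr0 nh; lra.
Qed.

End Schwarz.

(** * Change of chart *)

Section ChainRule.
Variables (R : realType) (S : riemannSurface R).
Local Notation C := (Cplx R).
Implicit Types (i j : rs_idx S) (f : S -> C) (p : S).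

(** [phi] is the derivative of the transition map. It is produced before [f], so that the same
    factor serves all entries of a vector-valued function. *)
Lemma chain_rule i j p : rs_dom i p -> rs_dom j p -> exists phi : C,
  forall U f, open U -> U p -> U `<=` rs_dom j -> smn j U 1 f ->
  C1 i f p /\ forall b, cd b i f p = (if b then phi else phi^*) * cd b j f p.
Proof.
move=> dip djp; have [phi hphi] := derivable_cder (rs_holo dip djp).
exists phi => U f oU Up Ud hf.
set A := cd true j f p; set B := cd false j f p.
suff key v : cderive (coord_line i v f p) 0 (A * (phi * v) + B * (phi * v)^*).
  have /has_pdP[a1 a2] := key 1; have /has_pdP[b1 b2] := key 'i.
  split => [|b]; first by split.
  rewrite cdE a2 b2 !rmorphM /= conjCi rmorph1.
  have ii := sqri R; move: ('i : C) (phi^*) ii => I phi' ii.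
  case: b; rewrite -/A -/B.
    have -> : (A * (phi * 1) + B * (phi' * 1) + - I * (A * (phi * I) + B * (phi' * - I))) / 2 =
      (A * phi + B * phi' - (I * I) * (A * phi - B * phi')) / 2 by field.
    by rewrite ii; field.
  have -> : (A * (phi * 1) + B * (phi' * 1) + I * (A * (phi * I) + B * (phi' * - I))) / 2 =
      (A * phi + B * phi' + (I * I) * (A * phi - B * phi')) / 2 by field.
  by rewrite ii; field.
(* The coordinate line of chart [i], read in chart [j]. Its velocity [phi * v] is inserted into the
   first order expansion of [f] in chart [j]; [e1] and [e2] each account for half of the error. *)
pose F (t : R) := rs_z j (rs_zinv i (rs_z i p + realC t * v)).
have F0 : F 0 = rs_z j p by rewrite /F realC0 mul0r addr0 rs_zK.
have dF : cderive F 0 (phi * v).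
  by apply: (@cder_line R (fun w => rs_z j (rs_zinv i w))); rewrite realC0 mul0r addr0.
apply: (@cderive_near R (fun t => f (rs_zinv j (F t)))).
  have : \forall t \near (0:R), U (rs_zinv i (rs_z i p + realC t * v)).
    by apply: near_coord => //; apply: open_nbhs_nbhs.
  by apply: filterS => t Ut; rewrite /F rs_zK //; apply: Ud.
apply: cderive_dist => e e0.
set d := phi * v in dF *; set D := A * d + B * d^*.
have nA := norm1_ge0 A; have nB := norm1_ge0 B; have nd := norm1_ge0 d.
pose e1 := e / 2 / (1 + norm1 d); pose e2 := Num.min 1 (e / 2 / (1 + norm1 A + norm1 B)).
have e10 : 0 < e1 by rewrite !divr_gt0 //; lra.
have e20 : 0 < e2 by rewrite lt_min ltr01 !divr_gt0 //; lra.
have e21 : e2 <= 1 by rewrite ge_min lexx.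
have e22 : e2 * (norm1 A + norm1 B) <= e / 2.
  have : e2 <= e / 2 / (1 + norm1 A + norm1 B) by rewrite ge_min lexx orbT.
  by rewrite ler_pdivlMr; last (by lra); move=> ?; lra.
have [r r0 hr] := C1_approx oU Ud hf Up e10.
have [s s0 hs] := dist_cderive dF e20.
exists (Num.min s (r / (1 + norm1 d))).
  by rewrite lt_min s0 divr_gt0 //; lra.
move=> t; rewrite lt_min => /andP[ts]; rewrite ltr_pdivlMr; last lra; move=> tr.
have {hs} := hs t ts; rewrite add0r F0 => hs.
pose h := F t - rs_z j p.
have t0 : 0 <= `|t| by [].
have nh : norm1 h <= (1 + norm1 d) * `|t|.
  have -> : h = (F t - rs_z j p - d * realC t) + d * realC t by rewrite /h; ring.
  apply: le_trans (norm1D _ _) _; rewrite norm1Mr [leRHS]mulrDl lerD //.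
  by apply: le_trans hs _; rewrite ler_wpM2r.
have nhr : norm1 h < r by apply: le_lt_trans nh _; rewrite [ltLHS]mulrC.
have hr' := hr h nhr.
have E : rs_z j p + h = F t by rewrite /h; ring.
rewrite E -/A -/B in hr'.
rewrite rs_zK; last exact: djp.
have -> : f (rs_zinv j (F t)) - f p - D * realC t =
  (f (rs_zinv j (F t)) - f p - (A * h + B * h^*)) +
  (A * (h - d * realC t) + B * (h - d * realC t)^*).
  have -> : (h - d * realC t)^* = h^* - d^* * realC t.
    by apply: Ceq; rewrite !CcompE; ring.
  by rewrite /D; ring.
apply: le_trans (norm1D _ _) _.
have k1 : norm1 (A * (h - d * realC t) + B * (h - d * realC t)^*) <= e / 2 * `|t|.
  apply: le_trans (norm1D _ _) _.
  apply: le_trans (lerD (norm1M _ _) (norm1M _ _)) _; rewrite norm1_conj -[leLHS]mulrDl.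
  apply: le_trans (ler_wpM2l (addr_ge0 nA nB) hs) _.
  by rewrite mulrA ler_wpM2r // mulrC.
have k2 : e1 * norm1 h <= e / 2 * `|t|.
  apply: le_trans (ler_wpM2l (ltW e10) nh) _.
  have nz : 1 + norm1 d != 0 by rewrite gt_eqF //; lra.
  by rewrite mulrA ler_wpM2r // /e1 divfK.
by apply: le_trans (lerD (le_trans hr' k2) k1) _; rewrite -mulrDl -splitr.
Qed.

End ChainRule.

Fact sealed_copy (T : Type) (x : T) : {y : T | y = x}.
Proof. by exists x. Qed.

(* An irreducible copy of [x]: keeps unification from unfolding [x]. *)
Definition seal (T : Type) (x : T) : T := sval (sealed_copy x).

Lemma sealE (T : Type) (x : T) : seal x = x.
Proof. exact: (svalP (sealed_copy x)). Qed.

(** * Derivatives of matrix-valued functions *)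

Section MatrixCalculus.
Variables (R : realType) (S : riemannSurface R).
Local Notation C := (Cplx R).

Definition mxsm m k (i : rs_idx S) (U : set S) (F : S -> 'M[C]_(m, k)) : Prop :=
  forall a b, sm i U (fun p => F p a b).
Definition mcd m k (b : bool) (i : rs_idx S) (F : S -> 'M[C]_(m, k)) (p : S) : 'M[C]_(m, k) :=
  seal (\matrix_(a, c) cd b i (fun x => F x a c) p).

Lemma mcdE m k b i (F : S -> 'M[C]_(m, k)) p a c :
  mcd b i F p a c = cd b i (fun x => F x a c) p.
Proof. by rewrite /mcd sealE mxE. Qed.

Lemma mcdzE m k i (F : S -> 'M[C]_(m, k)) p : mx_dz i F p = mcd true i F p.
Proof. by rewrite /mcd sealE. Qed.
Lemma mcdzbE m k i (F : S -> 'M[C]_(m, k)) p : mx_dzb i F p = mcd false i F p.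
Proof. by rewrite /mcd sealE. Qed.

Lemma mx_smooth_sm m k (W : set S) (F : S -> 'M[C]_(m, k)) :
  mx_smooth W F <-> forall i, mxsm i (W `&` rs_dom i) F.
Proof.
split=> h; first by move=> i a b; have /smooth_sm := h a b; apply.
by move=> a b; apply/smooth_sm => i; apply: h.
Qed.

Lemma mxsm_sub m k i (U V : set S) (F : S -> 'M[C]_(m, k)) :
  V `<=` U -> mxsm i U F -> mxsm i V F.
Proof. by move=> VU h a b; apply: sm_sub VU (h a b). Qed.

Variables (i : rs_idx S) (U : set S).
Hypotheses (oU : open U) (Ud : U `<=` rs_dom i).

Section Ops.
Variables m k l : nat.
Implicit Types (F G : S -> 'M[C]_(m, k)) (H : S -> 'M[C]_(k, l)) (f : S -> C).

Lemma mxsm_ext F G : (forall x, U x -> F x = G x) -> mxsm i U F -> mxsm i U G.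
Proof. by move=> FG h a b; apply: sm_ext (h a b) => // x /FG ->. Qed.
Lemma mxsm_cst (A : 'M[C]_(m, k)) : mxsm i U (fun=> A).
Proof. by move=> a b; apply: sm_cst. Qed.
Lemma mxsmD F G : mxsm i U F -> mxsm i U G -> mxsm i U (fun x => F x + G x).
Proof.
by move=> hF hG a b; apply: sm_ext (smD oU Ud (hF a b) (hG a b)) => // x _; rewrite mxE.
Qed.
Lemma mxsmN F : mxsm i U F -> mxsm i U (fun x => - F x).
Proof.
by move=> hF a b; apply: sm_ext (smN oU Ud (hF a b)) => // x _; rewrite mxE.
Qed.
Lemma mxsmB F G : mxsm i U F -> mxsm i U G -> mxsm i U (fun x => F x - G x).
Proof. by move=> hF hG; apply: mxsmD hF _; apply: mxsmN. Qed.
Lemma mxsmZ f F : sm i U f -> mxsm i U F -> mxsm i U (fun x => f x *: F x).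
Proof.
by move=> hf hF a b; apply: sm_ext (smM oU Ud hf (hF a b)) => // x _; rewrite mxE.
Qed.
Lemma mxsmM F H : mxsm i U F -> mxsm i U H -> mxsm i U (fun x => F x *m H x).
Proof.
move=> hF hH a b.
apply: sm_ext (sm_sum oU Ud (index_enum 'I_k) (fun c => smM oU Ud (hF a c) (hH c b))) => //.
by move=> x _; rewrite mxE.
Qed.
Lemma mxsm_tr F : mxsm i U F -> mxsm i U (fun x => (F x)^T).
Proof. by move=> hF a b; apply: sm_ext (hF b a) => // x _; rewrite mxE. Qed.
Lemma mxsm_cd b F : mxsm i U F -> mxsm i U (mcd b i F).
Proof.
by move=> hF a c; apply: sm_ext (sm_cd b oU Ud (hF a c)) => // x _; rewrite mcdE.
Qed.

Variables (b : bool) (p : S).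
Hypothesis Up : U p.
Let dp := Ud Up.

Lemma mcd_local F G : (\forall x \near p, F x = G x) -> mcd b i F p = mcd b i G p.
Proof using oU Ud Up.
move=> h; apply/matrixP => a c; rewrite !(mxE, mcdE); apply: cd_local => //.
by apply: filterS h => x ->.
Qed.
Lemma mcd_ext F G : (forall x, U x -> F x = G x) -> mcd b i F p = mcd b i G p.
Proof.
move=> h; apply: mcd_local; have : nbhs p U by apply: open_nbhs_nbhs.
by apply: filterS => x /h.
Qed.
Lemma mcd_cst (A : 'M[C]_(m, k)) : mcd b i (fun=> A) p = 0.
Proof. by apply/matrixP => a c; rewrite !(mxE, mcdE) cd_cst. Qed.
Lemma mcdD F G : mxsm i U F -> mxsm i U G ->
  mcd b i (fun x => F x + G x) p = mcd b i F p + mcd b i G p.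
Proof using oU Ud Up.
move=> hF hG; apply/matrixP => a c; rewrite !(mxE, mcdE).
rewrite -(cdD b (sm_C1 (hF a c) Up) (sm_C1 (hG a c) Up)).
by congr (cd b i _ p); apply/funext => x; rewrite mxE.
Qed.
Lemma mcdN F : mxsm i U F -> mcd b i (fun x => - F x) p = - mcd b i F p.
Proof using oU Ud Up.
move=> hF; apply/matrixP => a c; rewrite !(mxE, mcdE) -(cdN b (sm_C1 (hF a c) Up)).
by congr (cd b i _ p); apply/funext => x; rewrite mxE.
Qed.
Lemma mcdB F G : mxsm i U F -> mxsm i U G ->
  mcd b i (fun x => F x - G x) p = mcd b i F p - mcd b i G p.
Proof using oU Ud Up. by move=> hF hG; rewrite mcdD ?mcdN //; apply: mxsmN. Qed.
Lemma mcdZ f F : sm i U f -> mxsm i U F ->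
  mcd b i (fun x => f x *: F x) p = cd b i f p *: F p + f p *: mcd b i F p.
Proof using oU Ud Up.
move=> hf hF; apply/matrixP => a c; rewrite !(mxE, mcdE).
rewrite -(cdM dp b (sm_C1 hf Up) (sm_C1 (hF a c) Up)).
by congr (cd b i _ p); apply/funext => x; rewrite mxE.
Qed.
Lemma mcdZc (z : C) F : mxsm i U F ->
  mcd b i (fun x => z *: F x) p = z *: mcd b i F p.
Proof. by move=> hF; rewrite mcdZ ?cd_cst ?scale0r ?add0r //; apply: sm_cst. Qed.
Lemma cd_sum (I : Type) (r : seq I) (F : I -> S -> C) : (forall c, sm i U (F c)) ->
  cd b i (fun x => \sum_(c <- r) F c x) p = \sum_(c <- r) cd b i (F c) p.
Proof.
move=> h; elim: r => [|c r IH].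
  by under eq_fun do rewrite big_nil; rewrite big_nil cd_cst.
under eq_fun do rewrite big_cons.
by rewrite big_cons cdD ?IH //; apply: sm_C1 Up => //; apply: sm_sum.
Qed.
Lemma mcdM F H : mxsm i U F -> mxsm i U H ->
  mcd b i (fun x => F x *m H x) p = mcd b i F p *m H p + F p *m mcd b i H p.
Proof.
move=> hF hH; apply/matrixP => a c; rewrite !(mxE, mcdE) -big_split /=.
under eq_fun do rewrite mxE.
rewrite (cd_sum _ (fun d => smM oU Ud (hF a d) (hH d c))).
apply: eq_bigr => d _; rewrite !(mxE, mcdE).
exact: (cdM dp b (sm_C1 (hF a d) Up) (sm_C1 (hH d c) Up)).
Qed.
Lemma mcd_tr F : mcd b i (fun x => (F x)^T) p = (mcd b i F p)^T.
Proof.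
apply/matrixP => a c; rewrite !(mxE, mcdE).
by congr (cd b i _ p); apply/funext => x; rewrite mxE.
Qed.
Lemma mcd_conj F : mxsm i U F ->
  mcd b i (fun x => map_mx Num.conj (F x)) p = map_mx Num.conj (mcd (~~ b) i F p).
Proof using oU Ud Up.
move=> hF; apply/matrixP => a c; rewrite !(mxE, mcdE).
rewrite -(cd_conj b (sm_C1 (hF a c) Up)).
by congr (cd b i _ p); apply/funext => x; rewrite mxE.
Qed.
Lemma mcd_comm F : mxsm i U F ->
  mcd b i (mcd (~~ b) i F) p = mcd (~~ b) i (mcd b i F) p.
Proof.
move=> hF; apply/matrixP => a c; rewrite !(mxE, mcdE).
have := cd_comm oU Ud (hF a c 2%N) Up.
have e d : (fun x => mcd d i F x a c) = cd d i (fun x => F x a c).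
  by apply/funext => x; rewrite mcdE.
by rewrite !e; case: (b).
Qed.
End Ops.
End MatrixCalculus.
(** * Lorentzian linear algebra *)

Section LorentzAlgebra.
Variables (R : realType) (n : nat).
Local Notation C := (Cplx R).
Local Notation vec := 'cV[C]_(n.+2).
Local Notation End := 'M[C]_(n.+2).
Definition lgram : End := seal (gram R n).
Local Notation J := lgram.
Implicit Types (u v w : vec) (A B X Y P g : End) (U V : {vspace vec}).

Lemma mulmx_ext m k (A B : 'M[C]_(m, k)) : (forall w : 'cV_k, A *m w = B *m w) -> A = B.
Proof.
move=> h; apply/matrixP => a b.
have := congr1 (fun M : 'cV_m => M a 0) (h (delta_mx b 0)).
by rewrite -!colE !mxE.
Qed.

Lemma gram_tr : J^T = J.
Proof. by rewrite /lgram sealE tr_diag_mx. Qed.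
Lemma gramK : J *m J = 1%:M.
Proof.
rewrite /lgram sealE mulmx_diag -diag_const_mx; congr diag_mx; apply/matrixP => a b.
by rewrite !mxE; case: ifP; rewrite ?mulrNN mulr1.
Qed.
Lemma gramKl m (A : 'M[C]_(n.+2, m)) : J *m (J *m A) = A.
Proof. by rewrite mulmxA gramK mul1mx. Qed.
Lemma gram_conj : map_mx Num.conj J = J.
Proof.
rewrite /lgram sealE map_diag_mx; congr diag_mx; apply/matrixP => a b; rewrite !mxE.
by case: ifP => _; rewrite ?rmorphN rmorph1.
Qed.

Definition lip u v : C := seal (@ip R n) u v.
Definition lwedge u v : End := seal (@wedge R n) u v.
Lemma lipE u v : lip u v = ip u v. Proof. by rewrite /lip sealE. Qed.
Lemma lwedgeE u v : lwedge u v = wedge u v. Proof. by rewrite /lwedge sealE. Qed.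

Lemma lgramE : J = gram R n. Proof. by rewrite /lgram sealE. Qed.
Lemma lipJ u v : lip u v = (u^T *m J *m v) 0 0. Proof. by rewrite lipE lgramE. Qed.
Lemma lwedgeJ u v : lwedge u v = v *m (u^T *m J) - u *m (v^T *m J).
Proof. by rewrite lwedgeE lgramE. Qed.

Lemma ip_mx u v : u^T *m J *m v = (lip u v)%:M.
Proof. by rewrite [LHS]mx11_scalar lipJ. Qed.
Lemma ipC u v : lip u v = lip v u.
Proof.
rewrite !lipJ -[in RHS](trmxK (_ *m u)) [in RHS]mxE !trmx_mul trmxK gram_tr.
by rewrite mulmxA.
Qed.
Lemma ipDl u1 u2 v : lip (u1 + u2) v = lip u1 v + lip u2 v.
Proof. by rewrite !lipJ linearD /= !mulmxDl mxE. Qed.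
Lemma ipDr u v1 v2 : lip u (v1 + v2) = lip u v1 + lip u v2.
Proof. by rewrite ipC ipDl ![lip _ u]ipC. Qed.
Lemma ipZl (a : C) u v : lip (a *: u) v = a * lip u v.
Proof. by rewrite !lipJ linearZ /= -!scalemxAl mxE. Qed.
Lemma ipZr (a : C) u v : lip u (a *: v) = a * lip u v.
Proof. by rewrite ipC ipZl ipC. Qed.
Lemma ipNl u v : lip (- u) v = - lip u v.
Proof. by rewrite -scaleN1r ipZl mulN1r. Qed.
Lemma ipNr u v : lip u (- v) = - lip u v.
Proof. by rewrite ipC ipNl ipC. Qed.
Lemma ipBl u1 u2 v : lip (u1 - u2) v = lip u1 v - lip u2 v.
Proof. by rewrite ipDl ipNl. Qed.
Lemma ipBr u v1 v2 : lip u (v1 - v2) = lip u v1 - lip u v2.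
Proof. by rewrite ipDr ipNr. Qed.
Lemma ip0l v : lip 0 v = 0.
Proof. by rewrite -(scale0r 0) ipZl mul0r. Qed.
Lemma ip0r v : lip v 0 = 0.
Proof. by rewrite ipC ip0l. Qed.
Definition ipE := (ipDl, ipDr, ipZl, ipZr, ipNl, ipNr, ip0l, ip0r).

Lemma ip_nondeg u : (forall v, lip v u = 0) -> u = 0.
Proof.
move=> h; rewrite -[u]gramKl; suff -> : J *m u = 0 by rewrite mulmx0.
apply/matrixP => a b; rewrite ord1 [RHS]mxE -(h (delta_mx a 0)) !lipJ -mulmxA.
by rewrite trmx_delta -rowE [RHS]mxE.
Qed.

Lemma ip_conj u v : (lip u v)^* = lip (conjv u) (conjv v).
Proof.
by rewrite !lipJ /conjv map_trmx -{2}gram_conj -!map_mxM [in RHS]mxE.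
Qed.

(** The adjoint for the Lorentzian form. On orthogonal matrices it is the inverse, but unlike
    [invmx] it is linear in the entries and so commutes with differentiation. *)
Definition ladj A : End := seal (fun A => J *m A^T *m J) A.
Lemma ladjE A : ladj A = J *m A^T *m J. Proof. by rewrite /ladj sealE. Qed.
Lemma ladjD A B : ladj (A + B) = ladj A + ladj B.
Proof. by rewrite !ladjE linearD /= mulmxDr mulmxDl. Qed.
Lemma ladjZ (a : C) A : ladj (a *: A) = a *: ladj A.
Proof. by rewrite !ladjE linearZ /= -scalemxAr -scalemxAl. Qed.
Lemma ladjN A : ladj (- A) = - ladj A.
Proof. by rewrite -scaleN1r ladjZ scaleN1r. Qed.
Lemma ladjB A B : ladj (A - B) = ladj A - ladj B.
Proof. by rewrite ladjD ladjN. Qed.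
Lemma ladjM A B : ladj (A *m B) = ladj B *m ladj A.
Proof. by rewrite !ladjE trmx_mul -!mulmxA gramKl. Qed.
Lemma ladjK A : ladj (ladj A) = A.
Proof. by rewrite !ladjE !trmx_mul trmxK gram_tr !mulmxA gramK mul1mx -mulmxA gramK mulmx1. Qed.
Lemma ip_adj A u v : lip (A *m u) v = lip u (ladj A *m v).
Proof. by rewrite !lipJ !ladjE trmx_mul -!mulmxA gramKl. Qed.
Lemma ladj_ext A B : (forall u v, lip (A *m u) v = lip u (B *m v)) -> ladj A = B.
Proof.
move=> h; apply: mulmx_ext => v; apply/eqP; rewrite -subr_eq0; apply/eqP.
by apply: ip_nondeg => u; rewrite ipBr -h ip_adj subrr.
Qed.

Lemma orth_adj g : orthogonal_mx g -> ladj g *m g = 1%:M.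
Proof. by rewrite /orthogonal_mx -lgramE ladjE => h; rewrite -!mulmxA [g^T *m _]mulmxA h gramK. Qed.
Lemma orth_unit g : orthogonal_mx g -> g \in unitmx.
Proof. by move/orth_adj/mulmx1_unit => []. Qed.
Lemma orth_inv g : orthogonal_mx g -> invmx g = ladj g.
Proof.
move=> h; have u := orth_unit h.
by rewrite -[LHS]mul1mx -(orth_adj h) -mulmxA mulmxV // mulmx1.
Qed.
Lemma orth_adjr g : orthogonal_mx g -> g *m ladj g = 1%:M.
Proof. by move=> h; rewrite -orth_inv // mulmxV // orth_unit. Qed.
Lemma orth_ip g u v : orthogonal_mx g -> lip (g *m u) (g *m v) = lip u v.
Proof. by move=> h; rewrite ip_adj mulmxA orth_adj // mul1mx. Qed.

Lemma wedgeE u v w : lwedge u v *m w = lip u w *: v - lip v w *: u.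
Proof. by rewrite !lwedgeJ mulmxBl -!mulmxA ![_^T *m (_ *m w)]mulmxA !ip_mx !mul_mx_scalar. Qed.
Lemma ladj_wedge u v : ladj (lwedge u v) = - lwedge u v.
Proof.
apply: ladj_ext => x y; rewrite mulNmx !wedgeE !ipE [lip x u]ipC [lip x v]ipC; ring.
Qed.
Lemma wedgeC u v : lwedge v u = - lwedge u v.
Proof. by rewrite !lwedgeJ opprB. Qed.
Lemma wedge_self u : lwedge u u = 0.
Proof. by rewrite !lwedgeJ subrr. Qed.
Lemma wedgeDl u1 u2 v : lwedge (u1 + u2) v = lwedge u1 v + lwedge u2 v.
Proof. by apply: mulmx_ext => w; rewrite [RHS]mulmxDl !wedgeE ipDl scalerDl scalerDr opprD addrACA. Qed.
Lemma wedgeZl (a : C) u v : lwedge (a *: u) v = a *: lwedge u v.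
Proof.
apply: mulmx_ext => w; rewrite -[RHS]scalemxAl !wedgeE ipZl scalerBr !scalerA.
by congr (_ - _ *: _); exact: mulrC.
Qed.
Lemma wedgeDr u v1 v2 : lwedge u (v1 + v2) = lwedge u v1 + lwedge u v2.
Proof. by rewrite wedgeC wedgeDl opprD -!wedgeC. Qed.
Lemma wedgeZr (a : C) u v : lwedge u (a *: v) = a *: lwedge u v.
Proof. by rewrite wedgeC wedgeZl -scalerN -wedgeC. Qed.
Lemma wedge_orth g u v : orthogonal_mx g -> g *m lwedge u v *m ladj g = lwedge (g *m u) (g *m v).
Proof.
move=> h; apply: mulmx_ext => w.
have -> : g *m lwedge u v *m ladj g *m w = g *m (lwedge u v *m (ladj g *m w)) by rewrite !mulmxA.
by rewrite !wedgeE mulmxBr -!scalemxAr !ip_adj.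
Qed.

Lemma span1P (a v : vec) : reflect (exists x, v = x *: a) (v \in <<[:: a]>>%VS).
Proof. by rewrite span_seq1; apply: vlineP. Qed.

Lemma span_consP (a v : vec) s : reflect (exists x w, w \in << s >>%VS /\ v = x *: a + w)
  (v \in <<a :: s>>%VS).
Proof.
rewrite span_cons; apply: (iffP memv_addP) => [[u /vlineP[k ->] [w ws ->]]|[x [w [ws ->]]]].
  by exists k, w.
by exists (x *: a); [apply/vlineP; exists x|exists w].
Qed.

Lemma span2P (a b v : vec) : reflect (exists x y, v = x *: a + y *: b) (v \in <<[:: a; b]>>%VS).
Proof.
apply: (iffP (span_consP a v [:: b])) => [[x [w [/span1P[y ->] ->]]]|[x [y ->]]].
  by exists x, y.
by exists x, (y *: b); split=> //; apply/span1P; exists y.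
Qed.

Lemma span3P (a b c v : vec) :
  reflect (exists x y z, v = x *: a + (y *: b + z *: c)) (v \in <<[:: a; b; c]>>%VS).
Proof.
apply: (iffP (span_consP a v [:: b; c])) => [[x [w [/span2P[y [z ->]] ->]]]|[x [y [z ->]]]].
  by exists x, y, z.
by exists x, (y *: b + z *: c); split=> //; apply/span2P; exists y, z.
Qed.

Lemma mx_imageP g U w : orthogonal_mx g -> (w \in mx_image g U) = (ladj g *m w \in U).
Proof.
move=> h; apply/memv_imgP/idP => [[u Uu ->]|wU].
  by rewrite lfunE /= mulmxA orth_adj // mul1mx.
by exists (ladj g *m w) => //; rewrite lfunE /= mulmxA orth_adjr // mul1mx.
Qed.

Lemma mem_mx_image g U u : u \in U -> g *m u \in mx_image g U.
Proof. by move=> Uu; have := memv_img (linfun (mulmx g)) Uu; rewrite lfunE. Qed.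

Lemma dim_mx_image g U : orthogonal_mx g -> \dim (mx_image g U) = \dim U.
Proof.
move=> h; apply: limg_dim_eq; apply/eqP; rewrite -subv0; apply/subvP => w.
rewrite memv_cap memv_ker lfunE /= => /andP[_ /eqP gw].
by rewrite memv0 -[w]mul1mx -(orth_adj h) -mulmxA gw mulmx0.
Qed.

Lemma perpP x U : reflect (forall u, u \in U -> lip u x = 0) (x \in perp U).
Proof.
have mem_bigcap (s : seq vec) : (x \in (\bigcap_(b <- s) lker (linfun (mulmx (b^T *m gram R n))))%VS)
    = all (fun b => lip b x == 0) s.
  elim: s => [|b s IH]; first by rewrite big_nil memvf.
  rewrite big_cons memv_cap IH /= memv_ker lfunE /= -lgramE ip_mx; congr andb.
  by apply/eqP/eqP => [/matrixP/(_ 0 0)|->]; rewrite ?raddf0 // !mxE.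
rewrite /perp mem_bigcap; apply: (iffP allP) => [h u Uu|h b bU].
  rewrite (coord_vbasis Uu); elim/big_ind: _ => [|a b ha hb|k _]; rewrite ?ip0l ?ipDl ?ha ?hb ?addr0 //.
  have mk : (vbasis U)`_k \in vbasis U by rewrite mem_nth ?size_tuple.
  by rewrite ipZl; have /eqP -> := h _ mk; rewrite mulr0.
by rewrite h // vbasis_mem.
Qed.

Lemma mem_wedge_sp U V u v : u \in U -> v \in V -> lwedge u v \in wedge_sp U V.
Proof.
move=> Uu Vv; rewrite (coord_vbasis Uu) (coord_vbasis Vv).
have base k l : (k < \dim U)%N -> (l < \dim V)%N ->
    lwedge (vbasis U)`_k (vbasis V)`_l \in wedge_sp U V.
  by move=> hk hl; rewrite lwedgeE; apply: memv_span; apply: allpairs_f; rewrite mem_nth ?size_tuple.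
have w0l (x : vec) : lwedge 0 x = 0 by rewrite -(scale0r 0) wedgeZl scale0r.
have w0r (x : vec) : lwedge x 0 = 0 by rewrite -(scale0r 0) wedgeZr scale0r.
elim/big_ind: _ => [|a b ha hb|k _]; first by rewrite w0l mem0v.
  by rewrite wedgeDl memvD.
rewrite wedgeZl; apply: memvZ.
elim/big_ind: _ => [|a b ha hb|l _]; first by rewrite w0r mem0v.
  by rewrite wedgeDr memvD.
by rewrite wedgeZr; apply: memvZ; apply: base.
Qed.

Lemma wedge_sp_ind U V (Q : End -> Prop) :
  Q 0 -> (forall X Y, Q X -> Q Y -> Q (X + Y)) -> (forall (a : C) X, Q X -> Q (a *: X)) ->
  (forall u v, u \in U -> v \in V -> Q (lwedge u v)) ->
  forall X, X \in wedge_sp U V -> Q X.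
Proof.
move=> Q0 QD QZ Qw X; rewrite /wedge_sp span_def.
have sub : forall Y, Y \in [seq wedge u v | u <- vbasis U, v <- vbasis V] -> Q Y.
  move=> Y /allpairsP[[u v] /= [hu hv ->]].
  by rewrite -lwedgeE; apply: Qw; apply: vbasis_mem.
move: [seq wedge u v | u <- vbasis U, v <- vbasis V] sub X.
elim=> [|Y s IH] sub X.
  by rewrite big_nil memv0 => /eqP ->.
rewrite big_cons => /memv_addP[Y' /vlineP[a ->] [Z hZ ->]].
apply: QD; first by apply: QZ; apply: sub; rewrite mem_head.
by apply: IH hZ => Z' hZ'; apply: sub; rewrite in_cons hZ' orbT.
Qed.

(** Such a [P] exists exactly when [V] is non-degenerate, and is then determined by [V]. Bundles are
    differentiated through this projection. *)
Definition is_oproj V P : Prop :=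
  [/\ ladj P = P, forall w, P *m w \in V & forall v, v \in V -> P *m v = v].

Lemma oproj_idem V P : is_oproj V P -> P *m P = P.
Proof. by move=> [_ hV hid]; apply: mulmx_ext => w; rewrite -mulmxA hid. Qed.

Lemma oproj_mem V P : is_oproj V P -> forall v, (v \in V) = (P *m v == v).
Proof. by move=> [_ hV hid] v; apply/idP/eqP => [/hid|<-]. Qed.

Lemma oproj_perp V P : is_oproj V P -> forall v, (v \in perp V) = (P *m v == 0).
Proof.
move=> [aP hV hid] v; apply/perpP/eqP => [h|h u Vu].
  by apply: ip_nondeg => u; rewrite -aP -ip_adj h.
by rewrite -(hid u Vu) ip_adj aP h ip0r.
Qed.

Lemma oproj_reflection V P : is_oproj V P -> forall w,
  reflection V w = P *m w - (w - P *m w).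
Proof.
move=> hP w; have [aP hV hid] := hP.
have compl x : x - P *m x \in perp V.
  by rewrite (oproj_perp hP) mulmxBr mulmxA (oproj_idem hP) subrr.
have cap0 : (V :&: perp V = 0)%VS.
  apply/eqP; rewrite -subv0; apply/subvP => x; rewrite memv_cap memv0 => /andP[Vx].
  by rewrite (oproj_perp hP) hid.
have cap0' : (perp V :&: V = 0)%VS by rewrite capvC.
have dec : w = P *m w + (w - P *m w) by rewrite addrC subrK.
have gen a b : a + b = w -> a \in V -> b \in perp V -> a - b = P *m w - (w - P *m w).
  move=> e Va; rewrite (oproj_perp hP) => /eqP Pb.
  have Pw : P *m w = a by rewrite -e mulmxDr hid // Pb addr0.
  have -> : w - P *m w = b by rewrite Pw -e addrC addKr.
  by rewrite Pw.
rewrite /reflection.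
have -> : (daddv_pi V (perp V) - daddv_pi (perp V) V)%R w =
   daddv_pi V (perp V) w - daddv_pi (perp V) V w by rewrite !lfunE /= !lfunE.
have wVV : w \in (V + perp V)%VS.
  by apply/memv_addP; exists (P *m w) => //; exists (w - P *m w) => //.
exact: gen (daddv_pi_add cap0 wVV) (memv_pi _ _ _) (memv_pi _ _ _).
Qed.

(** A skew [X] exchanging [V] and its complement is determined by its restriction to [V]. With the
    standard pseudo-orthonormal basis [e j], it is the sum of the [P e_j /\ X P e_j] with the signs
    [J j j]. *)
Lemma oproj_wedge V P X : is_oproj V P -> ladj X = - X -> P *m X + X *m P = X ->
  X \in wedge_sp V (perp V).
Proof.
move=> hP aX mX; have [aP hV hid] := hP; have PP := oproj_idem hP.
have PXP : P *m X *m P = 0.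
  have := congr1 (mulmx P) mX; rewrite mulmxDr mulmxA PP mulmxA => /eqP.
  by rewrite -subr_eq0 addrAC subrr add0r => /eqP.
pose e (j : 'I_n.+2) : vec := delta_mx j 0.
have dec w : w = \sum_j (J j j * lip (e j) w) *: e j.
  apply/matrixP => a b; rewrite ord1 summxE (bigD1 a) //= big1 ?addr0.
    rewrite !mxE eqxx mulr1 -[LHS]mul1r.
    rewrite !lipJ /e trmx_delta -mulmxA -rowE [in RHS]mxE.
    rewrite lgramE mul_diag_mx !mxE eqxx mulr1n.
    rewrite mulrA; congr (_ * _).
    by case: ifP; rewrite ?mulrNN mulr1.
  by move=> j ja; rewrite !mxE eq_sym (negbTE ja) mulr0.
have -> : X = \sum_j J j j *: lwedge (P *m e j) (X *m (P *m e j)).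
  apply: mulmx_ext => w; rewrite mulmx_suml.
  transitivity (X *m (P *m \sum_j (J j j * lip (e j) (P *m w)) *: e j) +
     P *m \sum_j (J j j * lip (e j) (P *m (X *m w))) *: e j).
    by rewrite -!dec -[in LHS]mX mulmxDl addrC !mulmxA PP -!mulmxA [P *m (P *m _)]mulmxA PP.
  rewrite !mulmx_sumr -big_split /=; apply: eq_bigr => j _.
  rewrite -[RHS]scalemxAl wedgeE -!scalemxAr scalerBr !scalerA.
  congr (_ *: _ + _); first by rewrite ip_adj aP.
  rewrite -scaleNr; congr (_ *: _).
  by rewrite -mulrN ip_adj aX mulNmx ipNr opprK ip_adj aP.
apply: memv_suml => j _; apply: memvZ; apply: mem_wedge_sp; first exact: hV.
by rewrite (oproj_perp hP) !mulmxA PXP mul0mx.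
Qed.

End LorentzAlgebra.
(** * Conformal lifts and the central sphere congruence *)

Section LorentzPositivity.
Variables (R : realType) (n : nat).
Local Notation C := (Cplx R).
Local Notation vec := 'cV[C]_(n.+2).
Implicit Types (u v w : vec).

Lemma lip_sum u v : lip u v = \sum_j (if j == ord_max then -1 else 1) * (u j 0 * v j 0).
Proof.
rewrite lipJ lgramE mul_mx_diag mxE; apply: eq_bigr => j _.
by rewrite !mxE [_ * (if _ then _ else _)]mulrC mulrA.
Qed.

Lemma conjvE u j : conjv u = u -> (u j 0)^* = u j 0.
Proof. by move=> h; rewrite -{2}h mxE. Qed.

Lemma lip_spacelike u : conjv u = u -> u ord_max 0 = 0 ->
  0 <= lip u u /\ (lip u u = 0 -> u = 0).
Proof.
move=> ru u0; have e : lip u u = \sum_j `|u j 0| ^+ 2.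
  rewrite lip_sum; apply: eq_bigr => j _; rewrite normCK (conjvE j ru).
  by case: eqP => [->|_]; rewrite ?u0 ?mulr0 ?mul1r.
have pos j : 0 <= `|u j 0| ^+ 2 by rewrite exprn_ge0.
rewrite e; split; first by apply: sumr_ge0.
move=> /psumr_eq0P h; apply/matrixP => j a; rewrite ord1 mxE.
have := h (fun j _ => pos j) j isT => /eqP.
by rewrite expf_eq0 normr_eq0 => /andP[_ /eqP].
Qed.

(** A nonzero real null vector has a nonzero time component, so a multiple of [u] can be subtracted
    from [v] to remove the time component of [v]. This does not change [lip v v], and on vectors
    without time component the form is positive definite. *)
Lemma lorentz_null_orth u v : conjv u = u -> conjv v = v -> u != 0 ->
  lip u u = 0 -> lip u v = 0 ->
  0 <= lip v v /\ (lip v v = 0 -> exists c, v = c *: u).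
Proof.
move=> ru rv u0 uu uv.
have um : u ord_max 0 != 0.
  apply/eqP => um; have [_ h] := lip_spacelike ru um.
  by move: u0; rewrite (h uu) eqxx.
pose c := v ord_max 0 / u ord_max 0; pose v' := v - c *: u.
have cc : c^* = c by rewrite /c fmorph_div /= !conjvE.
have rv' : conjv v' = v'.
  by apply/matrixP => j a; rewrite ord1 !mxE rmorphB rmorphM /= !conjvE // cc.
have v'm : v' ord_max 0 = 0 by rewrite !mxE /c divfK ?subrr.
have [p q] := lip_spacelike rv' v'm.
have e : lip v' v' = lip v v.
  by rewrite /v' !ipE [lip v u]ipC uv uu !(mulr0, oppr0, addr0, subr0).
rewrite -e; split=> // /q h; exists c; apply/eqP.
by rewrite -subr_eq0 -/v' h.
Qed.

Definition rk u v : 'M[C]_(n.+2) := seal (fun u v => u *m (v^T *m lgram R n)) u v.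
Lemma rkE u v w : rk u v *m w = lip v w *: u.
Proof. by rewrite /rk sealE -mulmxA ip_mx mul_mx_scalar. Qed.
Lemma ladj_rk u v : ladj (rk u v) = rk v u.
Proof. by apply: ladj_ext => x y; rewrite !rkE !ipE ipC [lip x v]ipC mulrC. Qed.

End LorentzPositivity.

(** * The product rule for the inner product *)

Section LipCalculus.
Variables (R : realType) (S : riemannSurface R) (n : nat) (i : rs_idx S) (U : set S).
Local Notation C := (Cplx R).
Local Notation vec := 'cV[C]_(n.+2).
Hypotheses (oU : open U) (Ud : U `<=` rs_dom i).
Implicit Types (u v : S -> vec).

Lemma sm_lip u v : mxsm i U u -> mxsm i U v -> sm i U (fun x => lip (u x) (v x)).
Proof.
move=> hu hv.
have h := mxsmM oU Ud (mxsmM oU Ud (mxsm_tr oU Ud hu) (mxsm_cst oU Ud (lgram R n))) hv.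
by apply: sm_ext (h 0 0) => // x _; rewrite lipJ.
Qed.

Lemma cd_lip b u v p : mxsm i U u -> mxsm i U v -> U p ->
  cd b i (fun x => lip (u x) (v x)) p =
  lip (mcd b i u p) (v p) + lip (u p) (mcd b i v p).
Proof.
move=> hu hv Up.
have ht := mxsm_tr oU Ud hu; have hJ := mxsm_cst oU Ud (lgram R n).
have h1 := mxsmM oU Ud ht hJ.
have := mcdM oU Ud b Up h1 hv => /(congr1 (fun M : 'M_1 => M 0 0)).
rewrite mcdE (mcdM oU Ud b Up ht hJ) mcd_cst mulmx0 addr0 mcd_tr.
rewrite [in RHS]mxE -!lipJ => <-.
by congr (cd b i _ p); apply/funext => x; rewrite lipJ.
Qed.

Lemma mxsm_rk u v : mxsm i U u -> mxsm i U v -> mxsm i U (fun x => rk (u x) (v x)).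
Proof.
move=> hu hv.
have h := mxsmM oU Ud hu (mxsmM oU Ud (mxsm_tr oU Ud hv) (mxsm_cst oU Ud (lgram R n))).
by apply: mxsm_ext h => // x _; rewrite /rk sealE.
Qed.

Lemma cd_eq0 b (f : S -> C) p : (forall x, U x -> f x = 0) -> U p -> cd b i f p = 0.
Proof.
move=> h Up; rewrite -(cd_cst i p b 0); apply: cd_local; first exact: Ud.
have : nbhs p U by apply: open_nbhs_nbhs.
by apply: filterS => x /h ->.
Qed.
End LipCalculus.

(** * Lifts with isotropic derivative *)

Section ConformalLift.
Variables (R : realType) (S : riemannSurface R) (n : nat) (i : rs_idx S) (U : set S).
Local Notation C := (Cplx R).
Local Notation vec := 'cV[C]_(n.+2).
Local Notation End := 'M[C]_(n.+2).
Hypotheses (oU : open U) (Ud : U `<=` rs_dom i).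
Variable sg : S -> vec.
Hypothesis sg_sm : mxsm i U sg.
Hypothesis sg_real : forall x, U x -> conjv (sg x) = sg x.
Hypothesis sg_null : forall x, U x -> lip (sg x) (sg x) = 0.
Hypothesis sg_neq0 : forall x, U x -> sg x != 0.

Let s b := mcd b i sg.
Let ss := mcd false i (mcd true i sg).
(** Half the conformal factor: once [s true] is isotropic, the induced metric is 2h (dx^2 +
    dy^2). *)
Let h x := lip (s true x) (s false x).

Lemma s_sm b : mxsm i U (s b).
Proof. exact: mxsm_cd. Qed.
Lemma ss_sm : mxsm i U ss.
Proof. by apply: mxsm_cd => //; exact: s_sm. Qed.
Lemma h_sm : sm i U h.
Proof. by apply: sm_lip; rewrite //; exact: s_sm. Qed.

Lemma ssE b x : U x -> mcd (~~ b) i (s b) x = ss x.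
Proof. by case: b => //= Ux; rewrite /ss (mcd_comm oU Ud false Ux sg_sm). Qed.

Lemma s_conj b x : U x -> conjv (s b x) = s (~~ b) x.
Proof.
move=> Ux; rewrite /conjv /s -{1}(negbK b) -(mcd_conj oU Ud (~~ b) Ux sg_sm).
apply: (mcd_ext oU Ud) => // y Uy; exact: sg_real.
Qed.

Lemma lip_sg_s b x : U x -> lip (sg x) (s b x) = 0.
Proof.
move=> Ux; have := cd_eq0 oU Ud b sg_null Ux.
rewrite (cd_lip oU Ud b sg_sm sg_sm Ux) -/(s b) [lip (s b x) _]ipC => /eqP.
by rewrite -mulr2n mulrn_eq0 /= => /eqP.
Qed.

Lemma lip_sg_ss x : U x -> lip (sg x) (ss x) = - h x.
Proof.
move=> Ux; have := cd_eq0 oU Ud false (@lip_sg_s true) Ux.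
rewrite (cd_lip oU Ud false sg_sm (s_sm true) Ux) -/(s false) -/ss => /eqP.
by rewrite addrC addr_eq0 ipC => /eqP ->; rewrite ipC.
Qed.

Hypothesis s_iso : forall x, U x -> lip (s true x) (s true x) = 0.

Lemma lip_s_s b x : U x -> lip (s b x) (s b x) = 0.
Proof.
case: b => Ux; first exact: s_iso.
by rewrite -(s_conj true Ux) -ip_conj s_iso // rmorph0.
Qed.

Lemma lip_s_ss b x : U x -> lip (s b x) (ss x) = 0.
Proof.
move=> Ux; have := cd_eq0 oU Ud (~~ b) (@lip_s_s b) Ux.
rewrite (cd_lip oU Ud _ (s_sm b) (s_sm b) Ux) ssE // [lip (ss x) _]ipC => /eqP.
by rewrite -mulr2n mulrn_eq0 /= => /eqP.
Qed.

Let sx x := s true x + s false x.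
Let sy x := 'i *: (s true x - s false x).

(** The real derivatives [sx], [sy] are orthogonal to the null vector [sg] and have square [2 * h],
    so Lorentzian positivity applies. If [h] vanishes, both are multiples of [sg] and the span is a
    line. *)
Lemma h_pos x : U x -> 0 <= h x /\ (h x = 0 -> \dim <<[:: sg x; s true x; s false x]>>%VS != 3).
Proof.
move=> Ux.
have rx : conjv (sx x) = sx x.
  rewrite /sx /conjv map_mxD /=.
  have := s_conj true Ux; have := s_conj false Ux; rewrite /conjv /= => -> ->.
  exact: addrC.
have ry : conjv (sy x) = sy x.
  rewrite /sy /conjv map_mxZ /= map_mxB /=.
  have := s_conj true Ux; have := s_conj false Ux; rewrite /conjv /= => -> ->.
  by rewrite conjCi scaleNr -scalerN opprB.
have px : lip (sg x) (sx x) = 0 by rewrite /sx !ipE !lip_sg_s // addr0.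
have py : lip (sg x) (sy x) = 0 by rewrite /sy ipZr ipBr !lip_sg_s // subrr mulr0.
have xx : lip (sx x) (sx x) = 2 * h x.
  by rewrite /sx !ipE !lip_s_s // add0r addr0 [lip (s false x) _]ipC /h mulr_natl mulr2n.
have yy : lip (sy x) (sy x) = 2 * h x.
  rewrite /sy ipZl ipZr mulrA sqri !(ipBl, ipBr) !lip_s_s // sub0r subr0 [lip (s false x) _]ipC.
  by rewrite -/(h x); ring.
have [hx0 hx] := lorentz_null_orth (sg_real Ux) rx (sg_neq0 Ux) (sg_null Ux) px.
have [hy0 hy] := lorentz_null_orth (sg_real Ux) ry (sg_neq0 Ux) (sg_null Ux) py.
split; first by move: hx0; rewrite xx pmulr_rge0.
move=> h0; rewrite xx yy h0 mulr0 in hx hy.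
have [a ea] := hx erefl; have [c ec] := hy erefl.
have i0 : 'i != 0 :> C by exact: neq0Ci.
have two0 : (2 : C) != 0 by rewrite pnatr_eq0.
have hc : s true x - s false x = ('i^-1 * c) *: sg x.
  by rewrite -scalerA -ec /sy scalerA mulVf // scale1r.
have dbl (v : vec) : v + v = 2 *: v by rewrite scaler_nat mulr2n.
have st : s true x = (2^-1 * (a + 'i^-1 * c)) *: sg x.
  rewrite -scalerA scalerDl -ea -hc /sx addrACA subrr addr0 dbl scalerA.
  by rewrite mulVf // scale1r.
have sf : s false x = (2^-1 * (a - 'i^-1 * c)) *: sg x.
  rewrite -scalerA scalerBl -ea -hc /sx opprB addrC addrA subrK dbl scalerA.
  by rewrite mulVf // scale1r.
have sub : (<<[:: sg x; s true x; s false x]>> <= <<[:: sg x]>>)%VS.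
  apply/span_subvP => v; rewrite !inE => /or3P[] /eqP ->; apply/span1P.
  - by exists 1; rewrite scale1r.
  - by rewrite st; eexists.
  - by rewrite sf; eexists.
have := leq_trans (dimvS sub) (dim_span _) => /= d.
by apply/eqP => e; rewrite e in d.
Qed.

Lemma h_dim x : U x -> h x != 0 -> \dim <<[:: sg x; s true x; s false x]>>%VS = 3.
Proof.
move=> Ux h0; apply/eqP.
suff : free [:: sg x; s true x; s false x] by rewrite /free.
rewrite !free_cons nil_free andbT; apply/and3P; split.
- apply/negP => /span2P[a [c e]].
  have ha : a = 0.
    have := congr1 (fun v => lip v (s false x)) e.
    rewrite lip_sg_s // ipDl !ipZl lip_s_s // mulr0 addr0 => /esym/eqP.
    by rewrite mulf_eq0 (negbTE h0) orbF => /eqP.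
  have hc : c = 0.
    have := congr1 (fun v => lip v (s true x)) e.
    rewrite lip_sg_s // ipDl !ipZl lip_s_s // mulr0 add0r [lip _ (s true x)]ipC => /esym/eqP.
    by rewrite mulf_eq0 (negbTE h0) orbF => /eqP.
  by have := sg_neq0 Ux; rewrite e ha hc !scale0r addr0 eqxx.
- apply/negP => /span1P[a e]; move: h0; rewrite /h e ipZl lip_s_s // mulr0 eqxx //.
- rewrite span_nil memv0; apply: contra h0 => /eqP e.
  by rewrite /h e ip0r.
Qed.

Hypothesis h0 : forall x, U x -> h x != 0.

(** Chosen so that [e4] is null. As [lip (sg x) (e4 x) = - h x], the vectors form two mutually
    orthogonal hyperbolic pairs, [s true] with [s false] and [sg] with [e4]. *)
Let k x := lip (ss x) (ss x) / (2 * h x).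
Let e4 x := ss x + k x *: sg x.

(* orthogonal projection onto the span of [sg] and its derivatives of type (1,0), (0,1), (1,1) *)
Definition lift_proj x : End :=
  (h x)^-1 *: (rk (s true x) (s false x) + rk (s false x) (s true x)
               - rk (sg x) (e4 x) - rk (e4 x) (sg x)).

Let two_h x : U x -> 2 * h x != 0.
Proof. by move=> Ux; rewrite mulf_neq0 ?h0 // pnatr_eq0. Qed.

Lemma lift_proj_sm : mxsm i U lift_proj.
Proof.
have hs := s_sm; have hss := ss_sm; have hsg := sg_sm.
have hk : sm i U k.
  apply: smM => //; first exact: sm_lip.
  by apply: smV => //; apply: smM => //; [exact: sm_cst|exact: h_sm].
have he4 : mxsm i U e4 by apply: mxsmD => //; apply: mxsmZ.
apply: mxsmZ => //; first by apply: smV => //; exact: h_sm.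
apply: (mxsmB oU Ud); last exact: (mxsm_rk oU Ud he4 hsg).
apply: (mxsmB oU Ud); last exact: (mxsm_rk oU Ud hsg he4).
apply: (mxsmD oU Ud).
  exact: (mxsm_rk oU Ud (hs true) (hs false)).
exact: (mxsm_rk oU Ud (hs false) (hs true)).
Qed.

Lemma lift_projE x v : lift_proj x *m v = (h x)^-1 *:
  (lip (s false x) v *: s true x + lip (s true x) v *: s false x
   - lip (e4 x) v *: sg x - lip (sg x) v *: e4 x).
Proof. by rewrite /lift_proj -scalemxAl !mulmxBl mulmxDl !rkE. Qed.

Let V x := <<[:: sg x; s true x; s false x; ss x]>>%VS.

Lemma lift_proj_oproj x : U x -> is_oproj (V x) (lift_proj x).
Proof.
move=> Ux.
have m1 : sg x \in V x by apply: memv_span; rewrite !inE eqxx.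
have m2 : s true x \in V x by apply: memv_span; rewrite !inE eqxx orbT.
have m3 : s false x \in V x by apply: memv_span; rewrite !inE eqxx !orbT.
have m4 : ss x \in V x by apply: memv_span; rewrite !inE eqxx !orbT.
have e4m : e4 x \in V x by rewrite memvD // memvZ.
have z1 := lip_sg_s true Ux; have z2 := lip_sg_s false Ux.
have z3 := sg_null Ux; have z4 := lip_s_s true Ux; have z5 := lip_s_s false Ux.
have z6 := lip_s_ss true Ux; have z7 := lip_s_ss false Ux.
have z8 := lip_sg_ss Ux; have hx := h0 Ux.
have z1' : lip (s true x) (sg x) = 0 by rewrite ipC.
have z2' : lip (s false x) (sg x) = 0 by rewrite ipC.
have z6' : lip (ss x) (s true x) = 0 by rewrite ipC.
have z7' : lip (ss x) (s false x) = 0 by rewrite ipC.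
have z8' : lip (ss x) (sg x) = - h x by rewrite ipC.
have z9 : lip (s false x) (s true x) = h x by rewrite ipC.
have z10 : lip (s true x) (s false x) = h x by [].
split.
- rewrite /lift_proj ladjZ !ladjB ladjD !ladj_rk; congr (_ *: _).
  by rewrite [rk (s false x) _ + _]addrC addrAC.
- move=> w; rewrite lift_projE; apply: memvZ; apply: memvB; last exact: memvZ.
  by apply: memvB; [apply: memvD|]; exact: memvZ.
pose simp0 := (scale0r, mulr0, mul0r, addr0, add0r, sub0r, subr0, oppr0).
have id1 : lift_proj x *m sg x = sg x.
  rewrite lift_projE /e4 !ipE z1' z2' z3 z8' !simp0 scaleNr opprK.
  by rewrite scalerA mulVf // scale1r.
have id2 : lift_proj x *m s true x = s true x.
  rewrite lift_projE /e4 !ipE z1 z4 z6' z9 !simp0.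
  by rewrite scalerA mulVf // scale1r.
have id3 : lift_proj x *m s false x = s false x.
  rewrite lift_projE /e4 !ipE z2 z5 z7' z10 !simp0.
  by rewrite scalerA mulVf // scale1r.
have id4 : lift_proj x *m ss x = ss x.
  rewrite lift_projE /e4 !ipE z6 z7 z8 !simp0 scaleNr opprK.
  have -> : lip (ss x) (ss x) + k x * - h x = k x * h x.
    by rewrite /k; field; rewrite hx.
  rewrite scalerDr scalerN !scalerA [_^-1 * (_ * _)]mulrCA mulVf // mulr1 scale1r.
  by rewrite addrC -addrA addrN addr0.
move=> v; rewrite /V => /span_consP[a [w [/span3P[b [c [d ->]]] ->]]].
move: (ss x) (s false x) (s true x) (sg x) (lift_proj x) id1 id2 id3 id4.
by move=> v4 v3 v2 v1 X id1 id2 id3 id4; rewrite !mulmxDr -!scalemxAr id1 id2 id3 id4.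
Qed.

Lemma dim_span4 x : U x -> \dim (V x) = 4.
Proof.
move=> Ux; apply/eqP; suff : free [:: sg x; s true x; s false x; ss x] by rewrite /free.
have : free (ss x :: [:: sg x; s true x; s false x]).
  rewrite free_cons; apply/andP; split; last by rewrite /free (h_dim Ux (h0 Ux)).
  apply/negP => /span3P[a [b [c e]]].
  have := congr1 (lip (sg x)) e.
  rewrite !ipDr !ipZr lip_sg_ss // sg_null // !lip_sg_s // !mulr0 !addr0 => /eqP.
  by rewrite oppr_eq0 (negbTE (h0 Ux)).
by rewrite -(@perm_free _ _ [:: ss x; sg x; s true x; s false x]) // -[X in perm_eq X](cat1s) perm_catC.
Qed.

End ConformalLift.

(** * The Laplacian of a conformal lift *)

Section Laplacian.
Variables (R : realType) (S : riemannSurface R) (n : nat) (i : rs_idx S) (U : set S).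
Local Notation C := (Cplx R).
Local Notation vec := 'cV[C]_(n.+2).
Hypotheses (oU : open U) (Ud : U `<=` rs_dom i).
Variable sg : S -> vec.
Hypothesis sg_sm : mxsm i U sg.

Lemma pd1E (f : S -> C) p : pd i 1 f p = cd true i f p + cd false i f p.
Proof. by rewrite !cdE; field. Qed.
Lemma pdiE (f : S -> C) p : pd i 'i f p = 'i * (cd true i f p - cd false i f p).
Proof.
rewrite !cdE; move: (pd i 1 f p) (pd i 'i f p) => x y.
have ii := sqri R; move: ('i : C) ii => I ii.
have -> : I * ((x + - I * y) / 2 - (x + I * y) / 2) = - (I * I) * y by field.
by rewrite ii; ring.
Qed.

Lemma mx_pd1E (F : S -> vec) p : mx_pd i 1 F p = mcd true i F p + mcd false i F p.
Proof. by apply/matrixP => a b; rewrite !(mxE, mcdE) pd1E. Qed.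
Lemma mx_pdiE (F : S -> vec) p : mx_pd i 'i F p = 'i *: (mcd true i F p - mcd false i F p).
Proof. by apply/matrixP => a b; rewrite !(mxE, mcdE) pdiE. Qed.

Hypothesis s_iso : forall b x, U x -> lip (mcd b i sg x) (mcd b i sg x) = 0.
Let h x := lip (mcd true i sg x) (mcd false i sg x).
Hypothesis h_pos : forall x, U x -> 0 < h x.

(** Here E = G = 2h and F = 0, so the area density is also 2h and Beltrami's formula collapses to
    (d_x^2 + d_y^2) / 2h, that is 4 d_z d_zbar / 2h. *)
Lemma laplacianE p : U p ->
  laplacian i sg p = (2 / h p) *: mcd false i (mcd true i sg) p.
Proof.
move=> Up.
pose sx x := mcd true i sg x + mcd false i sg x.
pose sy x := 'i *: (mcd true i sg x - mcd false i sg x).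
have st := mxsm_cd oU Ud true sg_sm; have sf := mxsm_cd oU Ud false sg_sm.
have ex : mx_pd i 1 sg = sx by apply/funext => x; rewrite mx_pd1E.
have ey : mx_pd i 'i sg = sy by apply/funext => x; rewrite mx_pdiE.
have Exx x : U x -> ip (sx x) (sx x) = 2 * h x.
  move=> Ux; rewrite -lipE /sx !ipE !s_iso // add0r addr0 [lip (mcd false i sg x) _]ipC.
  by rewrite mulr_natl mulr2n.
have Eyy x : U x -> ip (sy x) (sy x) = 2 * h x.
  move=> Ux; rewrite -lipE /sy ipZl ipZr mulrA sqri !(ipBl, ipBr) !s_iso // sub0r subr0.
  by rewrite [lip (mcd false i sg x) _]ipC -/(h x); ring.
have Exy x : U x -> ip (sx x) (sy x) = 0.
  move=> Ux; rewrite -lipE /sx /sy ipZr !(ipDl, ipBr) !s_iso //.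
  by rewrite [lip (mcd false i sg x) _]ipC sub0r subr0 addNr mulr0.
pose w x := realC (Num.sqrt (ReC (ip (sx x) (sx x) * ip (sy x) (sy x) - ip (sx x) (sy x) ^+ 2))).
have ew x : U x -> w x = 2 * h x.
  move=> Ux; rewrite /w Exx // Eyy // Exy //.
  have hr : realC (ReC (h x)) = h x by rewrite /realC /ReC RRe_real // gtr0_real // h_pos.
  have -> : 2 * h x * (2 * h x) - 0 ^+ 2 = realC ((2 * ReC (h x)) ^+ 2).
    by rewrite [in RHS]expr2 !realCM hr (realCn R 2); ring.
  rewrite ReCr sqrtr_sqr ger0_norm; first by rewrite realCM hr (realCn R 2).
  rewrite mulr_ge0 // -realC_ge0 hr ltW //; exact: h_pos.
have h0 x : U x -> 2 * h x != 0.
  by move=> Ux; rewrite mulf_neq0 ?pnatr_eq0 // gt_eqF // h_pos.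
have nearU : \forall x \near p, U x by apply: open_nbhs_nbhs.
have pdeq v (F G : S -> vec) : (forall x, U x -> F x = G x) -> mx_pd i v F p = mx_pd i v G p.
  move=> FG; apply/matrixP => a b; rewrite !mxE; apply: pd_near_eq; first exact: Ud.
  by apply: filterS nearU => x /FG ->.
pose Fx x := (w x)^-1 *: (ip (sy x) (sy x) *: sx x - ip (sx x) (sy x) *: sy x).
pose Fy x := (w x)^-1 *: (ip (sx x) (sx x) *: sy x - ip (sx x) (sy x) *: sx x).
have -> : laplacian i sg p = (w p)^-1 *: (mx_pd i 1 Fx p + mx_pd i 'i Fy p).
  by rewrite /laplacian ex ey.
have eFx x : U x -> Fx x = sx x.
  by move=> Ux; rewrite /Fx ew // Eyy // Exy // scale0r subr0 scalerA mulVf ?h0 // scale1r.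
have eFy x : U x -> Fy x = sy x.
  by move=> Ux; rewrite /Fy ew // Exx // Exy // scale0r subr0 scalerA mulVf ?h0 // scale1r.
rewrite (pdeq _ _ _ eFx) (pdeq _ _ _ eFy).
rewrite mx_pd1E mx_pdiE ew //.
have dx b : mcd b i sx p = mcd b i (mcd true i sg) p + mcd b i (mcd false i sg) p.
  exact: (mcdD oU Ud b Up st sf).
have dy b : mcd b i sy p = 'i *: (mcd b i (mcd true i sg) p - mcd b i (mcd false i sg) p).
  by rewrite (mcdZc oU Ud b Up) ?(mcdB oU Ud b Up) //; apply: mxsmB.
rewrite !dx !dy (mcd_comm oU Ud true Up sg_sm) /=.
rewrite -scalerBr scalerA sqri scaleN1r.
move: (mcd true i (mcd true i sg) p) (mcd false i (mcd true i sg) p) (mcd false i (mcd false i sg) p).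
move=> a b c.
have -> : a + b + (b + c) - (a - b - (b - c)) = 4 *: b.
  by apply/matrixP => x y; rewrite !mxE; ring.
by rewrite scalerA; congr (_ *: _); field; rewrite gt_eqF // h_pos.
Qed.

End Laplacian.

(** * Independence of the lift and of the chart *)

Section LiftIndependence.
Variables (R : realType) (S : riemannSurface R) (n : nat).
Local Notation C := (Cplx R).
Local Notation vec := 'cV[C]_(n.+2).
Implicit Types (O U : set S) (L : S -> {vspace vec}) (sg : S -> vec) (p : S) (i j : rs_idx S).

Definition T2 b i sg p := <<[:: sg p; mcd b i sg p]>>%VS.
Definition T3 i sg p := <<[:: sg p; mcd true i sg p; mcd false i sg p]>>%VS.
Definition T4 i sg p :=
  <<[:: sg p; mcd true i sg p; mcd false i sg p; mcd false i (mcd true i sg) p]>>%VS.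

Lemma nonzero_nbhd U (f : S -> C) p : open U -> U p -> {for p, continuous f} -> f p != 0 ->
  exists U', [/\ open U', U' p, U' `<=` U & forall x, U' x -> f x != 0].
Proof.
move=> oU Up /continuousC fc f0.
have n0 : 0 < norm1 (f p) by rewrite lt_neqAle eq_sym norm1_eq0 f0 norm1_ge0.
have near : nbhs p (U `&` [set x | f x != 0]).
  apply: filterI; first by apply: open_nbhs_nbhs.
  apply: filterS (fc _ n0) => x /= h; apply/eqP => fx.
  by move: h; rewrite fx sub0r norm1N ltxx.
exists (interior (U `&` [set x | f x != 0])); split.
- exact: open_interior.
- exact: near.
- by move=> x /interior_subset [].
- by move=> x /interior_subset [].
Qed.

Lemma lift_ratio U sg sg' i p : open U -> U `<=` rs_dom i -> U p ->
  mxsm i U sg -> mxsm i U sg' -> sg p != 0 ->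
  (forall x, U x -> sg' x \in <[sg x]>%VS) ->
  exists U' f, [/\ open U', U' p, U' `<=` U, sm i U' f & forall x, U' x -> sg' x = f x *: sg x].
Proof.
move=> oU Ud Up hs hs' s0 sL.
have [a a0] : exists a, sg p a 0 != 0.
  apply/existsP; move: s0; apply: contraR; rewrite negb_exists => /forallP h.
  by apply/eqP/matrixP => a b; rewrite ord1 mxE; apply/eqP; move: (h a); rewrite negbK.
have [U' [oU' U'p sub h0]] := nonzero_nbhd oU Up (sm_cont (hs a 0) Up) a0.
have Ud' : U' `<=` rs_dom i by move=> x /sub /Ud.
exists U', (fun x => sg' x a 0 * (sg x a 0)^-1); split=> //.
  apply: smM => //; first exact: sm_sub sub (hs' a 0).
  by apply: smV => //; exact: sm_sub sub (hs a 0).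
move=> x U'x; have /vlineP[c e] := sL x (sub x U'x).
by rewrite e mxE mulfK // h0.
Qed.

Lemma span_change_lift U i sg sg' f p : open U -> U `<=` rs_dom i -> U p ->
  mxsm i U sg -> sm i U f -> (forall x, U x -> sg' x = f x *: sg x) ->
  [/\ forall b, (T2 b i sg' p <= T2 b i sg p)%VS, (T3 i sg' p <= T3 i sg p)%VS &
      (T4 i sg' p <= T4 i sg p)%VS].
Proof.
move=> oU Ud Up hs hf e.
have d1 b x : U x -> mcd b i sg' x = cd b i f x *: sg x + f x *: mcd b i sg x.
  by move=> Ux; rewrite (mcd_ext oU Ud b Ux e) (mcdZ oU Ud b Ux hf hs).
have hcf b := sm_cd b oU Ud hf; have hcs b := mxsm_cd oU Ud b hs.
have d2 : mcd false i (mcd true i sg') p =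
   (cd false i (cd true i f) p *: sg p + cd true i f p *: mcd false i sg p) +
   (cd false i f p *: mcd true i sg p + f p *: mcd false i (mcd true i sg) p).
  rewrite (mcd_ext oU Ud false Up (d1 true)) (mcdD oU Ud false Up); last 2 first.
  - by apply: mxsmZ.
  - by apply: mxsmZ.
  by rewrite (mcdZ oU Ud false Up (hcf true) hs) (mcdZ oU Ud false Up hf (hcs true)).
have m X (v : vec) : v \in X -> v \in <<X>>%VS by apply: memv_span.
split=> [b||]; apply/span_subvP => v; rewrite !inE.
- move=> /orP[/eqP ->|/eqP ->]; rewrite ?e ?d1 //; do ?apply: memvD; apply: memvZ; apply: m;
    by rewrite !inE eqxx ?orbT.
- move=> /or3P[/eqP ->|/eqP ->|/eqP ->]; rewrite ?e ?d1 //; do ?apply: memvD; apply: memvZ; apply: m;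
    by rewrite !inE eqxx ?orbT.
move=> /or4P[/eqP ->|/eqP ->|/eqP ->|/eqP ->]; rewrite ?e ?d2 ?d1 //; do ?apply: memvD; apply: memvZ; apply: m;
    by rewrite !inE eqxx ?orbT.
Qed.

Lemma span_change_chart U i j sg p : open U -> U `<=` rs_dom i -> U `<=` rs_dom j -> U p ->
  mxsm i U sg -> mxsm j U sg ->
  [/\ forall b, (T2 b i sg p <= T2 b j sg p)%VS, (T3 i sg p <= T3 j sg p)%VS &
      mcd true j sg p != 0 -> (T4 i sg p <= T4 j sg p)%VS].
Proof.
move=> oU Ui Uj Up hsi hsj.
have /boolp.choice[phi hphi] (x : S) : exists phi : C, U x -> forall f, smn j U 1 f ->
  C1 i f x /\ forall b, cd b i f x = (if b then phi else phi^*) * cd b j f x.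
  have [Ux|nUx] := pselect (U x); last by exists 0.
  by have [phi hphi] := chain_rule (Ui _ Ux) (Uj _ Ux); exists phi => _ f; apply: hphi.
have d1 b x : U x -> mcd b i sg x = (if b then phi x else (phi x)^*) *: mcd b j sg x.
  move=> Ux; apply/matrixP => a c; rewrite mcdE [RHS]mxE mcdE.
  by have [_ ->] := hphi x Ux _ (hsj a c 1%N).
have m X (v : vec) : v \in X -> v \in <<X>>%VS by apply: memv_span.
split=> [b||st0]; apply/span_subvP => v; rewrite !inE.
- move=> /orP[/eqP ->|/eqP ->]; rewrite ?d1 //; do ?apply: memvZ; apply: m;
    by rewrite !inE eqxx ?orbT.
- move=> /or3P[/eqP ->|/eqP ->|/eqP ->]; rewrite ?d1 //; do ?apply: memvZ; apply: m;
    by rewrite !inE eqxx ?orbT.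
(* The factor [phi] is only known point by point. Near [p] it is a quotient of components of the two
   derivatives, by a component of [mcd true j sg] that does not vanish; this makes it
   differentiable. *)
have [a a0] : exists a, mcd true j sg p a 0 != 0.
  apply/existsP; move: st0; apply: contraR; rewrite negb_exists => /forallP h.
  by apply/eqP/matrixP => a b; rewrite ord1 [RHS]mxE; apply/eqP; move: (h a); rewrite negbK.
have hti := mxsm_cd oU Ui true hsi; have htj := mxsm_cd oU Uj true hsj.
have [U' [oU' U'p sub h0]] := nonzero_nbhd oU Up (sm_cont (htj a 0) Up) a0.
have di := Ui _ Up.
have C1j c : C1 i (fun x => mcd true j sg x c 0) p.
  by have [] := hphi p Up _ (htj c 0 1%N).
have cdj c : cd false i (fun x => mcd true j sg x c 0) p =
   (phi p)^* * cd false j (fun x => mcd true j sg x c 0) p.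
  by have [_ ->] := hphi p Up _ (htj c 0 1%N).
have C1phi : C1 i phi p.
  apply: (@C1_local _ _ i p di (fun x => mcd true i sg x a 0 * (mcd true j sg x a 0)^-1)).
    have : nbhs p U' by apply: open_nbhs_nbhs.
    by apply: filterS => x U'x; rewrite d1 ?mxE ?mulfK ?h0 //; apply: sub.
  apply: C1M => //; first exact: sm_C1 (hti a 0) Up.
  by apply: C1V => //; apply: C1j.
have d2 : mcd false i (mcd true i sg) p = cd false i phi p *: mcd true j sg p +
    (phi p * (phi p)^*) *: mcd false j (mcd true j sg) p.
  apply/matrixP => c b; rewrite ord1 mcdE !mxE.
  rewrite (mcdE false j (mcd true j sg) p c 0) -mulrA -cdj.
  rewrite -(cdM di false C1phi (C1j c)); apply: cd_local => //.
  have : nbhs p U by apply: open_nbhs_nbhs.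
  by apply: filterS => x Ux; rewrite d1 // mxE.
move=> /or4P[/eqP ->|/eqP ->|/eqP ->|/eqP ->]; rewrite ?d2 ?d1 //; do ?apply: memvD; do ?apply: memvZ; apply: m;
    by rewrite !inE eqxx ?orbT.
Qed.

End LiftIndependence.

(** * Local frames and the projection onto the central sphere congruence *)

Section Frames.
Variables (R : realType) (S : riemannSurface R) (n : nat).
Local Notation C := (Cplx R).
Local Notation vec := 'cV[C]_(n.+2).
Local Notation End := 'M[C]_(n.+2).
Implicit Types (O U W : set S) (L : S -> {vspace vec}) (sg : S -> vec) (p x : S) (i j : rs_idx S).

Lemma open_chart i U : open U -> open (U `&` rs_dom i).
Proof. by move=> oU; apply: openI => //; exact: rs_open_dom. Qed.

Lemma is_lift_sm O L sg i : is_lift O L sg -> mxsm i (O `&` rs_dom i) sg.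
Proof. by case=> /mx_smooth_sm h _; apply: h. Qed.

Lemma T3_st i sg p : \dim (T3 i sg p) = 3 -> mcd true i sg p != 0.
Proof.
move=> d; apply/eqP => e.
have sub : (T3 i sg p <= <<[:: sg p; mcd false i sg p]>>)%VS.
  apply/span_subvP => v; rewrite !inE => /or3P[]/eqP ->; rewrite ?e ?mem0v //;
  by apply: memv_span; rewrite !inE eqxx ?orbT.
by have := leq_trans (dimvS sub) (dim_span _); rewrite d.
Qed.

Lemma vs_anti (A B : {vspace vec}) : (A <= B)%VS -> (B <= A)%VS -> A = B.
Proof. by move=> AB BA; apply/eqP; rewrite eqEsubv AB BA. Qed.

Lemma lift_spans O O' L sg sg' i j p : open O -> open O' -> is_lift O L sg -> is_lift O' L sg' ->
  O p -> O' p -> rs_dom i p -> rs_dom j p ->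
  [/\ forall b, T2 b i sg p = T2 b j sg' p, T3 i sg p = T3 j sg' p &
      \dim (T3 i sg p) = 3 -> T4 i sg p = T4 j sg' p].
Proof.
move=> oO oO' l l' Op O'p dip djp.
pose U := O `&` O' `&` (rs_dom i `&` rs_dom j).
have oU : open U by apply: openI; apply: openI => //; exact: rs_open_dom.
have Up : U p by [].
have Ui : U `<=` rs_dom i by move=> x [_ []].
have Uj : U `<=` rs_dom j by move=> x [_ []].
have hs k : U `<=` rs_dom k -> mxsm k U sg.
  by move=> Uk; apply: mxsm_sub (is_lift_sm k l) => x Ux; split; [case: Ux => [[]]|exact: Uk].
have hs' k : U `<=` rs_dom k -> mxsm k U sg'.
  by move=> Uk; apply: mxsm_sub (is_lift_sm k l') => x Ux; split; [case: Ux => [[]]|exact: Uk].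
have [c2 c3 c4] := span_change_chart oU Ui Uj Up (hs i Ui) (hs j Uj).
have [c2' c3' c4'] := span_change_chart oU Uj Ui Up (hs j Uj) (hs i Ui).
have [_ lp] := l; have [_ lp'] := l'.
have [_ s0 _ _] := lp p Op; have [_ s0' _ _] := lp' p O'p.
have e1 x : U x -> sg' x \in <[sg x]>%VS.
  move=> [[Ox O'x] _]; have [_ _ _ <-] := lp x Ox.
  by have [_ _ _ ->] := lp' x O'x; rewrite memv_line.
have e1' x : U x -> sg x \in <[sg' x]>%VS.
  move=> [[Ox O'x] _]; have [_ _ _ <-] := lp' x O'x.
  by have [_ _ _ ->] := lp x Ox; rewrite memv_line.
have [V [f [oV Vp VU hf ef]]] := lift_ratio oU Uj Up (hs j Uj) (hs' j Uj) s0 e1.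
have [V' [f' [oV' Vp' VU' hf' ef']]] := lift_ratio oU Uj Up (hs' j Uj) (hs j Uj) s0' e1'.
have Vj : V `<=` rs_dom j by move=> x /VU /Uj.
have Vj' : V' `<=` rs_dom j by move=> x /VU' /Uj.
have [d2 d3 d4] := span_change_lift oV Vj Vp (mxsm_sub VU (hs j Uj)) hf ef.
have [d2' d3' d4'] := span_change_lift oV' Vj' Vp' (mxsm_sub VU' (hs' j Uj)) hf' ef'.
have E3 : T3 i sg p = T3 j sg p by exact: vs_anti c3 c3'.
split=> [b||d].
- exact: vs_anti (subv_trans (c2 b) (d2' b)) (subv_trans (d2 b) (c2' b)).
- by rewrite E3; exact: vs_anti d3' d3.
have ti := T3_st d; have tj : mcd true j sg p != 0 by apply: T3_st; rewrite -E3.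
exact: vs_anti (subv_trans (c4 tj) d4') (subv_trans d4 (c4' ti)).
Qed.

Definition Lam b L := if b then Lam10 L else Lam01 L.

(** The definitions fix one lift and one chart at each point; this replaces them by any lift and
    chart, so that the bundles can be differentiated. *)
Lemma LamE O L sg i p : open O -> is_lift O L sg -> O p -> rs_dom i p ->
  (forall b, Lam b L p = T2 b i sg p) /\ Lam1 L p = T3 i sg p.
Proof.
move=> oO l Op dip.
have : is_lift_near p L (lift_near L p).
  by apply: (@xgetPex _ (fun=> 0) (is_lift_near p L)); exists sg; exists O.
move=> [O' [oO' O'p l']].
have dc : rs_dom (chart_at p) p by exact: (projT2 (cid (rs_cover p))).
have [e2 e3 _] := lift_spans oO' oO l' l O'p Op dc dip.
split; last by rewrite -e3 /Lam1 /T3 -mcdzE -mcdzbE.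
by move=> b; rewrite -e2; case: b; rewrite /Lam /Lam10 /Lam01 /T2 -?mcdzE -?mcdzbE.
Qed.

Record cframe i U L sg : Prop := {
  cf_open : open U;
  cf_dom : U `<=` rs_dom i;
  cf_sm : mxsm i U sg;
  cf_real : forall x, U x -> conjv (sg x) = sg x;
  cf_null : forall x, U x -> lip (sg x) (sg x) = 0;
  cf_neq0 : forall x, U x -> sg x != 0;
  cf_iso : forall b x, U x -> lip (mcd b i sg x) (mcd b i sg x) = 0;
  cf_h : forall x, U x -> 0 < lip (mcd true i sg x) (mcd false i sg x);
  cf_L : forall x, U x -> L x = <[sg x]>%VS;
  cf_Lam : forall b x, U x -> Lam b L x = T2 b i sg x;
  cf_Lam1 : forall x, U x -> Lam1 L x = T3 i sg x
}.

Lemma conf_frame W L O sg i : open W -> conformal_immersion W L -> open O -> is_lift O L sg ->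
  cframe i (W `&` O `&` rs_dom i) L sg.
Proof.
move=> oW [_ hW] oO l; set U := W `&` O `&` rs_dom i.
have oU : open U by apply: open_chart; apply: openI.
have Ud : U `<=` rs_dom i by move=> x [].
have hs : mxsm i U sg by apply: mxsm_sub (is_lift_sm i l) => x [[_ ?] ?].
have [_ lp] := l.
have lx x : U x -> [/\ conjv (sg x) = sg x, lip (sg x) (sg x) = 0, sg x != 0 & L x = <[sg x]>%VS].
  by move=> [[_ Ox] _]; have [a b c d] := lp x Ox; rewrite lipE.
have LE x : U x -> (forall b, Lam b L x = T2 b i sg x) /\ Lam1 L x = T3 i sg x.
  by move=> [[_ Ox] dx]; apply: (LamE oO l Ox dx).
have real x : U x -> conjv (sg x) = sg x by move=> /lx[].
have null x : U x -> lip (sg x) (sg x) = 0 by move=> /lx[].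
have neq0 x : U x -> sg x != 0 by move=> /lx[].
have iso1 x : U x -> lip (mcd true i sg x) (mcd true i sg x) = 0.
  move=> Ux; have [[Wx Ox] dx] := Ux; have [_ isoL] := hW x Wx.
  have [e _] := LE x Ux; rewrite lipE; apply: isoL; rewrite -[Lam10 L x]/(Lam true L x) e;
  by apply: memv_span; rewrite !inE eqxx orbT.
have iso b x : U x -> lip (mcd b i sg x) (mcd b i sg x) = 0.
  by move=> Ux; apply: (lip_s_s oU Ud hs real iso1).
split=> //; try by move=> x /lx[].
- move=> x Ux; have [p0 p3] := h_pos oU Ud hs real null neq0 iso1 Ux.
  rewrite lt_def p0 andbT; apply/eqP => /p3/eqP; apply.
  have [_ e3] := LE x Ux; have [[Wx _] _] := Ux.
  by change (\dim (T3 i sg x) = 3); rewrite -e3; have [] := hW x Wx.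
- by move=> b x /LE[].
- by move=> x /LE[].
Qed.

Lemma cf_dim i U L sg x : cframe i U L sg -> U x -> \dim (T3 i sg x) = 3.
Proof.
move=> cf Ux; have [oU Ud hs real null neq0 iso h _ _ _] := cf.
by apply: (h_dim oU Ud hs real null neq0 (iso true) Ux); rewrite gt_eqF // h.
Qed.

Lemma two_div_neq0 (h : C) : 0 < h -> 2 / h != 0.
Proof. by move=> h0; rewrite mulf_neq0 ?invr_eq0 ?pnatr_eq0 // gt_eqF. Qed.

Lemma central_sphereE W L O sg i x : open W -> conformal_immersion W L -> open O ->
  is_lift O L sg -> W x -> O x -> rs_dom i x -> central_sphere L x = T4 i sg x.
Proof.
move=> oW hW oO l Wx Ox dx.
have : is_lift_near x L (lift_near L x).
  by apply: (@xgetPex _ (fun=> 0) (is_lift_near x L)); exists sg; exists O.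
move=> [O' [oO' O'x l']].
have dc : rs_dom (chart_at x) x by exact: (projT2 (cid (rs_cover x))).
have cf := conf_frame (chart_at x) oW hW oO' l'.
have Ux : (W `&` O' `&` rs_dom (chart_at x)) x by [].
have [_ _ e4] := lift_spans oO' oO l' l O'x Ox dc dx.
rewrite -(e4 (cf_dim cf Ux)) /central_sphere (cf_Lam1 cf Ux).
have E : exists2 k : C, k != 0 & laplacian (chart_at x) (lift_near L x) x =
    k *: mcd false (chart_at x) (mcd true (chart_at x) (lift_near L x)) x.
  eexists; last exact: (laplacianE (cf_open cf) (@cf_dom _ _ _ _ cf) (cf_sm cf)
    (cf_iso cf) (cf_h cf) Ux).
  exact: two_div_neq0 (cf_h cf Ux).
have [h h0 ->] := E; rewrite /T4.
move: (mcd false _ (mcd true _ _) x) => ss.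
have m X (v : vec) : v \in X -> v \in <<X>>%VS by apply: memv_span.
apply: vs_anti; first (rewrite subv_add; apply/andP; split).
- apply/span_subvP => v; rewrite !inE => /or3P[]/eqP ->; apply: m; by rewrite !inE eqxx ?orbT.
- by rewrite -memvE; apply: memvZ; apply: m; rewrite !inE eqxx ?orbT.
apply/span_subvP => v; rewrite !inE => /or4P[]/eqP ->.
- by apply: (subvP (addvSl _ _)); apply: m; rewrite !inE eqxx ?orbT.
- by apply: (subvP (addvSl _ _)); apply: m; rewrite !inE eqxx ?orbT.
- by apply: (subvP (addvSl _ _)); apply: m; rewrite !inE eqxx ?orbT.
apply: (subvP (addvSr _ _)); apply/vlineP; exists h^-1.
by rewrite scalerA (mulVf h0) scale1r.
Qed.

Lemma cf_oproj i U L sg x : cframe i U L sg -> U x ->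
  is_oproj (T4 i sg x) (lift_proj i sg x).
Proof.
move=> cf Ux; have [oU Ud hs real null neq0 iso h _ _ _] := cf.
apply: (lift_proj_oproj oU Ud hs real null (iso true) _ Ux) => y Uy.
by rewrite gt_eqF // h.
Qed.

Lemma cf_proj_sm i U L sg : cframe i U L sg -> mxsm i U (lift_proj i sg).
Proof.
move=> cf; have [oU Ud hs real null neq0 iso h _ _ _] := cf.
apply: (lift_proj_sm oU Ud hs) => y Uy.
by rewrite gt_eqF // h.
Qed.

Lemma oproj_unique (V : {vspace vec}) (P Q : End) : is_oproj V P -> is_oproj V Q -> P = Q.
Proof.
move=> [aP hP iP] [aQ hQ iQ].
have PQ : P *m Q = Q by apply: mulmx_ext => w; rewrite -mulmxA iP.
have QP : Q *m P = P by apply: mulmx_ext => w; rewrite -mulmxA iQ.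
by rewrite -QP -[in LHS]aP -[in LHS]aQ -ladjM PQ aQ.
Qed.

Lemma sm_near i U (f : S -> C) :
  (forall p, U p -> exists2 U', U' p & sm i U' f) -> sm i U f.
Proof.
move=> h; apply/smn_pds => s p Up; have [U' U'p /smn_pds k] := h p Up.
exact: k.
Qed.

(* the orthogonal projection onto [V p]; junk if there is none *)
Definition oproj (V : S -> {vspace vec}) (p : S) : End := xget 0 [set P | is_oproj (V p) P].

Lemma conf_cframe L p i : conformal_immersion setT L -> rs_dom i p ->
  exists U sg, [/\ cframe i U L sg, U p & forall x, U x -> central_sphere L x = T4 i sg x].
Proof.
move=> cL dp; have [sg [O [oO Op l]]] := cL.1 p I.
exists (setT `&` O `&` rs_dom i), sg; split=> //.
  exact: conf_frame openT cL oO l.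
by move=> x [[_ Ox] dx]; apply: (central_sphereE openT cL oO l).
Qed.

Lemma oprojE (V : S -> {vspace vec}) x P : is_oproj (V x) P -> oproj V x = P.
Proof.
move=> h; apply: (@oproj_unique (V x)) => //.
by apply: (@xgetPex _ 0 [set P | is_oproj (V x) P]); exists P.
Qed.

(** Uniqueness of orthogonal projections glues the explicit local formulas [lift_proj] into one
    global smooth map. *)
Lemma conf_oproj L (V := central_sphere L) : conformal_immersion setT L ->
  (forall x, is_oproj (V x) (oproj V x)) /\ mx_smooth setT (oproj V).
Proof.
move=> cL; have loc p i : rs_dom i p -> exists U sg, [/\ cframe i U L sg, U p &
    forall x, U x -> is_oproj (V x) (lift_proj i sg x)].
  move=> dp; have [U [sg [cf Up e]]] := conf_cframe cL dp.
  by exists U, sg; split=> // x Ux; rewrite /V e //; apply: cf_oproj cf Ux.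
split=> [x|].
  have [i dx] := rs_cover x; have [U [sg [cf Ux h]]] := loc x i dx.
  by rewrite (oprojE (h x Ux)); apply: h.
apply/mx_smooth_sm => i a b; apply: sm_near => p [_ dp].
have [U [sg [cf Up h]]] := loc p i dp; exists U => //.
apply: (sm_ext (cf_open cf) (@cf_dom _ _ _ _ cf) _ (cf_proj_sm cf a b)).
by move=> x Ux; rewrite (oprojE (h x Ux)).
Qed.

End Frames.
(** * The flat family of a constrained Willmore surface *)

Section MatrixIdentities.
Variables (F : comNzRingType) (m k : nat).
Local Notation M := 'M[F]_(m, k).

Lemma entry_add (A B : M) i j x y : A i j = x -> B i j = y -> (A + B) i j = x + y.
Proof. by rewrite mxE => -> ->. Qed.
Lemma entry_opp (A : M) i j x : A i j = x -> (- A) i j = - x.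
Proof. by rewrite mxE => ->. Qed.
Lemma entry_scale (a : F) (A : M) i j x : A i j = x -> (a *: A) i j = a * x.
Proof. by rewrite mxE => ->. Qed.
Lemma entry_zero i j : (0 : M) i j = 0.
Proof. by rewrite mxE. Qed.
Lemma entry_eq (A B : M) i j x y : A i j = x -> B i j = y -> x = y -> A i j = B i j.
Proof. by move=> -> ->. Qed.
End MatrixIdentities.

(** Entries are computed along sums, opposites and scalings only. Products and other matrices stay
    atomic, which leaves a scalar identity for [ring] or [field]. *)
Ltac mx_entry := lazymatch goal with
  | |- fun_of_matrix (GRing.add _ _) _ _ = _ => eapply entry_add; [mx_entry | mx_entry]
  | |- fun_of_matrix (GRing.opp _) _ _ = _ => eapply entry_opp; mx_entry
  | |- fun_of_matrix (GRing.scale _ _) _ _ = _ => eapply entry_scale; mx_entry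
  | |- fun_of_matrix (@GRing.zero _) _ _ = _ => eapply entry_zero
  | _ => reflexivity
  end.
Ltac mx_entries := apply/matrixP => ? ?; eapply entry_eq; [mx_entry | mx_entry | ].
Ltac mx_ring := mx_entries; ring.

(** * The Codazzi and flatness identities for matrices *)

Section LieAlgebra.
Variables (R : realType) (k : nat).
Local Notation M := 'M[Cplx R]_k.
Implicit Types P n m : M.

(* [T] is the curl of [N], and the hypotheses are the derivatives of [nP + Pn = n] and the
   symmetry of the second derivatives of [P], whose first derivatives are [[n, P]], [[m, P]]. *)
Lemma codazzi_algebra P n m nf mt : P *m P = P -> P *m n + n *m P = n -> P *m m + m *m P = m ->
  (m *m P - P *m m) *m n + P *m nf + (nf *m P + n *m (m *m P - P *m m)) = nf ->
  (n *m P - P *m n) *m m + P *m mt + (mt *m P + m *m (n *m P - P *m n)) = mt ->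
  nf *m P + n *m (m *m P - P *m m) - ((m *m P - P *m m) *m n + P *m nf) =
  mt *m P + m *m (n *m P - P *m n) - ((n *m P - P *m n) *m m + P *m mt) ->
  mt - nf = 2 *: lie n m.
Proof.
move=> PP Pn Pm.
have {}Pn : P *m n = n - n *m P by rewrite -[X in X - _]Pn addrK.
have {}Pm : P *m m = m - m *m P by rewrite -[X in X - _]Pm addrK.
have mPn : m *m P *m n = m *m n - m *m n *m P by rewrite -(mulmxA m n P) -mulmxBr -Pn mulmxA.
have nPm : n *m P *m m = n *m m - n *m m *m P by rewrite -(mulmxA n m P) -mulmxBr -Pm mulmxA.
have Pnm : P *m n *m m = n *m m *m P by rewrite Pn mulmxBl nPm opprB addrC subrK.
have Pmn : P *m m *m n = m *m n *m P by rewrite Pm mulmxBl mPn opprB addrC subrK.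
have dPn : (m *m P - P *m m) *m n = m *m n - 2 *: (m *m n *m P).
  by rewrite mulmxBl mPn Pmn; mx_ring.
have dPm : (n *m P - P *m n) *m m = n *m m - 2 *: (n *m m *m P).
  by rewrite mulmxBl nPm Pnm; mx_ring.
have ndP : n *m (m *m P - P *m m) = 2 *: (n *m m *m P) - n *m m.
  by rewrite mulmxBr !mulmxA nPm; mx_ring.
have mdP : m *m (n *m P - P *m n) = 2 *: (m *m n *m P) - m *m n.
  by rewrite mulmxBr !mulmxA mPn; mx_ring.
rewrite dPn dPm ndP mdP => hn hm hs; set T := mt - nf.
have comm : T *m P = P *m T.
  apply/eqP; rewrite -subr_eq0 /T mulmxBl mulmxBr; apply/eqP.
  move/eqP: hs; rewrite -subr_eq0 => /eqP /(congr1 -%R); rewrite oppr0 => <-.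
  by mx_ring.
have hT : P *m T + T *m P - T = 4 *: (lie n m *m P) - 2 *: lie n m.
  apply/eqP; rewrite -subr_eq0; apply/eqP.
  move/eqP: hn; rewrite -subr_eq0 => /eqP hn; move/eqP: hm; rewrite -subr_eq0 => /eqP hm.
  rewrite -(subrr (0 : M)) -{1}hm -hn /T /lie !(mulmxBl, mulmxBr); mx_ring.
(* With [K = lie n m] this reads 2TP - T = 4KP - 2K. Multiplication by [P] gives TP = 2KP, and
   substituting back gives T = 2K. *)
rewrite -comm in hT; move: (lie n m) hT => K hT; clearbody T.
have TP : T *m P = 2 *: (K *m P).
  have := congr1 (mulmx^~ P) hT.
  rewrite (mulmxBl _ T) (mulmxBl _ _ P) mulmxDl -!scalemxAl -(mulmxA T) -(mulmxA K) PP => h.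
  rewrite -[LHS](addrK (T *m P)) h; mx_ring.
have -> : T = T *m P + T *m P - (T *m P + T *m P - T) by mx_ring.
by rewrite hT TP; mx_ring.
Qed.

(** [h1] and [h2] determine [dm] and [dn]. After substitution everything cancels up to a multiple of
    [lie u v]. *)
Lemma flat_algebra n m u v dn dm du dv (l : Cplx R) : l != 0 ->
  dm - dn = 2 *: lie n m -> dm + dn = 2 *: (lie u m + lie v n) ->
  du = lie m u -> dv = lie n v -> lie u v = 0 ->
  let a := - n + l *: n + (l ^+ 2 - 1) *: u in
  let b := - m + l^-1 *: m + (l ^- 2 - 1) *: v in
  (- dm + l^-1 *: dm + (l ^- 2 - 1) *: dv) - (- dn + l *: dn + (l ^+ 2 - 1) *: du)
    + lie a b = 0.
Proof.
move=> l0 h1 h2 -> -> uv /=.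
have -> : dm = lie n m + lie u m + lie v n.
  have -> : dm = 2^-1 *: ((dm - dn) + (dm + dn)).
    by mx_entries; field.
  by rewrite h1 h2; mx_entries; field.
have -> : dn = lie u m + lie v n - lie n m.
  have -> : dn = 2^-1 *: ((dm + dn) - (dm - dn)).
    by mx_entries; field.
  by rewrite h1 h2; mx_entries; field.
have {}uv : u *m v = v *m u by apply/eqP; rewrite -subr_eq0; apply/eqP.
rewrite /lie !(mulmxDl, mulmxDr, mulmxN, mulNmx) -!(scalemxAl, scalemxAr) uv.
move: (n *m m) (m *m n) (u *m m) (m *m u) (n *m v) (v *m n) (v *m u).
by move=> x1 x2 x3 x4 x5 x6 x7; mx_entries; field.
Qed.

End LieAlgebra.

(** * The splitting of d in terms of the projection *)

Section Splitting.
Variables (R : realType) (S : riemannSurface R) (n : nat).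
Local Notation C := (Cplx R).
Local Notation vec := 'cV[C]_(n.+2).
Local Notation End := 'M[C]_(n.+2).

(* coefficient of dz for [b = true], of dzbar for [b = false] *)
Definition coef m k b (al : form1 S m k) (i : rs_idx S) (x : S) : 'M[C]_(m, k) :=
  if b then (al i x).1 else (al i x).2.

Section Chart.
Variables (i : rs_idx S) (U : set S).
Hypotheses (oU : open U) (Ud : U `<=` rs_dom i).

Lemma mxsm_ladj (X : S -> End) : mxsm i U X -> mxsm i U (fun x => ladj (X x)).
Proof.
move=> hX; have hJ := mxsm_cst oU Ud (lgram R n).
have h := mxsmM oU Ud (mxsmM oU Ud hJ (mxsm_tr oU Ud hX)) hJ.
by apply: (mxsm_ext oU Ud _ h) => x _; rewrite ladjE.
Qed.

Lemma mcd_ladj b (X : S -> End) x : mxsm i U X -> U x ->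
  mcd b i (fun y => ladj (X y)) x = ladj (mcd b i X x).
Proof.
move=> hX Ux; have hJ := mxsm_cst oU Ud (lgram R n).
have hT := mxsm_tr oU Ud hX.
have hJT := mxsmM oU Ud hJ hT.
have e' y : U y -> ladj (X y) = lgram R n *m (X y)^T *m lgram R n by rewrite ladjE.
rewrite (mcd_ext oU Ud b Ux e') (mcdM oU Ud b Ux hJT hJ) (mcdM oU Ud b Ux hJ hT).
by rewrite !mcd_cst mul0mx add0r mulmx0 addr0 mcd_tr ladjE.
Qed.

(** The splitting d = D_V + N expressed through the projection: [cs_skew] and [cs_mixed] say that
    [N] has values in V /\ V^perp, and [cs_dP] that [P] is parallel for d - N. *)
Record csplit (P : S -> End) (N : bool -> S -> End) : Prop := CSplit {
  cs_P_sm : mxsm i U P;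
  cs_idem : forall x, U x -> P x *m P x = P x;
  cs_N_sm : forall b, mxsm i U (N b);
  cs_skew : forall b x, U x -> ladj (N b x) = - N b x;
  cs_mixed : forall b x, U x -> P x *m N b x + N b x *m P x = N b x;
  cs_dP : forall b x, U x -> mcd b i P x = N b x *m P x - P x *m N b x
}.

Variables (P : S -> End) (N : bool -> S -> End).
Hypothesis cs : csplit P N.

Lemma cs_PNP b x : U x -> P x *m N b x *m P x = 0.
Proof.
move=> Ux; have := congr1 (mulmx (P x)) (cs_mixed cs b Ux).
rewrite mulmxDr mulmxA (cs_idem cs Ux) mulmxA => /eqP.
by rewrite -subr_eq0 addrAC subrr add0r => /eqP.
Qed.

Lemma cs_proj b (X : S -> vec) x : mxsm i U X -> (forall y, U y -> P y *m X y = X y) -> U x ->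
  mcd b i X x = N b x *m X x + P x *m mcd b i X x.
Proof.
move=> hX PX Ux; rewrite -{1}(mcd_ext oU Ud b Ux PX) (mcdM oU Ud b Ux (cs_P_sm cs) hX).
rewrite (cs_dP cs b Ux); congr (_ + _); rewrite mulmxBl -mulmxA PX //.
by rewrite -{2}(PX x Ux) [P x *m N b x *m _]mulmxA cs_PNP // mul0mx subr0.
Qed.

Lemma cs_proj_perp b (X : S -> vec) x : mxsm i U X -> (forall y, U y -> P y *m X y = 0) -> U x ->
  P x *m (mcd b i X x - N b x *m X x) = 0.
Proof.
move=> hX PX Ux; have := mcd_ext oU Ud b Ux PX.
rewrite (mcdM oU Ud b Ux (cs_P_sm cs) hX) mcd_cst (cs_dP cs b Ux) mulmxBl -mulmxA PX // mulmx0.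
by rewrite sub0r mulmxBr addrC mulmxA.
Qed.

(** [N] is the commutator of dP with P. Hence [N] is determined by the bundle, and two splittings of
    the same bundle coincide. *)
Lemma cs_unique b x : U x -> N b x = mcd b i P x *m P x - P x *m mcd b i P x.
Proof.
move=> Ux; rewrite (cs_dP cs b Ux) mulmxBl mulmxBr !mulmxA cs_PNP // (cs_idem cs Ux).
rewrite -[N b x *m P x *m P x]mulmxA (cs_idem cs Ux) subr0 sub0r opprK addrC.
by rewrite (cs_mixed cs b Ux).
Qed.

End Chart.

Lemma csplit_sub i U U' P N : U' `<=` U -> csplit i U P N -> csplit i U' P N.
Proof.
move=> sub [h1 h2 h3 h4 h5 h6]; split.
- exact: mxsm_sub sub h1.
- by move=> x /sub; exact: h2.
- by move=> b; exact: mxsm_sub sub (h3 b).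
- by move=> b x /sub; exact: h4.
- by move=> b x /sub; exact: h5.
- by move=> b x /sub; exact: h6.
Qed.

Lemma coefN m k b (al : form1 S m k) i x : coef b (- al) i x = - coef b al i x.
Proof. by case: b. Qed.

Lemma nabla_coef b (A : form1 S n.+2 n.+2) (X : S -> vec) i x :
  coef b (nabla A X) i x = mcd b i X x + coef b A i x *m X x.
Proof. by case: b; rewrite /coef /= ?mcdzE ?mcdzbE. Qed.

Lemma form_in_coef m k W (E : S -> {vspace 'M[C]_(m, k)}) (al : form1 S m k) :
  form_in W E al <-> forall b i x, W x -> rs_dom i x -> coef b al i x \in E x.
Proof.
split=> h; first by case=> i x Wx dx; have [] := h i x Wx dx.
by move=> i x Wx dx; split; [exact: (h true) | exact: (h false)].
Qed.

Lemma is_form_sm W m k (al : form1 S m k) : is_form W al ->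
  forall b i, mxsm i (W `&` rs_dom i) (coef b al i).
Proof.
move=> [h1 h2 _] b i; have sub : W `&` rs_dom i `<=` W `&` rs_dom i `&` rs_dom i by move=> x [].
by case: b; [have /mx_smooth_sm/(_ i) := h1 i | have /mx_smooth_sm/(_ i) := h2 i]; exact: mxsm_sub.
Qed.

Section Global.
Variables (W : set S) (V : S -> {vspace vec}) (P : S -> End) (N : form1 S n.+2 n.+2).
Hypotheses (oW : open W) (P_oproj : forall x, W x -> is_oproj (V x) (P x)).

Lemma splitting_csplit i : mx_smooth W P -> splitting W V N ->
  csplit i (W `&` rs_dom i) P (fun b => coef b N i).
Proof.
move=> P_sm [N_form N_in parV parP].
have oU := open_chart i oW; have Ud : W `&` rs_dom i `<=` rs_dom i by move=> x [].
have /mx_smooth_sm/(_ i) PU := P_sm.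
have N_prop b x : W x -> rs_dom i x -> ladj (coef b N i x) = - coef b N i x /\
    P x *m coef b N i x + coef b N i x *m P x = coef b N i x.
  move=> Wx dx; move/form_in_coef: N_in => /(_ b i x Wx dx).
  move: (coef b N i x); apply: wedge_sp_ind.
  - by rewrite -[0](scale0r 0) ladjZ !scale0r oppr0 mulmx0 mul0mx addr0.
  - move=> X Y [aX mX] [aY mY]; rewrite ladjD aX aY opprD mulmxDl mulmxDr; split=> //.
    by rewrite addrACA mX mY.
  - by move=> a X [aX mX]; rewrite ladjZ aX scalerN -scalemxAl -scalemxAr -scalerDr mX.
  - move=> u v Vu Vv; rewrite ladj_wedge; split=> //.
    have oP := P_oproj Wx; have /eqP Pu : P x *m u == u by rewrite -(oproj_mem oP).
    have /eqP Pv : P x *m v == 0 by rewrite -(oproj_perp oP).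
    have [aP _ _] := oP.
    apply: mulmx_ext => w; rewrite mulmxDl -!mulmxA !wedgeE mulmxBr -!scalemxAr Pu Pv scaler0 sub0r.
    rewrite -{1}aP -{2}aP -!ip_adj Pu Pv ip0l scale0r subr0 addrC //.
split=> //.
- by move=> x [Wx _]; exact: oproj_idem (P_oproj Wx).
- by move=> b; exact: is_form_sm.
- by move=> b x [Wx dx]; have [] := N_prop b x Wx dx.
- by move=> b x [Wx dx]; have [] := N_prop b x Wx dx.
move=> b x [Wx dx]; have [_ mix] := N_prop b x Wx dx.
have Ux : (W `&` rs_dom i) x by [].
have oP := P_oproj Wx; have PP := oproj_idem oP.
have PPx (w : vec) : P x *m (P x *m w) = P x *m w by rewrite mulmxA PP.
have smw (w : vec) j := mxsmM (open_chart j oW) (@subIsetr _ W (rs_dom j))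
  ((proj1 (mx_smooth_sm W P)) P_sm j) (mxsm_cst (open_chart j oW) (@subIsetr _ W (rs_dom j)) w).
have smw' (w : vec) j := mxsmB (open_chart j oW) (@subIsetr _ W (rs_dom j))
  (mxsm_cst (open_chart j oW) (@subIsetr _ W (rs_dom j)) w) (smw w j).
have dPw (w : vec) : mcd b i (fun x => P x *m w) x = mcd b i P x *m w.
  by rewrite (mcdM oU Ud b Ux PU (mxsm_cst oU Ud w)) mcd_cst mulmx0 addr0.
(* The two parallelism conditions are tested on the sections [P w] and [w - P w] with [w] constant;
   together they determine the derivative of [P]. *)
have e1 (w : vec) : P x *m (mcd b i P x *m w - coef b N i x *m (P x *m w)) =
    mcd b i P x *m w - coef b N i x *m (P x *m w).
  have sec : is_section W V (fun x => P x *m w).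
    split; first by apply/mx_smooth_sm => j; exact: smw.
    by move=> y Wy; have [_ hP _] := P_oproj Wy; exact: hP.
  move/form_in_coef: (parV W _ oW (@subset_refl _ _) sec) => /(_ b i x Wx dx).
  by rewrite nabla_coef coefN dPw mulNmx (oproj_mem oP) => /eqP.
have e2 (w : vec) : P x *m (- (mcd b i P x *m w) - coef b N i x *m (w - P x *m w)) = 0.
  have sec : is_section W (fun x => perp (V x)) (fun x => w - P x *m w).
    split; first by apply/mx_smooth_sm => j; exact: smw'.
    move=> y Wy; rewrite (oproj_perp (P_oproj Wy)) mulmxBr mulmxA (oproj_idem (P_oproj Wy)).
    by rewrite subrr.
  move/form_in_coef: (parP W _ oW (@subset_refl _ _) sec) => /(_ b i x Wx dx).
  rewrite nabla_coef coefN mulNmx (oproj_perp oP).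
  rewrite (mcdB oU Ud b Ux (mxsm_cst oU Ud w) (smw w i)) mcd_cst dPw sub0r => /eqP //.
move: (mcd b i P x) (coef b N i x) mix e1 e2 => D M mix e1 e2; apply: mulmx_ext => w.
have PMP (v : vec) : P x *m (M *m (P x *m v)) = 0.
  have := congr1 (fun X => P x *m (X *m (P x *m v))) mix.
  rewrite mulmxDl mulmxDr -!mulmxA !PPx => /eqP.
  by rewrite addrC -subr_eq0 addrK => /eqP.
have f1 : P x *m (D *m w) = D *m w - M *m (P x *m w).
  by have := e1 w; rewrite mulmxBr PMP subr0.
have f2 : - (P x *m (D *m w)) = P x *m (M *m w).
  have := e2 w; rewrite mulmxBr mulmxN (mulmxBr M) (mulmxBr (P x)) PMP subr0 => e.
  exact: subr0_eq e.
rewrite mulmxBl -(mulmxA M) -(mulmxA (P x)) -f2 f1.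
by move: (D *m w) (M *m _) => y z; rewrite opprK addrC addrNK.
Qed.

Lemma csplit_splitting : is_form W N ->
  (forall i, csplit i (W `&` rs_dom i) P (fun b => coef b N i)) -> splitting W V N.
Proof.
move=> N_form cs; split=> //.
- apply/form_in_coef => b i x Wx dx; have Ux : (W `&` rs_dom i) x by [].
  by apply: (oproj_wedge (P_oproj Wx)); [exact: cs_skew (cs i) b x Ux | exact: cs_mixed (cs i) b x Ux].
- move=> O X oO OW [X_sm XV]; apply/form_in_coef => b i x Ox dx.
  have oU := open_chart i oO; have Ud : O `&` rs_dom i `<=` rs_dom i by move=> y [].
  have Ux : (O `&` rs_dom i) x by [].
  have sub : O `&` rs_dom i `<=` W `&` rs_dom i by move=> y [/OW].
  have /mx_smooth_sm/(_ i) hX := X_sm.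
  have PX y : (O `&` rs_dom i) y -> P y *m X y = X y.
    by move=> [Oy _]; apply/eqP; rewrite -(oproj_mem (P_oproj (OW _ Oy))) XV.
  rewrite nabla_coef coefN mulNmx (cs_proj oU Ud (csplit_sub sub (cs i)) b hX PX Ux).
  by rewrite addrAC subrr add0r; have [_ hP _] := P_oproj (OW _ Ox); exact: hP.
- move=> O X oO OW [X_sm XV]; apply/form_in_coef => b i x Ox dx.
  have oU := open_chart i oO; have Ud : O `&` rs_dom i `<=` rs_dom i by move=> y [].
  have Ux : (O `&` rs_dom i) x by [].
  have sub : O `&` rs_dom i `<=` W `&` rs_dom i by move=> y [/OW].
  have /mx_smooth_sm/(_ i) hX := X_sm.
  have PX y : (O `&` rs_dom i) y -> P y *m X y = 0.
    by move=> [Oy _]; apply/eqP; rewrite -(oproj_perp (P_oproj (OW _ Oy))) XV.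
  rewrite nabla_coef coefN mulNmx (oproj_perp (P_oproj (OW _ Ox))).
  by rewrite (cs_proj_perp oU Ud (csplit_sub sub (cs i)) b hX PX Ux).
Qed.

End Global.
End Splitting.

(** * Constrained Willmore surfaces in one chart *)

Section Local.
Variables (R : realType) (S : riemannSurface R) (n : nat).
Local Notation C := (Cplx R).
Local Notation vec := 'cV[C]_(n.+2).
Local Notation End := 'M[C]_(n.+2).
Variables (i : rs_idx S) (U : set S) (L : S -> {vspace vec}) (sg : S -> vec).
Hypothesis cf : cframe i U L sg.
Let oU := cf_open cf.
Let Ud : U `<=` rs_dom i := @cf_dom _ _ _ _ _ _ _ cf.
Local Notation s b := (mcd b i sg).
Local Notation ss := (mcd false i (mcd true i sg)).
Let h x := lip (s true x) (s false x).
Let hsg := cf_sm cf.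
Let hs b : mxsm i U (s b) := mxsm_cd oU Ud b hsg.

Variable P : S -> End.
Hypothesis P_oproj : forall x, U x -> is_oproj (T4 i sg x) (P x).
Variable N : bool -> S -> End.
Hypothesis cs : csplit i U P N.
Let P_sm := cs_P_sm cs.
Let N_sm := cs_N_sm cs.
Let N_skew := @cs_skew _ _ _ _ _ _ _ cs.
Let N_mixed := @cs_mixed _ _ _ _ _ _ _ cs.
Let dP := @cs_dP _ _ _ _ _ _ _ cs.
Let PNP := @cs_PNP _ _ _ _ _ _ _ cs.

Let ssE b x (Ux : U x) : mcd (~~ b) i (s b) x = ss x := ssE oU Ud hsg b Ux.
Let h0 x : U x -> h x != 0. Proof. by move=> Ux; rewrite gt_eqF // (cf_h cf Ux). Qed.
Let lip_sg_s b x (Ux : U x) : lip (sg x) (s b x) = 0 := lip_sg_s oU Ud hsg (cf_null cf) b Ux.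
Let lip_s_sg b x : U x -> lip (s b x) (sg x) = 0. Proof. by move=> Ux; rewrite ipC lip_sg_s. Qed.
Let lip_s_s b x (Ux : U x) : lip (s b x) (s b x) = 0 := cf_iso cf b Ux.
Let lip_s_ns b x : lip (s b x) (s (~~ b) x) = h x. Proof. by case: b; rewrite // ipC. Qed.
Let lip_ns_s b x : lip (s (~~ b) x) (s b x) = h x. Proof. by rewrite ipC lip_s_ns. Qed.
Let lip_sg_ss x (Ux : U x) : lip (sg x) (ss x) = - h x :=
  lip_sg_ss oU Ud hsg (cf_null cf) Ux.
Let null x (Ux : U x) : lip (sg x) (sg x) = 0 := cf_null cf Ux.

Let PP := @cs_idem _ _ _ _ _ _ _ cs.
Let Pid x v : U x -> v \in T4 i sg x -> P x *m v = v.
Proof. by move=> Ux; have [_ _] := P_oproj Ux; apply. Qed.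
Let Psg x : U x -> P x *m sg x = sg x.
Proof. by move=> Ux; apply: Pid Ux _; apply: memv_span; rewrite !inE eqxx. Qed.
Let Ps b x : U x -> P x *m s b x = s b x.
Proof. by move=> Ux; apply: Pid Ux _; apply: memv_span; case: b; rewrite !inE eqxx ?orbT. Qed.
Let Pss x : U x -> P x *m ss x = ss x.
Proof. by move=> Ux; apply: Pid Ux _; apply: memv_span; rewrite !inE eqxx ?orbT. Qed.

(** For a section [X] of [V], [N b *m X] is the component of its derivative orthogonal to [V]. *)
Lemma N_kill b (X : S -> vec) x : mxsm i U X -> (forall y, U y -> P y *m X y = X y) -> U x ->
  P x *m mcd b i X x = mcd b i X x -> N b x *m X x = 0.
Proof.
move=> hX PX Ux e; have := cs_proj oU Ud cs b hX PX Ux; rewrite e => /eqP.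
by rewrite -subr_eq subrr eq_sym => /eqP.
Qed.

Lemma N_sg b x : U x -> N b x *m sg x = 0.
Proof. by move=> Ux; apply: N_kill => //; exact: Ps. Qed.

Lemma N_s b x : U x -> N b x *m s (~~ b) x = 0.
Proof.
move=> Ux; apply: N_kill => //; first by move=> y; apply: Ps.
by rewrite -{1 3}(negbK b) ssE // Pss.
Qed.

Lemma P_form x v : U x -> P x *m v = (h x)^-1 *:
  (lip (s false x) v *: s true x + lip (s true x) v *: s false x
   - lip (ss x + (lip (ss x) (ss x) / (2 * h x)) *: sg x) v *: sg x
   - lip (sg x) v *: (ss x + (lip (ss x) (ss x) / (2 * h x)) *: sg x)).
Proof.
move=> Ux; rewrite -lift_projE; congr (_ *m v).
exact: oproj_unique (P_oproj Ux) (cf_oproj cf Ux).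
Qed.

(** An isotropic plane in the non-degenerate rank 4 bundle is its own orthogonal complement
    there. *)
Lemma T2_char b x v : U x -> v \in T4 i sg x -> lip (sg x) v = 0 -> lip (s b x) v = 0 ->
  v \in T2 b i sg x.
Proof.
move=> Ux Vv e1 e2; rewrite -(Pid Ux Vv) P_form // e1 scale0r subr0.
apply: memvZ; apply: memvB; last by apply: memvZ; apply: memv_span; rewrite !inE eqxx.
by case: b e2 => ->; rewrite scale0r ?addr0 ?add0r; apply: memvZ; apply: memv_span; rewrite !inE eqxx orbT.
Qed.

Lemma lip_P x v w : U x -> lip (P x *m v) w = lip v (P x *m w).
Proof. by move=> Ux; have [aP _ _] := P_oproj Ux; rewrite ip_adj aP. Qed.

Lemma lip_sg_sbb b x : U x -> lip (sg x) (mcd b i (s b) x) = 0.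
Proof.
move=> Ux; have := cd_eq0 oU Ud b (@lip_sg_s b) Ux.
by rewrite (cd_lip oU Ud b hsg (hs b) Ux) lip_s_s // add0r.
Qed.

Lemma lip_s_sbb b x : U x -> lip (s b x) (mcd b i (s b) x) = 0.
Proof.
move=> Ux; have := cd_eq0 oU Ud b (@lip_s_s b) Ux.
rewrite (cd_lip oU Ud b (hs b) (hs b) Ux) [lip (mcd b i _ x) _]ipC => /eqP.
by rewrite -mulr2n mulrn_eq0 /= => /eqP.
Qed.

Lemma P_sbb b x : U x -> P x *m mcd b i (s b) x \in T2 b i sg x.
Proof.
move=> Ux; have [_ hP _] := P_oproj Ux; apply: (T2_char Ux (hP _)).
  by rewrite -lip_P // Psg // lip_sg_sbb.
by rewrite -lip_P // Ps // lip_s_sbb.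
Qed.

Variable Q : bool -> S -> End.
Hypothesis Q_sm : forall b, mxsm i U (Q b).
Hypothesis Q_in : forall b x, U x -> Q b x \in wedge_sp (L x) (Lam1 L x).

Lemma Q_form b x : U x -> exists al be,
  Q b x = al *: lwedge (sg x) (s b x) + be *: lwedge (sg x) (s (~~ b) x).
Proof.
move=> Ux; have := Q_in b Ux; rewrite (cf_L cf Ux) (cf_Lam1 cf Ux).
pose Pr (X : End) := exists al be,
  X = al *: lwedge (sg x) (s b x) + be *: lwedge (sg x) (s (~~ b) x).
apply: (@wedge_sp_ind R n _ _ Pr).
- by exists 0, 0; rewrite !scale0r addr0.
- move=> X Y [a [c ->]] [a' [c' ->]]; exists (a + a'), (c + c').
  by rewrite !scalerDl addrACA.
- move=> k X [a [c ->]]; exists (k * a), (k * c).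
  by rewrite scalerDr !scalerA.
move=> u v /vlineP[k ->] /span3P[a [c [d ->]]].
have e : lwedge (k *: sg x) (a *: sg x + (c *: s true x + d *: s false x)) =
  (k * c) *: lwedge (sg x) (s true x) + (k * d) *: lwedge (sg x) (s false x).
  by rewrite wedgeZl !wedgeDr !wedgeZr wedge_self scaler0 add0r scalerDr !scalerA.
rewrite e {e}/Pr {Pr}; case: b => /=; first by exists (k * c), (k * d).
by exists (k * d), (k * c); rewrite addrC.
Qed.

Lemma Q_skew b x : U x -> ladj (Q b x) = - Q b x.
Proof.
by move=> /(Q_form b)[a [c ->]]; rewrite ladjD !ladjZ !ladj_wedge !scalerN opprD.
Qed.

Lemma wedge_proj x u v : U x -> P x *m u = u -> P x *m v = v ->
  lwedge u v *m P x = lwedge u v /\ P x *m lwedge u v = lwedge u v.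
Proof.
move=> Ux Pu Pv; split; apply: mulmx_ext => w.
  by rewrite -mulmxA !wedgeE -(lip_P u w Ux) -(lip_P v w Ux) Pu Pv.
by rewrite -mulmxA wedgeE mulmxBr -!scalemxAr Pu Pv.
Qed.

Lemma QP b x : U x -> Q b x *m P x = Q b x /\ P x *m Q b x = Q b x.
Proof.
move=> Ux; have [a [c ->]] := Q_form b Ux.
have [e1 e2] := wedge_proj Ux (Psg Ux) (Ps b Ux).
have [e3 e4] := wedge_proj Ux (Psg Ux) (Ps (~~ b) Ux).
by rewrite mulmxDl mulmxDr -!scalemxAl -!scalemxAr e1 e2 e3 e4.
Qed.

Lemma Q_sg b x : U x -> Q b x *m sg x = 0.
Proof.
move=> Ux; have [a [c ->]] := Q_form b Ux.
by rewrite mulmxDl -!scalemxAl !wedgeE !null // !lip_s_sg // !scale0r subrr !scaler0 addr0.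
Qed.

Lemma Q_vals b x : U x -> exists a c,
  Q b x *m s (~~ b) x = a *: sg x /\ Q b x *m s b x = c *: sg x.
Proof.
move=> Ux; have [a [c ->]] := Q_form b Ux.
exists (- (a * h x)), (- (c * h x)).
rewrite !mulmxDl -!scalemxAl !wedgeE !lip_sg_s // !lip_s_s // lip_s_ns lip_ns_s.
by rewrite !scale0r !sub0r oppr0 !scaler0 addr0 add0r !scalerN !scalerA !scaleNr.
Qed.

Hypothesis dQ : forall x, U x ->
  mcd true i (Q false) x - lie (N true x) (Q false x) =
  mcd false i (Q true) x - lie (N false x) (Q true x).

(** The derivative of [Q b] under D_V in the opposite direction. Closedness of q is the equality of
    the two values of [b]. *)
Let D b x := mcd (~~ b) i (Q b) x - lie (N (~~ b) x) (Q b x).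

Let DE x : U x -> D false x = D true x. Proof. exact: dQ. Qed.

Let dQX b (X : S -> vec) x : mxsm i U X -> U x -> mcd (~~ b) i (Q b) x *m X x =
  mcd (~~ b) i (fun y => Q b y *m X y) x - Q b x *m mcd (~~ b) i X x.
Proof. by move=> hX Ux; rewrite (mcdM oU Ud _ Ux (Q_sm b) hX) addrK. Qed.

Let ladj_mcd b (X : S -> End) x : mxsm i U X -> (forall y, U y -> ladj (X y) = - X y) -> U x ->
  ladj (mcd b i X x) = - mcd b i X x.
Proof.
by move=> hX e Ux; rewrite -(mcdN oU Ud b Ux hX) -(mcd_ladj oU Ud b hX Ux) (mcd_ext oU Ud b Ux e).
Qed.

Let D_skew b x : U x -> ladj (D b x) = - D b x.
Proof.
move=> Ux; rewrite /D ladjB (ladj_mcd _ (Q_sm b) (@Q_skew b) Ux) /lie ladjB !ladjM.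
rewrite N_skew // Q_skew // !mulNmx !mulmxN !opprK.
move: (mcd _ _ _ _) (N _ x *m Q b x) (Q b x *m N _ x) => a c d; mx_ring.
Qed.

Let D_sg b x : U x -> D b x *m sg x = - (Q b x *m s (~~ b) x).
Proof.
move=> Ux; rewrite /D mulmxBl dQX // /lie mulmxBl -!mulmxA Q_sg // N_sg // !mulmx0 subrr subr0.
rewrite (mcd_ext oU Ud _ Ux (@Q_sg b)) mcd_cst sub0r //.
Qed.

Let N_s' b x : U x -> N (~~ b) x *m s b x = 0.
Proof. by move=> Ux; have := N_s (~~ b) Ux; rewrite negbK. Qed.

Let D_s b x : U x -> lip (D b x *m s b x) (s (~~ b) x) = lip (ss x) (Q b x *m s (~~ b) x).
Proof.
move=> Ux; have hsb := hs b; have hQs := mxsmM oU Ud (Q_sm b) hsb.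
have orth c y : U y -> lip (Q b y *m s b y) (s c y) = 0.
  by move=> Uy; have [_ [k [_ ->]]] := Q_vals b Uy; rewrite ipZl lip_sg_s // mulr0.
have := cd_eq0 oU Ud (~~ b) (@orth (~~ b)) Ux.
rewrite (cd_lip oU Ud (~~ b) hQs (hs (~~ b)) Ux).
have [_ [k [_ e2]]] := Q_vals b Ux.
rewrite e2 ipZl lip_sg_sbb // mulr0 addr0 => e.
rewrite /D mulmxBl dQX // ssE // /lie mulmxBl -!mulmxA N_s' // e2 mulmx0 -scalemxAr N_sg //.
rewrite scaler0 !subr0 ipBl e sub0r ip_adj Q_skew // mulNmx ipNr opprK //.
Qed.

Lemma skew_lip (X : End) u v : ladj X = - X -> lip (X *m u) v = - lip (X *m v) u.
Proof. by move=> e; rewrite ip_adj e mulNmx ipNr ipC. Qed.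

(** Write [Q b *m s (~~ b) = a_b *: sg]. Evaluating the common derivative [D] on [sg] gives a_true =
    a_false; its skew-symmetry on the pair [s true], [s false] gives a_true = - a_false. So q^{1,0}
    lies in Lambda /\ Lambda^{0,1}. *)
Lemma Q_s b x : U x -> Q b x *m s (~~ b) x = 0.
Proof.
move=> Ux; have [a1 [c1 [e1 _]]] := Q_vals true Ux; have [a2 [c2 [e2 _]]] := Q_vals false Ux.
have k1 : lip (D true x *m s true x) (s false x) = a1 * - h x.
  by have := D_s true Ux; rewrite e1 ipZr [lip (ss x) _]ipC lip_sg_ss.
have k2 : lip (D true x *m s false x) (s true x) = a2 * - h x.
  by have := D_s false Ux; rewrite DE // e2 ipZr [lip (ss x) _]ipC lip_sg_ss.
have g1 : D true x *m sg x = - (a1 *: sg x) by have := D_sg true Ux; rewrite e1.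
have g2 : D true x *m sg x = - (a2 *: sg x) by have := D_sg false Ux; rewrite DE // e2.
have ea : a1 = a2.
  apply/eqP; rewrite -subr_eq0; have := g1; rewrite g2 => /eqP.
  rewrite eqr_opp eq_sym -subr_eq0 -scalerBl scaler_eq0 (negbTE (cf_neq0 cf Ux)) orbF //.
have a0 : a1 = 0.
  have := skew_lip (s true x) (s false x) (D_skew true Ux).
  rewrite k1 k2 ea => /eqP; rewrite -addr_eq0 -mulr2n mulrn_eq0 /= mulf_eq0 oppr_eq0.
  by rewrite (negbTE (h0 Ux)) orbF => /eqP.
by case: b; rewrite /= ?e1 ?e2 -?ea a0 scale0r.
Qed.

Lemma Q_wedge b x : U x -> exists be, Q b x = be *: lwedge (sg x) (s (~~ b) x).
Proof.
move=> Ux; have [a [c e]] := Q_form b Ux; exists c.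
have := Q_s b Ux; rewrite e mulmxDl -!scalemxAl !wedgeE lip_sg_s // lip_s_s // lip_s_ns.
rewrite !scale0r sub0r subrr scaler0 addr0 scalerN scalerA => /eqP.
rewrite oppr_eq0 scaler_eq0 (negbTE (cf_neq0 cf Ux)) orbF mulf_eq0 (negbTE (h0 Ux)) orbF.
by move=> /eqP ->; rewrite scale0r add0r.
Qed.

Let DP b x : U x -> D b x *m P x = D b x.
Proof.
move=> Ux; have PQ y (Uy : U y) : Q b y *m P y = Q b y by have [] := QP b Uy.
have [qp pq] := QP b Ux.
have e : mcd (~~ b) i (Q b) x = mcd (~~ b) i (Q b) x *m P x + Q b x *m mcd (~~ b) i P x.
  by rewrite -(mcdM oU Ud _ Ux (Q_sm b) P_sm) (mcd_ext oU Ud _ Ux PQ).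
have mP : N (~~ b) x *m Q b x *m P x = N (~~ b) x *m Q b x by rewrite -mulmxA qp.
have Qd : Q b x *m mcd (~~ b) i P x = Q b x *m N (~~ b) x *m P x - Q b x *m N (~~ b) x.
  by rewrite dP // mulmxBr !mulmxA qp.
rewrite /D /lie mulmxBl mulmxBl mP [in RHS]e Qd.
move: (mcd _ i (Q b) x *m P x) (N _ x *m Q b x) (Q b x *m N _ x) (Q b x *m N _ x *m P x).
by move=> a c d f; mx_ring.
Qed.

Let D_ns b x : U x -> D b x *m s (~~ b) x = 0.
Proof.
move=> Ux; rewrite /D mulmxBl dQX //.
rewrite (mcd_ext oU Ud _ Ux (@Q_s b)) mcd_cst sub0r /lie mulmxBl -!mulmxA Q_s // mulmx0 sub0r opprK.
have [qp _] := QP b Ux.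
have -> : Q b x *m (N (~~ b) x *m s (~~ b) x) = 0.
  by rewrite -qp -(Ps (~~ b) Ux) -mulmxA [P x *m (_ *m _)]mulmxA [P x *m (N _ x) *m _]mulmxA PNP // mul0mx mulmx0.
rewrite addr0 -qp -mulmxA.
have /span2P[a [c ->]] := P_sbb (~~ b) Ux.
by rewrite mulmxDr -!scalemxAr Q_sg // Q_s // !scaler0 addr0 oppr0.
Qed.

(** The common value [D] kills [sg], [s true] and [s false]: each of the last two is handled by one
    of its two expressions. As [D] factors through [P], its rank is at most one, and a skew
    endomorphism of rank at most one is zero. *)
Lemma dQ0 b x : U x -> mcd (~~ b) i (Q b) x = lie (N (~~ b) x) (Q b x).
Proof.
move=> Ux; apply: subr0_eq; suff : D b x = 0 by [].
have -> : D b x = D true x by case: b; [reflexivity | exact: DE].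
have k0 : D true x *m sg x = 0 by rewrite D_sg // Q_s // oppr0.
have k1 : D true x *m s false x = 0 by exact: (D_ns true Ux).
have k2 : D true x *m s true x = 0 by rewrite -DE //; exact: (D_ns false Ux).
have sk := D_skew true Ux.
have key v : exists d, D true x *m v = d *: (D true x *m ss x).
  have [_ hP _] := P_oproj Ux.
  have /span_consP[a [w [/span3P[c [d [e ->]]] Pv]]] := hP v.
  exists e; rewrite -{1}(DP true Ux) -mulmxA Pv !mulmxDr -!scalemxAr k0 k1 k2.
  by rewrite !scaler0 !add0r.
have z0 : lip (D true x *m ss x) (ss x) = 0.
  have := skew_lip (ss x) (ss x) sk => /eqP.
  by rewrite -addr_eq0 -mulr2n mulrn_eq0 /= => /eqP.
have z1 : D true x *m ss x = 0.
  apply: ip_nondeg => v; rewrite ipC skew_lip //.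
  by have [d ->] := key v; rewrite ipZl z0 mulr0 oppr0.
by apply: mulmx_ext => v; have [d ->] := key v; rewrite z1 scaler0 mul0mx.
Qed.

Lemma wedge_comm (u v v' : vec) : lip u u = 0 -> lip u v = 0 -> lip u v' = 0 ->
  lie (lwedge u v) (lwedge u v') = 0.
Proof.
move=> uu uv uv'; apply: mulmx_ext => w; rewrite mul0mx /lie mulmxBl -!mulmxA !wedgeE.
rewrite !ipBr !ipZr uu uv uv' [lip v u]ipC [lip v' u]ipC uv uv' [lip v' v]ipC.
by rewrite !mulr0 !subr0 !scale0r subrr.
Qed.

Lemma Q_comm x : U x -> lie (Q true x) (Q false x) = 0.
Proof.
move=> Ux; have [a ->] := Q_wedge true Ux; have [c ->] := Q_wedge false Ux.
rewrite /lie -!scalemxAl -!scalemxAr !scalerA [c * a]mulrC -scalerBr.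
have := wedge_comm (null Ux) (lip_sg_s false Ux) (lip_sg_s true Ux).
by rewrite /lie /= => ->; rewrite scaler0.
Qed.

(** The Codazzi equation d^D N = 0, a consequence of the symmetry of the second derivatives of
    [P]. *)
Lemma codazzi x : U x ->
  mcd true i (N false) x - mcd false i (N true) x = 2 *: lie (N true x) (N false x).
Proof.
move=> Ux.
apply: (@codazzi_algebra R _ (P x)).
- exact: PP.
- exact: N_mixed.
- exact: N_mixed.
- have e := mcd_ext oU Ud false Ux (@N_mixed true).
  rewrite (mcdD oU Ud false Ux (mxsmM oU Ud P_sm (N_sm true)) (mxsmM oU Ud (N_sm true) P_sm)) in e.
  by rewrite (mcdM oU Ud false Ux P_sm (N_sm true)) (mcdM oU Ud false Ux (N_sm true) P_sm) (dP false Ux) in e.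
- have e := mcd_ext oU Ud true Ux (@N_mixed false).
  rewrite (mcdD oU Ud true Ux (mxsmM oU Ud P_sm (N_sm false)) (mxsmM oU Ud (N_sm false) P_sm)) in e.
  by rewrite (mcdM oU Ud true Ux P_sm (N_sm false)) (mcdM oU Ud true Ux (N_sm false) P_sm) (dP true Ux) in e.
have := mcd_comm oU Ud false Ux P_sm => /=.
rewrite (mcd_ext oU Ud false Ux (@dP true)) (mcd_ext oU Ud true Ux (@dP false)).
rewrite (mcdB oU Ud false Ux (mxsmM oU Ud (N_sm true) P_sm) (mxsmM oU Ud P_sm (N_sm true))).
rewrite (mcdB oU Ud true Ux (mxsmM oU Ud (N_sm false) P_sm) (mxsmM oU Ud P_sm (N_sm false))).
rewrite (mcdM oU Ud false Ux (N_sm true) P_sm) (mcdM oU Ud false Ux P_sm (N_sm true)).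
rewrite (mcdM oU Ud true Ux (N_sm false) P_sm) (mcdM oU Ud true Ux P_sm (N_sm false)).
by rewrite (dP true Ux) (dP false Ux).
Qed.

Hypothesis EL : forall x, U x -> mcd true i (N false) x + mcd false i (N true) x =
  2 *: (lie (Q true x) (N false x) + lie (Q false x) (N true x)).

Lemma local_flat x (l : C) : U x -> l != 0 ->
  let A1 y := - N true y + l *: N true y + (l ^+ 2 - 1) *: Q true y in
  let A2 y := - N false y + l^-1 *: N false y + (l ^- 2 - 1) *: Q false y in
  mcd true i A2 x - mcd false i A1 x + lie (A1 x) (A2 x) = 0.
Proof.
move=> Ux l0 A1 A2.
have dA b c (k1 k2 : C) : mcd b i (fun y => - N c y + k1 *: N c y + k2 *: Q c y) x =
   - mcd b i (N c) x + k1 *: mcd b i (N c) x + k2 *: mcd b i (Q c) x.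
  have nN := mxsmN oU Ud (N_sm c).
  have kN := mxsmZ oU Ud (sm_cst oU Ud k1) (N_sm c).
  have kQ := mxsmZ oU Ud (sm_cst oU Ud k2) (Q_sm c).
  rewrite (mcdD oU Ud b Ux (mxsmD oU Ud nN kN) kQ) (mcdD oU Ud b Ux nN kN).
  by rewrite (mcdN oU Ud b Ux (N_sm c)) !(mcdZc oU Ud b Ux).
rewrite /A1 /A2 !dA.
exact: (flat_algebra l0 (codazzi Ux) (EL Ux) (dQ0 true Ux) (dQ0 false Ux) (Q_comm Ux)).
Qed.

End Local.
(** * The dressed family in one chart *)

Section ParameterCalculus.
Variable R : realType.
Local Notation C := (Cplx R).

Lemma derivable_near (f g : C -> C) z : (\forall m \near z, f m = g m) ->
  derivable f z 1 -> derivable g z 1.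
Proof. by move=> e h; apply: (near_eq_derivable _ h) => //; exact: oner_neq0. Qed.

Lemma cder_derivable (f : C -> C) z d : cder f z d -> derivable f z 1.
Proof.
move=> hf; apply/cvg_ex; exists d; apply/cvgC => e e0.
have e8 : 0 < e / 8 by rewrite divr_gt0.
have [del del0 hd] := hf _ e8; apply/nearC; exists del => // h; rewrite subr0 => hh h0.
have := hd (h + z); rewrite addrK => /(_ hh) hl.
rewrite /GRing.scale /= mulr1.
have -> : h^-1 * (f (h + z) - f z) - d = h^-1 * (f (h + z) - f z - d * h).
  by rewrite [RHS]mulrBr [d * h]mulrC mulrA mulVf // mul1r.
apply: le_lt_trans (norm1M _ _) _.
apply: le_lt_trans (ler_wpM2l (norm1_ge0 _) hl) _.
rewrite mulrCA; apply: le_lt_trans (ler_wpM2l (ltW e8) (norm1V h)) _.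
by clear -e0; lra.
Qed.

Lemma derivable_inv (f : C -> C) (z : C) : z != 0 -> derivable f z^-1 1 ->
  derivable (fun m : C => f m^-1) z 1.
Proof.
move=> z0 /derivable_cder[d hf].
have /derivable_cder[d' hv] : derivable (fun m : C => m^-1) z 1.
  exact: (derivableV z0 (@derivable_id _ _ z 1)).
exact: cder_derivable (cder_comp hv hf).
Qed.

Definition mxder m k (F : C -> 'M[C]_(m, k)) z := forall a b, derivable (fun l => F l a b) z 1.

Lemma mxder_near m k (F G : C -> 'M[C]_(m, k)) z : (\forall l \near z, F l = G l) ->
  mxder F z -> mxder G z.
Proof. by move=> e h a b; apply: derivable_near (h a b); near=> l; rewrite (near e l). Unshelve. all: end_near. Qed.

Lemma mxder_cst m k (A : 'M[C]_(m, k)) z : mxder (fun=> A) z.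
Proof. by move=> a b; exact: cdiff_cst. Qed.

Lemma mxderD m k (F G : C -> 'M[C]_(m, k)) z : mxder F z -> mxder G z ->
  mxder (fun l => F l + G l) z.
Proof.
move=> hF hG a b; have -> : (fun l => (F l + G l) a b) = (fun l => F l a b + G l a b).
  by apply/funext => l; rewrite mxE.
exact: (cdiffD (hF a b) (hG a b)).
Qed.

Lemma mxderZ m k (f : C -> C) (F : C -> 'M[C]_(m, k)) z : derivable f z 1 -> mxder F z ->
  mxder (fun l => f l *: F l) z.
Proof.
move=> hf hF a b; have -> : (fun l => (f l *: F l) a b) = (fun l => f l * F l a b).
  by apply/funext => l; rewrite mxE.
exact: (cdiffM hf (hF a b)).
Qed.

Lemma mxderM m k q (F : C -> 'M[C]_(m, k)) (G : C -> 'M[C]_(k, q)) z : mxder F z -> mxder G z ->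
  mxder (fun l => F l *m G l) z.
Proof.
move=> hF hG a b.
have -> : (fun l => (F l *m G l) a b) = (fun l => \sum_c F l a c * G l c b).
  by apply/funext => l; rewrite mxE.
elim: (index_enum _) => [|c s IH].
  have -> : (fun l => \sum_(c <- [::]) F l a c * G l c b) = (fun=> 0).
    by apply/funext => l; rewrite big_nil.
  exact: cdiff_cst.
have -> : (fun l => \sum_(d <- c :: s) F l a d * G l d b) =
    (fun l => F l a c * G l c b + \sum_(d <- s) F l a d * G l d b).
  by apply/funext => l; rewrite big_cons.
exact: (cdiffD (cdiffM (hF a c) (hG c b)) IH).
Qed.

Lemma mxder_tr m k (F : C -> 'M[C]_(m, k)) z : mxder F z -> mxder (fun l => (F l)^T) z.
Proof.
move=> hF a b; have -> : (fun l => (F l)^T a b) = (fun l => F l b a).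
  by apply/funext => l; rewrite mxE.
exact: hF.
Qed.

Lemma mxder_ladj n (F : C -> 'M[C]_(n.+2)) z : mxder F z -> mxder (fun l => ladj (F l)) z.
Proof.
move=> hF; have hJ := @mxder_cst _ _ (lgram R n) z.
apply: mxder_near (mxderM (mxderM hJ (mxder_tr hF)) hJ).
by near=> l; rewrite ladjE.
Unshelve. all: end_near. Qed.

Lemma derivable_cvg (f : C -> C) z : derivable f z 1 -> {for z, continuous f}.
Proof. by move=> /derivable_cder[d /cder_cont]. Qed.

Lemma vanish_at0 (f : C -> C) : derivable f 0 1 ->
  (\forall m \near (0 : C), m != 0 -> f m = 0) -> f 0 = 0.
Proof.
move=> /derivable_cvg/continuousC hc /nearC[e e0 h].
apply/eqP/negPn/negP => f0.
have n0 : 0 < norm1 (f 0) by rewrite lt_def norm1_ge0 norm1_eq0 f0.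
have /nearC[d d0 hd] := hc _ n0.
pose m : C := realC (Num.min e d / 2).
have md : 0 < Num.min e d by rewrite lt_min e0 d0.
have nm : norm1 m = Num.min e d / 2 by rewrite /norm1 /m /= normr0 addr0 gtr0_norm ?divr_gt0.
have nm' : norm1 m < Num.min e d by rewrite nm ltr_pdivrMr // ltr_pMr // ltr1n.
have m0 : m != 0 by rewrite -norm1_eq0 nm gt_eqF // divr_gt0.
have fm : f m = 0 by apply: h => //; rewrite subr0 (lt_le_trans nm') // ge_min lexx.
have md' : norm1 (m - 0) < d by rewrite subr0 (lt_le_trans nm') // ge_min lexx orbT.
by have := hd m md'; rewrite fm sub0r norm1N ltxx.
Qed.

Lemma mx_vanish_at0 m k (F : C -> 'M[C]_(m, k)) : mxder F 0 ->
  (\forall l \near (0 : C), l != 0 -> F l = 0) -> F 0 = 0.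
Proof.
move=> hF h; apply/matrixP => a b; rewrite [RHS]mxE.
apply: (vanish_at0 (hF a b)); near=> l => l0.
by rewrite (near h l) // mxE.
Unshelve. all: end_near. Qed.

(** [GA] extends [F] over 0 and [GB] controls it at infinity; the theorem on entire functions
    applies to each entry. *)
Lemma gauge_quadratic m k (F GA GB : C -> 'M[C]_(m, k)) :
  (forall z, z != 0 -> mxder F z) -> mxder GA 0 -> mxder GB 0 ->
  (\forall l \near (0 : C), l != 0 -> F l = GA l) ->
  (\forall l \near (0 : C), l != 0 -> l ^+ 2 *: F l^-1 = GB l) ->
  exists B, forall z, z != 0 -> F z = GA 0 + z *: B + z ^+ 2 *: GB 0.
Proof.
move=> dF dA dB hA hB.
have H a b : exists c, forall z, z != 0 -> F z a b = GA 0 a b + c * z + GB 0 a b * z ^+ 2.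
  (* The value at 0 is supplied by [GA], which turns the entry into an entire function. *)
  pose f z := if z == 0 then GA 0 a b else F z a b.
  have f_near : \forall m \near (0 : C), GA m a b = f m.
    near=> l; rewrite /f; case: eqVneq => [-> //|l0]; by rewrite (near hA l).
  have df z : derivable f z 1.
    have [->|z0] := eqVneq z 0; first exact: derivable_near f_near (dA a b).
    apply: derivable_near (dF z z0 a b).
    apply/nearC; exists (norm1 z) => [|l hl]; first by rewrite lt_def norm1_ge0 norm1_eq0 z0.
    rewrite /f; case: eqVneq => // l0.
    by move: hl; rewrite l0 sub0r norm1N ltxx.
  have fg : \forall m \near (0 : C), m != 0 -> m ^+ 2 * f m^-1 = GB m a b.
    by near=> l => l0; rewrite /f invr_eq0 (negbTE l0) -(near hB l) // mxE.
  have [c hc] := entire_quadratic df (dB a b) fg.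
  exists c => z z0; have := hc z.
  by rewrite /f eqxx (negbTE z0).
pose B : 'M[C]_(m, k) := \matrix_(a, b) xget 0 [set c | forall z, z != 0 ->
  F z a b = GA 0 a b + c * z + GB 0 a b * z ^+ 2].
exists B => z z0; apply/matrixP => a b; rewrite !mxE.
have [c hc] := H a b; case: xgetP => [y -> /= hy|/(_ c)]; last by case.
by rewrite (hy z z0) [_ * z ^+ 2]mulrC; congr (_ + _ + _); exact: mulrC.
Unshelve. all: end_near. Qed.

End ParameterCalculus.

Arguments mxder_cst {R m k} A z.
Arguments mxderD {R m k F G z}.
Arguments mxderZ {R m k f F z}.
Arguments mxderM {R m k q F G z}.
Arguments mxder_ladj {R n F z}.

(** * Matrix polynomials vanishing near 0 *)

Section PolynomialIdentity.
Variables (R : realType) (m k : nat).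
Local Notation C := (Cplx R).

Definition mxhorner (s : seq 'M[C]_(m, k)) (l : C) := foldr (fun A B => A + l *: B) 0 s.

Lemma mxhorner_eq0 s : (\forall l \near (0 : C), l != 0 -> mxhorner s l = 0) ->
  forall j, s`_j = 0.
Proof.
have der s' : mxder (mxhorner s') 0.
  elim: s' => [|A s' IH]; first exact: mxder_cst.
  exact: (mxderD (mxder_cst A 0) (mxderZ (@cdiff_id _ 0) IH)).
elim: s => [|A s IH] h j; first by rewrite nth_nil.
have A0 : A = 0 by have := mx_vanish_at0 (der (A :: s)) h; rewrite /= scale0r addr0.
case: j => [|j] /=; first exact: A0.
apply: IH.
near=> l => l0; have e : l != 0 -> mxhorner (A :: s) l = 0 by near: l.
by move/eqP: (e l0); rewrite /= A0 add0r scaler_eq0 (negbTE l0) => /eqP.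
Unshelve. all: end_near. Qed.

End PolynomialIdentity.

(** * Gauging the flat family *)

Section HatChart.
Variables (R : realType) (S : riemannSurface R) (n : nat).
Local Notation C := (Cplx R).
Local Notation vec := 'cV[C]_(n.+2).
Local Notation End := 'M[C]_(n.+2).
Variable i : rs_idx S.
Local Notation D := (rs_dom i).
Let oD : open D := rs_open_dom i.
Let Dd : D `<=` D := @subset_refl _ D.

(** The coefficient of g . (d + a), namely g a g^{-1} + g d(g^{-1}), with [ladj] for the inverse of
    an orthogonal [g]. *)
Definition gauge_coef b (g a : S -> End) x : End :=
  g x *m a x *m ladj (g x) + g x *m ladj (mcd b i g x).

Definition family_form (N Q : bool -> S -> End) b (l : C) x : End :=
  - N b x + l *: N b x + (l ^+ 2 - 1) *: Q b x.

(* [rr true l] is r(l) and [rr false l] is r(1/l); [f true l] and [f false l]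
   are the (1,0)-part of the dressed connection at l and its (0,1)-part at 1/l. *)
Record dressing_chart (P : S -> End) (N Q : bool -> S -> End) (dm : bool -> set C)
    (rr f : bool -> C -> S -> End) : Prop := DressingChart {
  dc_cs : csplit i D P N;
  dc_Q_sm : forall b, mxsm i D (Q b);
  dc_Q_skew : forall b x, D x -> ladj (Q b x) = - Q b x;
  dc_QP : forall b x, D x -> Q b x *m P x = Q b x /\ P x *m Q b x = Q b x;
  dc_dm_near : forall b, \forall l \near (0 : C), dm b l;
  dc_dm_opp : forall b l, dm b l -> dm b (- l);
  dc_rr_sm : forall b l, dm b l -> mxsm i D (rr b l);
  dc_rr_orth : forall b l x, dm b l -> D x -> orthogonal_mx (rr b l x);
  dc_rr_der : forall b x, D x -> mxder (fun l => rr b l x) 0;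
  dc_rr_der1 : forall b c x, D x -> mxder (fun l => mcd c i (rr b l) x) 0;
  dc_rr_twist : forall b c l m x, dm b l -> dm c m -> D x ->
    rr b (- l) x *m (2 *: P x - 1%:M) *m ladj (rr b l x) =
    rr c (- m) x *m (2 *: P x - 1%:M) *m ladj (rr c m x);
  dc_f_sm : forall b l, l != 0 -> mxsm i D (f b l);
  dc_f_der : forall b l x, l != 0 -> D x -> mxder (fun m => f b m x) l;
  dc_f_gauge : forall b l x, l != 0 -> dm b l -> D x ->
    f b l x = gauge_coef b (rr b l) (family_form N Q b l) x;
  dc_f_gauge' : forall b l x, l != 0 -> dm (~~ b) l -> D x ->
    f b l^-1 x = gauge_coef b (rr (~~ b) l) (family_form N Q b l^-1) x;
  dc_f_1 : forall b x, D x -> f b 1 x = 0;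
  dc_flat : forall x l, D x -> l != 0 ->
    mcd true i (family_form N Q false l^-1) x - mcd false i (family_form N Q true l) x +
    lie (family_form N Q true l x) (family_form N Q false l^-1 x) = 0
}.

Variables (P : S -> End) (N Q : bool -> S -> End) (dm : bool -> set C).
Variables (rr f : bool -> C -> S -> End).
Hypothesis dc : dressing_chart P N Q dm rr f.
Local Notation family_coef := (family_form N Q).
Let cs := dc_cs dc.
Let Q_sm := dc_Q_sm dc.
Let Q_skew := dc_Q_skew dc.
Let QP := dc_QP dc.
Let dm_near := dc_dm_near dc.
Let dm_opp := dc_dm_opp dc.
Let rr_sm := dc_rr_sm dc.
Let rr_orth := dc_rr_orth dc.
Let rr_der := dc_rr_der dc.
Let rr_der1 := dc_rr_der1 dc.
Let rr_twist := dc_rr_twist dc.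
Let f_sm := dc_f_sm dc.
Let f_der := dc_f_der dc.
Let f_gauge := dc_f_gauge dc.
Let f_gauge' := dc_f_gauge' dc.
Let f_1 := dc_f_1 dc.
Let flat := dc_flat dc.

Let dm0 b : dm b 0. Proof. exact: nbhs_singleton (dm_near b). Qed.

Local Notation R0 b x := (rr b 0 x).
(* The dressed family is [- n + l n + (l^2 - 1) u], whose value at [-1] is [- 2 n]. *)
Definition hatN b x : End := - 2^-1 *: f b (- 1) x.
Definition hatQ b x : End := R0 (~~ b) x *m Q b x *m ladj (R0 (~~ b) x).

Let scale_sandwich (k : C) (g a h X : End) :
  k *: (g *m a *m h + X) = g *m (k *: a) *m h + k *: X.
Proof. by rewrite scalerDr scalemxAl scalemxAr. Qed.

Let scale_family b x (l : C) : l != 0 -> l ^+ 2 *: family_coef b l^-1 x =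
  - l ^+ 2 *: N b x + l *: N b x + (1 - l ^+ 2) *: Q b x.
Proof.
move=> l0; rewrite /family_form !scalerDr !scalerA scalerN scaleNr mulrBr mulr1 -exprMn.
by rewrite (mulfV l0) expr1n expr2 -(mulrA l) (mulfV l0) mulr1.
Qed.

Let half2 (X : End) : 2^-1 *: (2 *: X) = X.
Proof. by rewrite scalerA mulVf ?pnatr_eq0 // scale1r. Qed.

Lemma hat_poly_gauge b x : D x ->
  (forall l, l != 0 -> f b l x = - hatN b x + l *: hatN b x + (l ^+ 2 - 1) *: hatQ b x) /\
  gauge_coef b (rr b 0) (fun x => - N b x - Q b x) x = - hatN b x - hatQ b x.
Proof.
move=> Dx.
(* [GA] is the gauge expression near l = 0, and [GB] is l^2 times the one at 1/l. The factor l^2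
   clears the double pole, so at 0 only the contribution of [Q] survives in [GB]. *)
pose GA l := gauge_coef b (rr b l) (family_coef b l) x.
pose GB l := rr (~~ b) l x *m (- l ^+ 2 *: N b x + l *: N b x + (1 - l ^+ 2) *: Q b x) *m
  ladj (rr (~~ b) l x) + l ^+ 2 *: (rr (~~ b) l x *m ladj (mcd b i (rr (~~ b) l) x)).
have d1 : derivable (fun l : C => l) 0 1 by exact: cdiff_id.
have d2 : derivable (fun l : C => l ^+ 2) 0 1 by exact: (cdiffM d1 d1).
have d3 : derivable (fun l : C => l ^+ 2 - 1) 0 1 by exact: (cdiffB d2 (@cdiff_cst _ 1 0)).
have d4 : derivable (fun l : C => 1 - l ^+ 2) 0 1 by exact: (cdiffB (@cdiff_cst _ 1 0) d2).
have d5 : derivable (fun l : C => - l ^+ 2) 0 1.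
  have -> : (fun l : C => - l ^+ 2) = (fun l => 0 - l ^+ 2) by apply/funext => l; rewrite sub0r.
  exact: (cdiffB (@cdiff_cst _ 0 0) d2).
have dA : mxder GA 0.
  apply: mxderD; last by apply: mxderM; [exact: (@rr_der b x Dx) | exact: mxder_ladj (@rr_der1 b b x Dx)].
  apply: mxderM; last exact: mxder_ladj (@rr_der b x Dx).
  apply: mxderM; first exact: (@rr_der b x Dx).
  apply: mxderD; last first.
    exact: (mxderZ d3 (mxder_cst _ _)).
  by apply: mxderD; [exact: mxder_cst | exact: (mxderZ d1 (mxder_cst _ _))].
have dB : mxder GB 0.
  apply: mxderD; last first.
    by apply: (mxderZ d2); apply: mxderM; [exact: (@rr_der (~~ b) x Dx) | exact: mxder_ladj (@rr_der1 (~~ b) b x Dx)].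
  apply: mxderM; last exact: mxder_ladj (@rr_der (~~ b) x Dx).
  apply: mxderM; first exact: (@rr_der (~~ b) x Dx).
  apply: mxderD; last first.
    exact: (mxderZ d4 (mxder_cst _ _)).
  apply: mxderD; last exact: (mxderZ d1 (mxder_cst _ _)).
  exact: (mxderZ d5 (mxder_cst _ _)).
have nA : \forall l \near (0 : C), l != 0 -> f b l x = GA l.
  by near=> l => l0; apply: f_gauge => //; near: l; exact: dm_near.
have nB : \forall l \near (0 : C), l != 0 -> l ^+ 2 *: f b l^-1 x = GB l.
  near=> l => l0; have dl : dm (~~ b) l by near: l; exact: dm_near.
  by rewrite (f_gauge' l0 dl Dx) scale_sandwich (scale_family b x l0).
have [B hB] := gauge_quadratic (fun l l0 => f_der l0 Dx) dA dB nA nB.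
have GB0 : GB 0 = hatQ b x.
  by rewrite /GB expr2 mul0r !(oppr0, scale0r, addr0, add0r, subr0, scale1r).
have GA0 : GA 0 = gauge_coef b (rr b 0) (fun x => - N b x - Q b x) x.
  by rewrite /GA /gauge_coef /family_form expr2 mul0r scale0r addr0 sub0r scaleN1r.
have N1 : (-1 : C) != 0 by rewrite oppr_eq0 oner_neq0.
rewrite -GA0; move: hB (f_1 b Dx); rewrite GB0 /hatN.
have two0 : (2 : C) != 0 by rewrite pnatr_eq0.
move: (GA 0) (hatQ b x) => A q hB; rewrite (hB 1 (oner_neq0 _)) expr1n !scale1r => e1.
have {}e1 : A = - B - q by rewrite -[A]addr0 -oppr0 -e1; mx_ring.
have -> : - 2^-1 *: f b (- 1) x = B.
  rewrite (hB _ N1) e1 sqrrN expr1n.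
  have -> : - B - q + -1 *: B + 1 *: q = - (2 *: B) by mx_ring.
  by rewrite scalerN scaleNr opprK half2.
split; last exact: e1.
move=> l l0; rewrite (hB _ l0) e1; mx_ring.
Unshelve. all: end_near. Qed.

Let R_orth b x : D x -> orthogonal_mx (R0 b x). Proof. exact: rr_orth (dm0 b). Qed.
Let R_sm b : mxsm i D (rr b 0) := rr_sm (dm0 b).

Lemma hatN_sm b : mxsm i D (hatN b).
Proof.
have N1 : (-1 : C) != 0 by rewrite oppr_eq0 oner_neq0.
exact: (mxsmZ oD Dd (sm_cst oD Dd (- 2^-1)) (f_sm b N1)).
Qed.

Lemma hatQ_sm b : mxsm i D (hatQ b).
Proof.
exact: (mxsmM oD Dd (mxsmM oD Dd (R_sm (~~ b)) (Q_sm b)) (mxsm_ladj oD Dd (R_sm (~~ b)))).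
Qed.

Lemma ladj_sandwich (g A : End) : ladj (g *m A *m ladj g) = g *m ladj A *m ladj g.
Proof. by rewrite !ladjM ladjK mulmxA. Qed.

Lemma hatQ_skew b x : D x -> ladj (hatQ b x) = - hatQ b x.
Proof. by move=> Dx; rewrite /hatQ ladj_sandwich Q_skew // mulmxN mulNmx. Qed.

(* differentiating g * ladj g = 1 *)
Lemma orth_mcd b (g : S -> End) x : mxsm i D g -> (forall y, D y -> orthogonal_mx (g y)) -> D x ->
  mcd b i g x *m ladj (g x) = - (g x *m ladj (mcd b i g x)).
Proof.
move=> hg og Dx.
have e y : D y -> g y *m ladj (g y) = 1%:M by move=> Dy; exact: orth_adjr (og y Dy).
have := mcd_ext oD Dd b Dx e.
rewrite (mcdM oD Dd b Dx hg (mxsm_ladj oD Dd hg)) mcd_cst (mcd_ladj oD Dd b hg Dx) => /eqP.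
by rewrite addr_eq0 => /eqP.
Qed.

Lemma gauge_skew b (g a : S -> End) x : mxsm i D g -> (forall y, D y -> orthogonal_mx (g y)) ->
  D x -> ladj (a x) = - a x -> ladj (gauge_coef b g a x) = - gauge_coef b g a x.
Proof.
move=> hg og Dx ax; rewrite /gauge_coef ladjD ladj_sandwich ladjM ladjK ax.
rewrite (orth_mcd b hg og Dx) mulmxN mulNmx.
by move: (_ *m a x *m _) (g x *m ladj _) => X Y; rewrite opprD.
Qed.

Lemma hatN_skew b x : D x -> ladj (hatN b x) = - hatN b x.
Proof.
move=> Dx; have [_ e] := hat_poly_gauge b Dx.
have a_skew : ladj (- N b x - Q b x) = - (- N b x - Q b x).
  by rewrite ladjB ladjN (cs_skew cs b Dx) (Q_skew b Dx) opprD.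
have := @gauge_skew b _ (fun x => - N b x - Q b x) _ (R_sm b) (@R_orth b) Dx a_skew.
rewrite e ladjB ladjN (hatQ_skew b Dx).
move: (hatN b x) (hatQ b x) => c d.
by rewrite opprK opprB opprK addrC => /addrI e1; rewrite -{2}e1 opprK.
Qed.

Definition hatP x : End := R0 true x *m P x *m ladj (R0 true x).

Let hat_refl b x : D x ->
  R0 b x *m (2 *: P x - 1%:M) *m ladj (R0 b x) = 2 *: hatP x - 1%:M.
Proof.
move=> Dx; have := rr_twist (dm0 b) (dm0 true) Dx; rewrite oppr0 => ->.
rewrite mulmxBr mulmxBl mulmx1 (orth_adjr (R_orth true Dx)) /hatP.
by rewrite -scalemxAr -scalemxAl.
Qed.

(** The twist relation at l = 0, where l and -l coincide, says that the reflection has the same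
    conjugate under r(0) and r(oo). *)
Lemma hatPE b x : D x -> hatP x = R0 b x *m P x *m ladj (R0 b x).
Proof.
move=> Dx; have := hat_refl b Dx.
rewrite mulmxBr mulmxBl mulmx1 (orth_adjr (R_orth b Dx)) => /addIr.
by rewrite -scalemxAr -scalemxAl => /(congr1 (fun X => 2^-1 *: X)); rewrite !half2.
Qed.

Lemma sandwichM (g A B : End) : orthogonal_mx g ->
  (g *m A *m ladj g) *m (g *m B *m ladj g) = g *m (A *m B) *m ladj g.
Proof.
move=> og; rewrite -(mulmxA (g *m A)) (mulmxA (ladj g)) (mulmxA (ladj g)) orth_adj // mul1mx.
by rewrite !mulmxA.
Qed.

Lemma hatP_idem x : D x -> hatP x *m hatP x = hatP x.
Proof. by move=> Dx; rewrite /hatP (sandwichM _ _ (R_orth true Dx)) (cs_idem cs Dx). Qed.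

Lemma hatQP b x : D x -> hatQ b x *m hatP x = hatQ b x /\ hatP x *m hatQ b x = hatQ b x.
Proof.
move=> Dx; rewrite (hatPE (~~ b) Dx) /hatQ !(sandwichM _ _ (R_orth (~~ b) Dx)).
by have [-> ->] := QP b Dx.
Qed.

Lemma hatP_sm : mxsm i D hatP.
Proof.
exact: (mxsmM oD Dd (mxsmM oD Dd (R_sm true) (cs_P_sm cs)) (mxsm_ladj oD Dd (R_sm true))).
Qed.

Let hat_commutator (K q h k p : End) : p *m h = p -> h *m p = p -> q *m h = q -> h *m q = q ->
  - (- K - q + k + p) *m h + (k *m h - h *m k) + h *m (- K - q + k + p) = K *m h - h *m K.
Proof.
by move=> e1 e2 e3 e4; rewrite mulNmx !(mulmxDl, mulmxDr, mulNmx, mulmxN) e1 e2 e3 e4; mx_ring.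
Qed.

(** [P] is parallel for d - N and commutes with [Q], hence is parallel for d - N - Q. The gauge by
    r(0) takes this operator to d - hatN - hatQ and [P] to [hatP], and [hatQ] commutes with
    [hatP]. *)
Lemma hatP_d b x : D x -> mcd b i hatP x = hatN b x *m hatP x - hatP x *m hatN b x.
Proof.
move=> Dx.
have hRP := mxsmM oD Dd (R_sm b) (cs_P_sm cs); have hRa := mxsm_ladj oD Dd (R_sm b).
rewrite (mcd_ext oD Dd b Dx (fun y Dy => hatPE b Dy)) (mcdM oD Dd b Dx hRP hRa).
rewrite (mcdM oD Dd b Dx (R_sm b) (cs_P_sm cs)) (mcd_ladj oD Dd b (R_sm b) Dx) (cs_dP cs b Dx).
have [qp pq] := QP b Dx; have [hqp hpq] := hatQP b Dx.
have [_ e] := hat_poly_gauge b Dx.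
have og := R_orth b Dx.
have e1 : mcd b i (rr b 0) x *m P x *m ladj (R0 b x) =
    - (R0 b x *m ladj (mcd b i (rr b 0) x)) *m hatP x.
  rewrite -(orth_mcd b (R_sm b) (R_orth b) Dx) (hatPE b Dx).
  by rewrite -(mulmxA _ (ladj _)) (mulmxA (ladj _)) (mulmxA (ladj _)) orth_adj // mul1mx !mulmxA.
have e2 : R0 b x *m P x *m ladj (mcd b i (rr b 0) x) =
    hatP x *m (R0 b x *m ladj (mcd b i (rr b 0) x)).
  by rewrite (hatPE b Dx) -!mulmxA (mulmxA (ladj _)) orth_adj // mul1mx.
have eM : R0 b x *m ladj (mcd b i (rr b 0) x) =
    - hatN b x - hatQ b x + R0 b x *m N b x *m ladj (R0 b x) + R0 b x *m Q b x *m ladj (R0 b x).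
  rewrite -e /gauge_coef mulmxBr mulmxN mulmxBl mulNmx.
  by move: (_ *m N b x *m _) (_ *m Q b x *m _) (_ *m ladj (mcd _ _ _ _)) => a c d; mx_ring.
have nP : R0 b x *m (N b x *m P x) *m ladj (R0 b x) = R0 b x *m N b x *m ladj (R0 b x) *m hatP x.
  by rewrite (hatPE b Dx) sandwichM.
have Pn : R0 b x *m (P x *m N b x) *m ladj (R0 b x) = hatP x *m (R0 b x *m N b x *m ladj (R0 b x)).
  by rewrite (hatPE b Dx) sandwichM.
have qP : R0 b x *m Q b x *m ladj (R0 b x) *m hatP x = R0 b x *m Q b x *m ladj (R0 b x).
  by rewrite (hatPE b Dx) (sandwichM _ _ og) qp.
have Pq : hatP x *m (R0 b x *m Q b x *m ladj (R0 b x)) = R0 b x *m Q b x *m ladj (R0 b x).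
  by rewrite (hatPE b Dx) (sandwichM _ _ og) pq.
rewrite mulmxDl e1 e2 eM mulmxBr mulmxBl nP Pn; exact: hat_commutator.
Qed.

Let parity_algebra (a a' w p rho g g' gi M M' F F' drho : End) :
  g *m gi = 1%:M -> rho *m g = g' *m p -> p *m a = a' *m p + w ->
  drho *m g - rho *m (M *m g) = - (M' *m g') *m p + g' *m w ->
  M *m g = F *m g - g *m a -> M' *m g' = F' *m g' - g' *m a' ->
  drho = rho *m F - F' *m rho.
Proof.
move=> gg rg pa hd hM hM'.
have key : drho *m g = (rho *m F - F' *m rho) *m g.
  have e1 : rho *m (M *m g) = rho *m F *m g - g' *m a' *m p - g' *m w.
    by rewrite hM mulmxBr mulmxA (mulmxA rho g) rg -(mulmxA g') pa mulmxDr mulmxA opprD addrA.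
  have e2 : (M' *m g') *m p = F' *m rho *m g - g' *m a' *m p.
    by rewrite hM' mulmxBl -(mulmxA F' g' p) -rg mulmxA.
  rewrite e1 mulNmx e2 in hd; rewrite mulmxBl.
  move: (drho *m g) (rho *m F *m g) (g' *m a' *m p) (g' *m w) (F' *m rho *m g) hd => A B c d e hd.
  by rewrite -[A](addrNK (B - c - d)) hd; mx_ring.
by rewrite -[LHS]mulmx1 -gg mulmxA key -mulmxA gg mulmx1.
Qed.

Let refl_coef b l x : D x ->
  (2 *: P x - 1%:M) *m family_coef b l x = family_coef b (- l) x *m (2 *: P x - 1%:M) +
    (2 *: (N b x *m P x - P x *m N b x)).
Proof.
move=> Dx; have e := cs_mixed cs b Dx; have [qp pq] := QP b Dx.
have {}e : P x *m N b x = N b x - N b x *m P x by rewrite -[X in X - _]e addrK.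
rewrite /family_form; move: (N b x) (P x) (Q b x) e qp pq => n0 p q e qp pq.
rewrite !(mulmxBl, mulmxBr, mulmxDl, mulmxDr, mulmx1, mul1mx, mulmxN, mulNmx) -!scalemxAl -!scalemxAr.
rewrite e qp pq; move: (n0 *m p) => np.
mx_ring.
Qed.

Let gauge_M b l x : l != 0 -> dm b l -> D x ->
  (rr b l x *m ladj (mcd b i (rr b l) x)) *m rr b l x =
  f b l x *m rr b l x - rr b l x *m family_coef b l x.
Proof.
move=> l0 dl Dx; rewrite (f_gauge l0 dl Dx) /gauge_coef mulmxDl.
rewrite -(mulmxA (rr b l x *m family_coef b l x)) (orth_adj (rr_orth dl Dx)) mulmx1.
by rewrite addrAC subrr add0r.
Qed.

(** The derivative of the relation rhohat r(l) = r(-l) rho, in which rhohat = 2 hatP - 1 does not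
    depend on l. *)
Let hatP_parity b l x : l != 0 -> dm b l -> D x ->
  2 *: mcd b i hatP x = (2 *: hatP x - 1%:M) *m f b l x - f b (- l) x *m (2 *: hatP x - 1%:M).
Proof.
move=> l0 dl Dx; have dl' := dm_opp dl.
have l0' : - l != 0 by rewrite oppr_eq0.
have og := rr_orth dl Dx.
have sm1 := sm_cst oD Dd (2 : C); have I_sm := mxsm_cst oD Dd (1%:M : End).
have refl_sm (X : S -> End) : mxsm i D X -> mxsm i D (fun y => 2 *: X y - 1%:M).
  by move=> hX; exact: (mxsmB oD Dd (mxsmZ oD Dd sm1 hX) I_sm).
have refl_d (X : S -> End) : mxsm i D X -> mcd b i (fun y => 2 *: X y - 1%:M) x = 2 *: mcd b i X x.
  move=> hX; rewrite (mcdB oD Dd b Dx (mxsmZ oD Dd sm1 hX) I_sm) (mcdZc oD Dd b Dx 2 hX).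
  by rewrite mcd_cst subr0.
have tw y : D y -> (2 *: hatP y - 1%:M) *m rr b l y = rr b (- l) y *m (2 *: P y - 1%:M).
  move=> Dy; rewrite -(hat_refl true Dy) -{1}oppr0 (rr_twist (dm0 true) dl Dy).
  by rewrite -(mulmxA _ (ladj _)) (orth_adj (rr_orth dl Dy)) mulmx1.
have e := mcd_ext oD Dd b Dx tw.
rewrite (mcdM oD Dd b Dx (refl_sm _ hatP_sm) (rr_sm dl)) in e.
rewrite (mcdM oD Dd b Dx (rr_sm dl') (refl_sm _ (cs_P_sm cs))) in e.
rewrite (refl_d _ hatP_sm) (refl_d _ (cs_P_sm cs)) (cs_dP cs b Dx) in e.
have rr_d m : dm b m -> mcd b i (rr b m) x =
    - ((rr b m x *m ladj (mcd b i (rr b m) x)) *m rr b m x).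
  move=> dmm; rewrite -mulNmx -(orth_mcd b (rr_sm dmm) (fun y => rr_orth dmm) Dx).
  by rewrite -mulmxA (orth_adj (rr_orth dmm Dx)) mulmx1.
rewrite (rr_d _ dl) (rr_d _ dl') mulmxN in e.
exact: (parity_algebra (orth_adjr og) (tw x Dx) (refl_coef b l Dx) e
  (gauge_M l0 dl Dx) (gauge_M l0' dl' Dx)).
Qed.

Lemma dm_neq0 b : exists2 l, l != 0 & dm b l.
Proof.
have /nearC[e e0 h] := dm_near b; exists (realC (e / 2)).
  by rewrite -norm1_eq0 /norm1 /= normr0 addr0 normr_eq0 gt_eqF // divr_gt0.
by apply: h; rewrite subr0 /norm1 /= normr0 addr0 gtr0_norm ?divr_gt0 // ltr_pdivrMr // ltr_pMr // ltr1n.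
Qed.

Let anticommute_refl (p m : End) :
  (2 *: p - 1%:M) *m m + m *m (2 *: p - 1%:M) = 0 -> p *m m + m *m p = m.
Proof.
rewrite mulmxBl mulmxBr mul1mx mulmx1 -scalemxAl -scalemxAr => e.
apply: subr0_eq; rewrite -[LHS]half2; move: (p *m m) (m *m p) e => a b e.
have -> : 2 *: (a + b - m) = 2 *: a - m + (2 *: b - m) by mx_ring.
by rewrite e scaler0.
Qed.

(** The left side of [hatP_parity] does not depend on l. Subtracting its values at l and -l, the
    reflection anticommutes with [f b l - f b (- l)], which is [2 * l] times [hatN]. *)
Lemma hat_mixed b x : D x -> hatP x *m hatN b x + hatN b x *m hatP x = hatN b x.
Proof.
move=> Dx; have [l l0 dl] := dm_neq0 b; have l0' : - l != 0 by rewrite oppr_eq0.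
have e := hatP_parity l0 dl Dx.
rewrite (hatP_parity l0' (dm_opp dl) Dx) opprK in e.
have [h _] := hat_poly_gauge b Dx.
have dF : f b l x - f b (- l) x = (2 * l) *: hatN b x.
  rewrite (h _ l0) (h _ l0') sqrrN; move: (hatN b x) (hatQ b x) => m q.
  by clear -l; mx_ring.
have e' : (2 *: hatP x - 1%:M) *m (f b l x - f b (- l) x) +
    (f b l x - f b (- l) x) *m (2 *: hatP x - 1%:M) = 0.
  move: (2 *: hatP x - 1%:M) (f b l x) (f b (- l) x) e => rho F F' e.
  rewrite mulmxBr mulmxBl.
  move: (rho *m F) (rho *m F') (F *m rho) (F' *m rho) e => A B A' B' e.
  have -> : A - B + (A' - B') = (A - B') - (B - A') by mx_ring.
  by rewrite e subrr.
have two0 : (2 : C) != 0 by rewrite pnatr_eq0.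
have l2 := mulf_neq0 two0 l0.
move: e'; rewrite dF -scalemxAl -scalemxAr -scalerDr => /eqP.
by rewrite scaler_eq0 (negbTE l2) => /eqP; exact: anticommute_refl.
Qed.

Lemma hat_csplit : csplit i D hatP hatN.
Proof.
split.
- exact: hatP_sm.
- exact: hatP_idem.
- exact: hatN_sm.
- exact: hatN_skew.
- exact: hat_mixed.
- exact: hatP_d.
Qed.

Let curv_algebra (h g At Af Ft Ff dAt dAf dFt dFf : End) : g *m h = 1%:M ->
  (h *m Ft - At *m h) *m Ff + h *m dFf - (dAf *m h + Af *m (h *m Ft - At *m h)) =
  (h *m Ff - Af *m h) *m Ft + h *m dFt - (dAt *m h + At *m (h *m Ff - Af *m h)) ->
  dAf - dAt + lie At Af = 0 -> dFf - dFt + lie Ft Ff = 0.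
Proof.
move=> gh e1 e2.
suff e : h *m (dFf - dFt + lie Ft Ff) = (dAf - dAt + lie At Af) *m h.
  by rewrite -[LHS]mul1mx -gh -mulmxA e e2 mul0mx mulmx0.
apply: subr0_eq; move: e1; rewrite /lie !(mulmxBl, mulmxBr, mulmxDl, mulmxDr, mulmxN, mulNmx, mulmxA).
move: (h *m Ft *m Ff) (At *m h *m Ff) (h *m dFf) (dAf *m h) (Af *m h *m Ft) (Af *m At *m h)
  (h *m Ff *m Ft) (h *m dFt) (dAt *m h) (At *m Af *m h).
move=> x1 x2 x3 x4 x5 x6 x7 x8 x9 x10 /eqP; rewrite -subr_eq0 => /eqP e.
by rewrite -[RHS]e; mx_ring.
Qed.

Let family_sm b l : mxsm i D (family_coef b l).
Proof.
have hN := cs_N_sm cs b; have z1 := sm_cst oD Dd l; have z2 := sm_cst oD Dd (l ^+ 2 - 1).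
exact: (mxsmD oD Dd (mxsmD oD Dd (mxsmN oD Dd hN) (mxsmZ oD Dd z1 hN)) (mxsmZ oD Dd z2 (Q_sm b))).
Qed.

Lemma hat_curv l x : l != 0 -> dm true l -> D x ->
  mcd true i (f false l^-1) x - mcd false i (f true l) x + lie (f true l x) (f false l^-1 x) = 0.
Proof.
move=> l0 dl Dx.
have l0' : l^-1 != 0 by rewrite invr_eq0.
pose g := rr true l; pose h y := ladj (g y).
pose A b := if b then family_coef true l else family_coef false l^-1.
pose F b := if b then f true l else f false l^-1.
have g_sm : mxsm i D g := rr_sm dl.
have h_sm : mxsm i D h := mxsm_ladj oD Dd g_sm.
have A_sm b : mxsm i D (A b) by case: b; exact: family_sm.
have F_sm b : mxsm i D (F b) by case: b; exact: f_sm.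
have F_gauge b y : D y -> F b y = gauge_coef b g (A b) y.
  by case: b => Dy; [exact: f_gauge | exact: (@f_gauge' false)].
(* The inverse gauge [h] satisfies dh = h F - A h. The symmetry of its second derivatives carries
   the vanishing curvature of [A] over to [F]. *)
have dh b y : D y -> mcd b i h y = h y *m F b y - A b y *m h y.
  move=> Dy; rewrite F_gauge // /h (mcd_ladj oD Dd b g_sm Dy) /gauge_coef mulmxDr.
  rewrite !(mulmxA (ladj (g y))) (orth_adj (rr_orth dl Dy)) !mul1mx.
  by move: (A b y *m _) (ladj _) => X Y; rewrite addrAC subrr add0r.
have e := mcd_comm oD Dd true Dx h_sm; rewrite /= in e.
rewrite (mcd_ext oD Dd true Dx (@dh false)) (mcd_ext oD Dd false Dx (@dh true)) in e.
have hF b := mxsmM oD Dd h_sm (F_sm b); have Ah b := mxsmM oD Dd (A_sm b) h_sm.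
rewrite (mcdB oD Dd true Dx (hF false) (Ah false)) (mcdB oD Dd false Dx (hF true) (Ah true)) in e.
rewrite (mcdM oD Dd true Dx h_sm (F_sm false)) (mcdM oD Dd false Dx h_sm (F_sm true)) in e.
rewrite (mcdM oD Dd true Dx (A_sm false) h_sm) (mcdM oD Dd false Dx (A_sm true) h_sm) in e.
rewrite (dh true x Dx) (dh false x Dx) in e.
exact: (curv_algebra (orth_adjr (rr_orth dl Dx)) e (flat Dx l0)).
Qed.

Let laurent_algebra (n0 m u v dN dM du dv : End) (l : C) : l != 0 ->
  l ^+ 2 *: ((- dM + l^-1 *: dM + (l^-1 ^+ 2 - 1) *: dv) - (- dN + l *: dN + (l ^+ 2 - 1) *: du)
    + lie (- n0 + l *: n0 + (l ^+ 2 - 1) *: u) (- m + l^-1 *: m + (l^-1 ^+ 2 - 1) *: v)) =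
  mxhorner [:: dv - lie (n0 + u) v; dM - lie (n0 + u) m + lie n0 v;
    - dM - dv + dN + du + lie (n0 + u) (m + v) + lie n0 m + lie u v;
    - dN - lie n0 (m + v) + lie u m; - du - lie u (m + v)] l.
Proof.
move=> l0; rewrite /lie !(mulmxDl, mulmxDr, mulmxN, mulNmx) -!(scalemxAl, scalemxAr).
move: (n0 *m m) (m *m n0) (u *m m) (m *m u) (n0 *m v) (v *m n0) (v *m u) (u *m v).
move=> x1 x2 x3 x4 x5 x6 x7 x8.
by rewrite /=; mx_entries; field.
Qed.

(** Times l^2 the curvature is a polynomial of degree at most four. Its extreme coefficients are the
    equations for the two parts of q, and the difference of the coefficients of l and l^3 is the
    equation for the Hodge dual of N. *)
Lemma hat_laurent x : D x ->
  [/\ mcd false i (hatQ true) x = lie (hatN false x) (hatQ true x) - lie (hatQ true x) (hatQ false x),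
      mcd true i (hatQ false) x = lie (hatN true x) (hatQ false x) + lie (hatQ true x) (hatQ false x) &
      mcd true i (hatN false) x + mcd false i (hatN true) x =
        2 *: (lie (hatQ true x) (hatN false x) + lie (hatQ false x) (hatN true x))].
Proof.
move=> Dx.
have hf b l y : l != 0 -> D y -> f b l y = - hatN b y + l *: hatN b y + (l ^+ 2 - 1) *: hatQ b y.
  by move=> l0 Dy; have [h _] := hat_poly_gauge b Dy; exact: h.
have df b c l : l != 0 -> mcd c i (f b l) x =
    - mcd c i (hatN b) x + l *: mcd c i (hatN b) x + (l ^+ 2 - 1) *: mcd c i (hatQ b) x.
  move=> l0; rewrite (mcd_ext oD Dd c Dx (fun y => hf b l y l0)).
  have nN := mxsmN oD Dd (hatN_sm b).
  have kN := mxsmZ oD Dd (sm_cst oD Dd l) (hatN_sm b).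
  have kQ := mxsmZ oD Dd (sm_cst oD Dd (l ^+ 2 - 1)) (hatQ_sm b).
  rewrite (mcdD oD Dd c Dx (mxsmD oD Dd nN kN) kQ) (mcdD oD Dd c Dx nN kN).
  by rewrite (mcdN oD Dd c Dx (hatN_sm b)) (mcdZc oD Dd c Dx l (hatN_sm b))
    (mcdZc oD Dd c Dx _ (hatQ_sm b)).
have horn : \forall l \near (0 : C), l != 0 -> mxhorner
    [:: mcd true i (hatQ false) x - lie (hatN true x + hatQ true x) (hatQ false x);
    mcd true i (hatN false) x - lie (hatN true x + hatQ true x) (hatN false x) +
      lie (hatN true x) (hatQ false x);
    - mcd true i (hatN false) x - mcd true i (hatQ false) x + mcd false i (hatN true) x +
      mcd false i (hatQ true) x + lie (hatN true x + hatQ true x) (hatN false x + hatQ false x) +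
      lie (hatN true x) (hatN false x) + lie (hatQ true x) (hatQ false x);
    - mcd false i (hatN true) x - lie (hatN true x) (hatN false x + hatQ false x) +
      lie (hatQ true x) (hatN false x);
    - mcd false i (hatQ true) x - lie (hatQ true x) (hatN false x + hatQ false x)] l = 0.
  near=> l => l0; have dl : dm true l by near: l; exact: dm_near.
  have l0' : l^-1 != 0 by rewrite invr_eq0.
  rewrite -laurent_algebra //; have := hat_curv l0 dl Dx.
  rewrite (df _ _ _ l0) (df _ _ _ l0') (hf _ _ _ l0 Dx) (hf _ _ _ l0' Dx) => ->.
  exact: scaler0.
have z := mxhorner_eq0 horn; move: z; clear.
move: (mcd true i (hatN false) x) (mcd false i (hatN true) x) (mcd true i (hatQ false) x)
  (mcd false i (hatQ true) x) (hatN true x) (hatN false x) (hatQ true x) (hatQ false x).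
move=> dM dN dv du n0 m u v z.
have z0 := z 0%N; have z1 := z 1%N; have z3 := z 3%N; have z4 := z 4%N.
rewrite /= in z0 z1 z3 z4.
move: z0 z1 z3 z4; rewrite /lie !(mulmxDl, mulmxDr, mulmxN, mulNmx).
move: (n0 *m m) (m *m n0) (u *m m) (m *m u) (n0 *m v) (v *m n0) (v *m u) (u *m v).
move=> x1 x2 x3 x4 x5 x6 x7 x8 z0 z1 z3 z4; split; apply: subr0_eq.
- by rewrite -[LHS]opprK -[RHS]oppr0; congr (- _); rewrite -[RHS]z4; mx_ring.
- by rewrite -[RHS]z0; mx_ring.
- by have e := subrr (0 : End); rewrite -{1}z1 -{1}z3 in e; rewrite -[RHS]e; mx_ring.
Unshelve. all: end_near. Qed.

Let kill_algebra (n0 q h : End) (v w : vec) (l : C) : l != 0 -> h *m q = q ->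
  w = (- n0 + l^-1 *: n0 + (l^-1 ^+ 2 - 1) *: q) *m v ->
  (1%:M - h) *m ((1 - l) *: (n0 *m v) - l *: w) = 0.
Proof.
move=> l0 hq ->; have -> : (1 - l) *: (n0 *m v) - l *: ((- n0 + l^-1 *: n0 + (l^-1 ^+ 2 - 1) *: q) *m v) =
    (l * (1 - l^-1 ^+ 2)) *: (q *m v).
  rewrite !mulmxDl mulNmx -!scalemxAl; move: (n0 *m v) (q *m v) => a b; by mx_entries; field.
by rewrite -scalemxAr mulmxA mulmxBl mul1mx hq subrr mul0mx scaler0.
Qed.

(* The order-one pole at the other end of the family is only cancelled if hatN vanishes here. *)
Lemma hatN_kill b x (y : vec) : D x -> P x *m y = y -> N b x *m y = 0 -> Q b x *m y = 0 ->
  hatN b x *m (R0 (~~ b) x *m y) = 0.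
Proof.
move=> Dx Py Ny Qy; pose s l := rr (~~ b) l x; pose ds l := ladj (mcd b i (rr (~~ b) l) x).
(* At 1/l the dressed form, applied to [s l *m y], is holomorphic in l because the original form
   kills [y]. The factor l reduces the simple pole, carried by [hatN], to a value at 0, and
   [1 - hatP] removes the double pole, carried by [hatQ]. *)
pose G l := (1%:M - hatP x) *m ((1 - l) *: (hatN b x *m (s l *m y)) -
  l *: (s l *m (ds l *m (s l *m y)))).
have s_der : mxder s 0 := @rr_der (~~ b) x Dx.
have ds_der : mxder ds 0 := mxder_ladj (@rr_der1 (~~ b) b x Dx).
have sy_der : mxder (fun l => s l *m y) 0 := mxderM s_der (mxder_cst y 0).
have d1 : derivable (fun l : C => 1 - l) 0 1 by exact: (cdiffB (@cdiff_cst _ 1 0) (@cdiff_id _ 0)).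
have d2 : derivable (fun l : C => - l) 0 1.
  have -> : (fun l : C => - l) = (fun l => 0 - l) by apply/funext => l; rewrite sub0r.
  exact: (cdiffB (@cdiff_cst _ 0 0) (@cdiff_id _ 0)).
have G_der : mxder G 0.
  apply: (mxderM (mxder_cst _ 0)).
  have -> : (fun l => (1 - l) *: (hatN b x *m (s l *m y)) - l *: (s l *m (ds l *m (s l *m y)))) =
      (fun l => (1 - l) *: (hatN b x *m (s l *m y)) + - l *: (s l *m (ds l *m (s l *m y)))).
    by apply/funext => l; rewrite scaleNr.
  exact: (mxderD (mxderZ d1 (mxderM (mxder_cst _ 0) sy_der))
    (mxderZ d2 (mxderM s_der (mxderM ds_der sy_der)))).
have G0 : \forall l \near (0 : C), l != 0 -> G l = 0.
  near=> l => l0; have dl : dm (~~ b) l by near: l; exact: dm_near.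
  have l0' : l^-1 != 0 by rewrite invr_eq0.
  have [h _] := hat_poly_gauge b Dx; have := h _ l0'.
  rewrite (f_gauge' l0 dl Dx) /gauge_coef -/(s l) -/(ds l) => /(congr1 (mulmx^~ (s l *m y))).
  have fy : family_coef b l^-1 x *m y = 0.
    by rewrite /family_form !mulmxDl mulNmx -!scalemxAl Ny Qy !scaler0 oppr0 !addr0.
  have e1 : s l *m family_coef b l^-1 x *m ladj (s l) *m (s l *m y) = 0.
    rewrite -(mulmxA _ (ladj _)) (mulmxA (ladj _)) (orth_adj (rr_orth dl Dx)) mul1mx.
    by rewrite -mulmxA fy mulmx0.
  rewrite mulmxDl e1 add0r -(mulmxA (s l)) => e.
  exact: (kill_algebra l0 (proj2 (hatQP b Dx)) e).
have := mx_vanish_at0 G_der G0; rewrite /G subr0 scale1r scale0r subr0 mulmxBl mul1mx => e.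
have Pv : hatP x *m (s 0 *m y) = s 0 *m y.
  rewrite (hatPE (~~ b) Dx) -(mulmxA _ (ladj _)) (mulmxA (ladj _)).
  by rewrite (orth_adj (R_orth (~~ b) Dx)) mul1mx -mulmxA Py.
have PNP : hatP x *m (hatN b x *m (s 0 *m y)) = 0.
  have /(congr1 (mulmx^~ (s 0 *m y))) := cs_PNP hat_csplit b Dx.
  by rewrite mul0mx -(mulmxA (hatP x *m hatN b x)) Pv -(mulmxA (hatP x) (hatN b x)).
by rewrite PNP subr0 in e.
Unshelve. all: end_near. Qed.

Lemma hatQ_kill b x (y : vec) : D x -> Q b x *m y = 0 -> hatQ b x *m (R0 (~~ b) x *m y) = 0.
Proof.
move=> Dx Qy; rewrite /hatQ -(mulmxA _ (ladj _)) (mulmxA (ladj _)).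
by rewrite (orth_adj (R_orth (~~ b) Dx)) mul1mx -mulmxA Qy mulmx0.
Qed.

(** At l = 0 the operator d - hatN - hatQ is the gauge by [R0 b] of d - N - Q. On [X], killed by
    [hatN] and [hatQ], the former is the plain derivative. *)
Lemma hat_pullback b (U : set S) (X : S -> vec) x : open U -> U `<=` D -> U x -> mxsm i U X ->
  hatN b x *m X x = 0 -> hatQ b x *m X x = 0 ->
  ladj (R0 b x) *m mcd b i X x = mcd b i (fun y => ladj (R0 b y) *m X y) x -
    N b x *m (ladj (R0 b x) *m X x) - Q b x *m (ladj (R0 b x) *m X x).
Proof.
move=> oU UD Ux hX NX QX; have Dx := UD _ Ux; have og := R_orth b Dx.
have hR := mxsm_sub UD (R_sm b).
rewrite (mcdM oU UD b Ux (mxsm_ladj oU UD hR) hX) (mcd_ladj oU UD b hR Ux).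
have [_ e] := hat_poly_gauge b Dx.
have eR : ladj (R0 b x) *m (- hatN b x - hatQ b x) *m X x = 0.
  by rewrite -mulmxA mulmxBl mulNmx NX QX oppr0 addr0 mulmx0.
rewrite -e /gauge_coef mulmxDr !(mulmxA (ladj (R0 b x))) (orth_adj og) !mul1mx mulmxDl in eR.
rewrite -mulmxA mulmxBl mulNmx in eR.
move: (N b x *m (_ *m _)) (Q b x *m (_ *m _)) (ladj (mcd _ _ _ _) *m _) eR => u v w eR.
have -> : w = u + v by rewrite -[LHS]subr0 -eR; mx_ring.
by move: (_ *m mcd b i X x) => t; mx_ring.
Qed.

End HatChart.
(** * The dressed surface *)

Section FormEquations.
Variables (R : realType) (S : riemannSurface R) (n : nat).
Local Notation C := (Cplx R).
Local Notation vec := 'cV[C]_(n.+2).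
Local Notation End := 'M[C]_(n.+2).
Variables (i : rs_idx S) (U : set S) (x : S).
Hypotheses (oU : open U) (Ud : U `<=` rs_dom i) (Ux : U x).

Lemma lieZl (a : C) (A B : End) : lie (a *: A) B = a *: lie A B.
Proof. by rewrite /lie -scalemxAl -scalemxAr scalerBr. Qed.

Lemma lieZr (a : C) (A B : End) : lie A (a *: B) = a *: lie A B.
Proof. by rewrite /lie -scalemxAl -scalemxAr scalerBr. Qed.

Lemma lieNl (A B : End) : lie (- A) B = - lie A B.
Proof. by rewrite /lie mulNmx mulmxN opprB opprK addrC. Qed.

Lemma lieC (A B : End) : lie A B = - lie B A.
Proof. by rewrite /lie opprB. Qed.

Lemma cov_d_coef (A al : form1 S n.+2 n.+2) : cov_d (- A) al i x =
  mcd true i (coef false al i) x - mcd false i (coef true al i) x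
  - lie (coef true A i x) (coef false al i x) + lie (coef false A i x) (coef true al i x).
Proof.
have -> : cov_d (- A) al i x = (mx_dz i (coef false al i) x - mx_dzb i (coef true al i) x)
    + (lie (- coef true A i x) (coef false al i x) - lie (- coef false A i x) (coef true al i x)).
  by [].
by rewrite mcdzE mcdzbE !lieNl opprK addrA.
Qed.

Variable N : form1 S n.+2 n.+2.
Hypothesis N_sm : forall b, mxsm i U (coef b N i).

Lemma cov_d_hodge : cov_d (- N) (hodge N) i x =
  'i *: (mcd true i (coef false N i) x + mcd false i (coef true N i) x).
Proof.
rewrite cov_d_coef.
have -> : coef false (hodge N) i = fun y => 'i *: coef false N i y by [].
have -> : coef true (hodge N) i = fun y => - 'i *: coef true N i y by [].
rewrite (mcdZc oU Ud true Ux _ (N_sm false)) (mcdZc oU Ud false Ux _ (N_sm true)).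
rewrite !lieZr [lie (coef false _ _ _) _]lieC.
by move: (mcd _ _ _ _) (mcd _ _ _ _) (lie _ _) => a b c; mx_ring.
Qed.

Lemma wedge_hodge (q : form1 S n.+2 n.+2) : (2 *: wedge_lie q (hodge N)) i x =
  'i *: (2 *: (lie (coef true q i x) (coef false N i x) + lie (coef false q i x) (coef true N i x))).
Proof.
have -> : (2 *: wedge_lie q (hodge N)) i x =
    2 *: (lie (coef true q i x) ('i *: coef false N i x) -
          lie (coef false q i x) (- 'i *: coef true N i x)) by [].
by rewrite !lieZr; move: (lie _ _) (lie _ _) => a b; mx_ring.
Qed.

End FormEquations.

(** * Local frames of a constrained Willmore surface *)

Section WillmoreFrames.
Variables (R : realType) (S : riemannSurface R) (n : nat).
Local Notation C := (Cplx R).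
Local Notation vec := 'cV[C]_(n.+2).
Local Notation End := 'M[C]_(n.+2).

Record willmore_frame i U L sg (P : S -> End) (N Q : bool -> S -> End) : Prop := {
  wf_cf : cframe i U L sg;
  wf_oproj : forall x, U x -> is_oproj (T4 i sg x) (P x);
  wf_cs : csplit i U P N;
  wf_Q_sm : forall b, mxsm i U (Q b);
  wf_Q_in : forall b x, U x -> Q b x \in wedge_sp (L x) (Lam1 L x);
  wf_dQ : forall x, U x -> mcd true i (Q false) x - lie (N true x) (Q false x) =
    mcd false i (Q true) x - lie (N false x) (Q true x);
  wf_EL : forall x, U x -> mcd true i (N false) x + mcd false i (N true) x =
    2 *: (lie (Q true x) (N false x) + lie (Q false x) (N true x))
}.

Variables (L : S -> {vspace vec}) (q N : form1 S n.+2 n.+2).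
Let V := central_sphere L.
Hypotheses (cw : constrained_Willmore setT L q) (sp : splitting setT V N).
Let P := oproj V.
Let cL : conformal_immersion setT L. Proof. by case: cw. Qed.

Lemma willmore_oproj x : is_oproj (V x) (P x).
Proof. by have [h _] := conf_oproj cL; exact: h. Qed.

Let P_sm : mx_smooth setT P. Proof. by have [_] := conf_oproj cL. Qed.

Let cs_of N' i : splitting setT V N' -> csplit i (rs_dom i) P (fun b => coef b N' i).
Proof.
move=> sp'; have sub : rs_dom i `<=` setT `&` rs_dom i by move=> x dx.
apply: (csplit_sub sub).
exact: (splitting_csplit (V := V) openT (fun x _ => willmore_oproj x) i P_sm sp').
Qed.

Lemma willmore_csplit i : csplit i (rs_dom i) P (fun b => coef b N i).
Proof. exact: cs_of sp. Qed.

Lemma willmore_Q_sm i b : mxsm i (rs_dom i) (coef b q i).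
Proof.
have [_ [q_form _] _ _] := cw.
by apply: mxsm_sub (is_form_sm q_form b i) => x dx.
Qed.

Let Dd (i : rs_idx S) : rs_dom i `<=` rs_dom i. Proof. exact: subset_refl. Qed.

Let equations i x : rs_dom i x ->
  (mcd true i (coef false q i) x - lie (coef true N i x) (coef false q i x) =
    mcd false i (coef true q i) x - lie (coef false N i x) (coef true q i x)) /\
  mcd true i (coef false N i) x + mcd false i (coef true N i) x =
    2 *: (lie (coef true q i x) (coef false N i x) + lie (coef false q i x) (coef true N i x)).
Proof.
move=> dx; have oD := @rs_open_dom _ _ i.
have [_ _ _ [N' sp' [e1 e2]]] := cw.
have cs := willmore_csplit i; have cs' := cs_of i sp'.
(* The definition of a constrained Willmore surface brings its own splitting [N']; by uniqueness its
   equations hold for the given [N]. *)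
have eN b y : rs_dom i y -> coef b N i y = coef b N' i y.
  by move=> dy; rewrite (cs_unique cs b dy) (cs_unique cs' b dy).
rewrite (mcd_ext oD (@Dd i) true dx (@eN false)) (mcd_ext oD (@Dd i) false dx (@eN true)).
rewrite !(eN _ _ dx); split.
  have := e1 i x I dx; rewrite cov_d_coef.
  move: (mcd _ _ _ _) (mcd _ _ _ _) (lie _ _) (lie _ _) => a b c d e.
  by apply: subr0_eq; rewrite -[RHS]e; mx_ring.
have := e2 i x I dx; rewrite (cov_d_hodge oD (@Dd i) dx (cs_N_sm cs')) wedge_hodge.
have i0 : ('i : C) != 0 by exact: neq0Ci.
exact: (scalerI i0).
Qed.

Lemma willmore_frame_exists i p : rs_dom i p -> exists U sg, U p /\
  willmore_frame i U L sg P (fun b => coef b N i) (fun b => coef b q i).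
Proof.
move=> dp; have [U [sg [cf Up eV]]] := conf_cframe cL dp.
have sub := @cf_dom _ _ _ _ _ _ _ cf.
exists U, sg; split; first exact: Up.
split.
- exact: cf.
- by move=> x Ux; rewrite -(eV x Ux); exact: willmore_oproj.
- exact: csplit_sub sub (willmore_csplit i).
- by move=> b; exact: mxsm_sub sub (willmore_Q_sm i b).
- move=> b x Ux; have [_ _ q_in _] := cw.
  by move/form_in_coef: q_in => /(_ b i x I (sub x Ux)).
- by move=> x /sub dx; have [] := equations dx.
- by move=> x /sub dx; have [] := equations dx.
Qed.

End WillmoreFrames.

(** * From the dressing gauge to its data in a chart *)

Section DressingChart.
Variables (R : realType) (S : riemannSurface R) (n : nat).
Local Notation C := (Cplx R).
Local Notation vec := 'cV[C]_(n.+2).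
Local Notation End := 'M[C]_(n.+2).

Lemma hol_family_der Om W m k (F : C -> S -> 'M[C]_(m, k)) l p : mx_hol_family Om W F -> Om l ->
  W p -> mxder (fun z => F z p) l.
Proof.
move=> h Ol Wp a b; have [i di] := rs_cover p.
by have [_ _] := h a b i [::] l p Ol Wp di.
Qed.

Lemma hol_family_der1 Om W m k (F : C -> S -> 'M[C]_(m, k)) l p i c : mx_hol_family Om W F ->
  Om l -> W p -> rs_dom i p -> mxder (fun z => mcd c i (F z) p) l.
Proof.
move=> h Ol Wp di a b.
have [_ _ d1] := h a b i [:: false] l p Ol Wp di.
have [_ _ d2] := h a b i [:: true] l p Ol Wp di.
rewrite /= in d1 d2.
have -> : (fun z => mcd c i (F z) p a b) = (fun z => 2^-1 *
    (pd i 1 (fun x => F z x a b) p + (if c then - 'i else 'i) * pd i 'i (fun x => F z x a b) p)).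
  by apply/funext => z; rewrite mcdE cdE mulrC.
exact: (cdiffM (@cdiff_cst _ 2^-1 l) (cdiffD d1 (cdiffM (@cdiff_cst _ _ l) d2))).
Qed.

Lemma cst_smooth m k (A : 'M[C]_(m, k)) : mx_smooth (setT : set S) (fun=> A).
Proof.
apply: (proj2 (mx_smooth_sm _ _)) => j.
exact: (mxsm_cst (open_chart j openT) (@subIsetr _ setT (rs_dom j)) A).
Qed.

(** Constant sections suffice to compare the zero order parts of two connections. *)
Lemma gauge_connection W g (A B : form1 S n.+2 n.+2) i x b : open W -> W x -> rs_dom i x ->
  mx_smooth setT g -> (forall y, orthogonal_mx (g y)) ->
  eq_connection (gauge g (nabla A)) (nabla B) ->
  coef b B i x = gauge_coef i b g (coef b A i) x.
Proof.
move=> oW Wx dx g_sm og e; apply: mulmx_ext => w.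
have oD := @rs_open_dom _ _ i; have Dd : rs_dom i `<=` rs_dom i := @subset_refl _ _.
have hg : mxsm i (rs_dom i) g.
  by have /mx_smooth_sm/(_ i) := g_sm; apply: mxsm_sub => y dy.
have w_sm := cst_smooth w.
have := congr1 (fun z => if b then z.1 else z.2) (e setT _ openT w_sm i x I dx).
rewrite -[in X in _ = X -> _]/(coef b (nabla B (fun=> w)) i x) nabla_coef mcd_cst add0r => <-.
have -> : (if b then (gauge g (nabla A) (fun=> w) i x).1 else (gauge g (nabla A) (fun=> w) i x).2) =
    g x *m coef b (nabla A (fun y => invmx (g y) *m w)) i x by case: b.
rewrite nabla_coef.
have inv_ladj : (fun y => invmx (g y) *m w) = (fun y => ladj (g y) *m w).
  by apply/funext => y; rewrite (orth_inv (og y)).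
rewrite inv_ladj (mcdM oD Dd b dx (mxsm_ladj oD Dd hg) (mxsm_cst oD Dd w)) mcd_cst mulmx0 addr0.
rewrite (mcd_ladj oD Dd b hg dx) (orth_inv (og x)) /gauge_coef mulmxDr mulmxDl addrC !mulmxA.
by [].
Qed.

Variables (L : S -> {vspace vec}) (q N : form1 S n.+2 n.+2).
Variables (dom : set (P1 R)) (r : P1 R -> S -> End).
Let V := central_sphere L.
Hypotheses (cw : constrained_Willmore setT L q) (sp : splitting setT V N).
Hypothesis dg : dressing_gauge V (perturbed_form N q) dom r.
Variable Ah : C -> form1 S n.+2 n.+2.
Hypothesis Ah_form : forall l, l != 0 -> is_form setT (Ah l).
Hypothesis Ah_hol : forall i, let Cx := [set l : C | l != 0] in
  mx_hol_family Cx (rs_dom i) (fun l p => (Ah l i p).1) /\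
  mx_hol_family Cx (rs_dom i) (fun l p => (Ah l i p).2).
Hypothesis Ah_gauge : forall l, l != 0 -> dom (Some l) ->
  eq_connection (gauge (r (Some l)) (nabla (perturbed_form N q l))) (nabla (Ah l)).
Hypothesis Ah_1 : eq_connection (nabla (Ah 1)) (nabla 0).

(** One local parameter [l] near 0 for both ends of the Riemann sphere; [par false 0] is the point
    at infinity. *)
Definition par b (l : C) : P1 R := if b then Some l else P1inv (Some l).
Definition dom_par b : set C := [set l | dom (par b l)].
Definition r_par b (l : C) : S -> End := r (par b l).
Definition Ah_par i b (l : C) : S -> End := coef b (Ah (if b then l else l^-1)) i.

Lemma par_opp b l : par b (- l) = P1opp (par b l).
Proof. by case: b => //=; rewrite oppr_eq0; case: eqP => //= _; rewrite invrN. Qed.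

Lemma par_neq0 b l : l != 0 -> par b l = Some (if b then l else l^-1).
Proof. by move=> l0; case: b => //=; rewrite (negbTE l0). Qed.

Lemma perturbed_coef b l i x : coef b (perturbed_form N q l) i x =
  family_form (fun b => coef b N i) (fun b => coef b q i) b (if b then l else l^-1) x.
Proof.
rewrite /coef; have -> : perturbed_form N q l i x =
  (- (N i x).1 + l *: (N i x).1 + l^-1 *: 0 + (l ^+ 2 - 1) *: (q i x).1 + (l ^- 2 - 1) *: 0,
   - (N i x).2 + l *: 0 + l^-1 *: (N i x).2 + (l ^+ 2 - 1) *: 0 + (l ^- 2 - 1) *: (q i x).2) by [].
by case: b; rewrite /family_form /= !scaler0 ?addr0 // exprVn.
Qed.

Lemma Ah_coef b l i x : l != 0 -> dom (Some l) -> rs_dom i x ->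
  coef b (Ah l) i x = gauge_coef i b (r (Some l))
    (family_form (fun b => coef b N i) (fun b => coef b q i) b (if b then l else l^-1)) x.
Proof.
move=> l0 dl dx.
rewrite (gauge_connection b openT I dx (dg_smooth dg dl) (fun y => dg_orthogonal dg y dl) (Ah_gauge l0 dl)).
by rewrite /gauge_coef perturbed_coef.
Qed.

Let near_b b : exists Om : set C, [/\ open Om, Om 0, forall l, Om l -> dom (par b l) &
  mx_hol_family Om setT (fun l => r (par b l))].
Proof. by case: b; [exact: dg_near0 dg | exact: dg_nearoo dg]. Qed.

Let P := oproj V.

Lemma dressing_chart_exists i : dressing_chart i P (fun b => coef b N i) (fun b => coef b q i)
  dom_par r_par (Ah_par i).
Proof.
have wf := @willmore_frame_exists _ _ _ _ _ _ cw sp i.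
have sub : rs_dom i `<=` setT `&` rs_dom i by move=> x dx.
have r_orth b l x : dom_par b l -> orthogonal_mx (r_par b l x).
  by move=> dl; exact: (dg_orthogonal dg x dl).
have inv0 (l : C) : l != 0 -> l^-1 != 0 by rewrite invr_eq0.
have if0 (b : bool) (l : C) : l != 0 -> (if b then l else l^-1) != 0 by case: b => //; exact: inv0.
split.
- exact: willmore_csplit cw sp i.
- by move=> b; exact: willmore_Q_sm cw i b.
- by move=> b x /wf[U [sg [Ux [cf _ _ _ Q_in _ _]]]]; exact: (Q_skew cf Q_in b Ux).
- by move=> b x /wf[U [sg [Ux [cf oP _ _ Q_in _ _]]]]; exact: (QP cf oP Q_in b Ux).
- move=> b; have [Om [oO O0 Od _]] := near_b b.
  by apply: filterS (open_nbhs_nbhs (conj oO O0)) => l /Od.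
- by move=> b l; rewrite /dom_par /= par_opp; exact: dg_dom_opp dg _.
- move=> b l dl; have /mx_smooth_sm/(_ i) := dg_smooth dg dl; exact: mxsm_sub.
- by move=> b l x dl _; exact: r_orth.
- by move=> b x dx; have [Om [oO O0 Od h]] := near_b b; exact: (hol_family_der h O0).
- by move=> b c x dx; have [Om [oO O0 Od h]] := near_b b; exact: (@hol_family_der1 Om setT _ _ (fun l => r (par b l)) 0 x i c h O0 I dx).
- move=> b c l m x dl dm dx; apply: mulmx_ext => w.
  have oP := willmore_oproj cw x.
  have refl u : (2 *: P x - 1%:M) *m u = reflection (V x) u.
    rewrite (oproj_reflection oP) mulmxBl mul1mx -scalemxAl; move: (P x *m u) => v.
    by rewrite opprB addrA -mulr2n scaler_nat.
  have := dg_twist dg x w dl dm.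
  rewrite -!par_opp (orth_inv (r_orth b l x dl)) (orth_inv (r_orth c m x dm)) -!refl.
  by rewrite -!mulmxA.
- move=> b l l0; apply: (mxsm_sub sub); apply: is_form_sm; apply: Ah_form; exact: if0.
- move=> b l x l0 dx; have [h1 h2] := Ah_hol i; case: b; first exact: (hol_family_der h1).
  move=> a c.
  have d := @hol_family_der _ (rs_dom i) _ _ (fun l p => (Ah l i p).2) l^-1 x h2 (inv0 _ l0) dx a c.
  have := @derivable_inv R (fun m => (Ah m i x).2 a c) l l0 d.
  by rewrite /Ah_par /coef.
- move=> b l x l0 dl dx.
  have dl' : dom (Some (if b then l else l^-1)) by rewrite -(par_neq0 b l0).
  rewrite /Ah_par (Ah_coef b (if0 b l l0) dl' dx) /r_par (par_neq0 b l0).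
  have -> : (if b then (if b then l else l^-1) else (if b then l else l^-1)^-1) = l.
    by case: (b); rewrite ?invrK.
  by [].
- move=> b l x l0 dl dx.
  have dl' : dom (Some (if ~~ b then l else l^-1)) by rewrite -(par_neq0 (~~ b) l0).
  have e : (if b then l^-1 else l^-1^-1) = (if ~~ b then l else l^-1).
    by case: (b); rewrite ?invrK.
  rewrite /Ah_par e (Ah_coef b (if0 (~~ b) l l0) dl' dx) /r_par (par_neq0 (~~ b) l0).
  have -> : (if b then (if ~~ b then l else l^-1) else (if ~~ b then l else l^-1)^-1) = l^-1.
    by case: (b).
  by [].
- move=> b x dx; rewrite /Ah_par.
  have -> : (if b then 1 else 1^-1) = 1 :> C by case: b; rewrite ?invr1.
  apply: mulmx_ext => w; rewrite mul0mx.
  have w_sm := cst_smooth w.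
  have := congr1 (fun z => if b then z.1 else z.2) (Ah_1 openT w_sm I dx).
  rewrite -/(coef b (nabla (Ah 1) (fun=> w)) i x) -/(coef b (nabla 0 (fun=> w)) i x).
  rewrite !nabla_coef mcd_cst !add0r => ->.
  by case: b; rewrite mul0mx.
- move=> x l /wf[U [sg [Ux [cf oP cs Qs Q_in dQ EL]]]] l0.
  have := local_flat cf oP cs Qs Q_in dQ EL Ux l0.
  have -> : l ^- 2 = l^-1 ^+ 2 by rewrite exprVn.
  by [].
Qed.

End DressingChart.

(** * The bundles Lambda^{1,0} and Lambda^{0,1} *)

Section TangentFrames.
Variables (R : realType) (S : riemannSurface R) (n : nat).
Local Notation C := (Cplx R).
Local Notation vec := 'cV[C]_(n.+2).
Local Notation End := 'M[C]_(n.+2).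

Lemma wf_sub i U U' (L : S -> {vspace vec}) sg P N Q : open U' -> U' `<=` U ->
  willmore_frame i U L sg P N Q -> willmore_frame i U' L sg P N Q.
Proof.
move=> oU' sub [cf oP cs Qs Qi dQ EL]; split.
- case: cf => oU Ud ssm sr sn s0 si sh sL sLam sLam1; split.
  + exact: oU'.
  + by move=> x /sub; exact: Ud.
  + exact: mxsm_sub sub ssm.
  + by move=> x /sub; exact: sr.
  + by move=> x /sub; exact: sn.
  + by move=> x /sub; exact: s0.
  + by move=> b x /sub; exact: si.
  + by move=> x /sub; exact: sh.
  + by move=> x /sub; exact: sL.
  + by move=> b x /sub; exact: sLam.
  + by move=> x /sub; exact: sLam1.
- by move=> x /sub; exact: oP.
- exact: csplit_sub sub cs.
- by move=> b; exact: mxsm_sub sub (Qs b).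
- by move=> b x /sub; exact: Qi.
- by move=> x /sub; exact: dQ.
- by move=> x /sub; exact: EL.
Qed.

Lemma T4_dim i U (L : S -> {vspace vec}) sg x : cframe i U L sg -> U x -> \dim (T4 i sg x) = 4.
Proof.
move=> cf; have h0 y : U y -> lip (mcd true i sg y) (mcd false i sg y) != 0.
  by move=> Uy; rewrite gt_eqF // (cf_h cf Uy).
exact: (dim_span4 (cf_open cf) (@cf_dom _ _ _ _ _ _ _ cf) (cf_sm cf) (cf_real cf) (cf_null cf)
  (cf_neq0 cf) (@cf_iso _ _ _ _ _ _ _ cf true) h0).
Qed.

Lemma T2_dim b i (sg : S -> vec) x : \dim (T3 i sg x) = 3 -> (2 <= \dim (T2 b i sg x))%N.
Proof.
move=> d3; have sub : (T3 i sg x <= T2 b i sg x + <[mcd (~~ b) i sg x]>)%VS.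
  apply/span_subvP => v; rewrite !inE => /or3P[]/eqP ->.
  - by apply: (subvP (addvSl _ _)); apply: memv_span; rewrite inE eqxx.
  - case: b; last by apply: (subvP (addvSr _ _)); exact: memv_line.
    by apply: (subvP (addvSl _ _)); apply: memv_span; rewrite !inE eqxx orbT.
  - case: b; first by apply: (subvP (addvSr _ _)); exact: memv_line.
    by apply: (subvP (addvSl _ _)); apply: memv_span; rewrite !inE eqxx orbT.
have := leq_trans (dimvS sub) (dimv_add_leqif _ _); rewrite d3 dim_vline.
by case: (_ == 0); rewrite ?addn0 ?addn1 // => /ltnW.
Qed.

Variables (i : rs_idx S) (U : set S) (L : S -> {vspace vec}) (sg : S -> vec).
Variables (P : S -> End) (N Q : bool -> S -> End).
Hypothesis wf : willmore_frame i U L sg P N Q.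
Let cf := wf_cf wf.
Let oP := wf_oproj wf.
Let cs := wf_cs wf.
Let oU := cf_open cf.
Let Ud : U `<=` rs_dom i := @cf_dom _ _ _ _ _ _ _ cf.
Local Notation s b := (mcd b i sg).

Let sg_s b x (Ux : U x) : lip (sg x) (s b x) = 0 := lip_sg_s oU Ud (cf_sm cf) (cf_null cf) b Ux.

Lemma T2_isotropic b x u v : U x -> u \in T2 b i sg x -> v \in T2 b i sg x -> lip u v = 0.
Proof.
move=> Ux /span2P[a [c ->]] /span2P[a' [c' ->]].
rewrite !ipDl !ipZl !ipDr !ipZr (cf_null cf Ux) (cf_iso cf b Ux) (sg_s b Ux).
by rewrite [lip (s b x) _]ipC (sg_s b Ux) !(mulr0, addr0).
Qed.

Lemma T2_proj b x v : U x -> v \in T2 b i sg x -> P x *m v = v.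
Proof.
move=> Ux Tv; have [_ _] := oP Ux; apply.
have /subvP : (T2 b i sg x <= T4 i sg x)%VS; last by apply.
by apply/sub_span => w; rewrite !inE; case: b {Tv} => /orP[]/eqP ->; rewrite eqxx ?orbT.
Qed.

Lemma T2_kill b x v : U x -> v \in T2 (~~ b) i sg x -> N b x *m v = 0 /\ Q b x *m v = 0.
Proof.
move=> Ux /span2P[a [c ->]]; rewrite !mulmxDr -!scalemxAr.
rewrite (N_sg cf oP cs b Ux) (N_s cf oP cs b Ux) (Q_sg cf (wf_Q_in wf) b Ux).
by rewrite (Q_s cf oP cs (wf_Q_sm wf) (wf_Q_in wf) (wf_dQ wf) b Ux) !scaler0 addr0.
Qed.

(** The result lies in [V], so by [T2_char] it only has to be orthogonal to [sg] and [s b]. This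
    follows by differentiating [lip (sg y) (X y) = 0] and [lip (s b y) (X y) = 0], since the second
    derivative of [sg] in direction [b] is orthogonal to the isotropic plane. *)
Lemma T2_section b (X : S -> vec) x : mxsm i U X -> (forall y, U y -> X y \in T2 b i sg y) -> U x ->
  mcd b i X x - N b x *m X x - Q b x *m X x \in T2 b i sg x.
Proof.
move=> hX TX Ux.
have PX y : U y -> P y *m X y = X y by move=> Uy; exact: T2_proj Uy (TX y Uy).
have e := cs_proj oU Ud cs b hX PX Ux.
have -> : mcd b i X x - N b x *m X x - Q b x *m X x = P x *m mcd b i X x - Q b x *m X x.
  by rewrite {1}e; move: (N b x *m _) (P x *m _) (Q b x *m _) => t1 t2 t3; mx_ring.
have [qp pq] := QP cf oP (wf_Q_in wf) b Ux.
have [aP hP _] := oP Ux.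
have s_sm := mxsm_cd oU Ud b (cf_sm cf).
have Pself v : v \in T2 b i sg x -> P x *m v = v by exact: T2_proj.
have sgT : sg x \in T2 b i sg x by apply: memv_span; rewrite inE eqxx.
have sT : s b x \in T2 b i sg x by apply: memv_span; rewrite !inE eqxx orbT.
have X0 v : v \in T2 b i sg x -> lip v (X x) = 0 by move=> Tv; exact: T2_isotropic Ux Tv (TX x Ux).
have ortho v : P x *m v = v -> lip v (mcd b i X x) = 0 -> lip (Q b x *m v) (X x) = 0 ->
    lip v (P x *m mcd b i X x - Q b x *m X x) = 0.
  move=> Pv e1 e2; rewrite ipBr -{1}aP -ip_adj Pv e1 ipC ip_adj.
  by rewrite (Q_skew cf (wf_Q_in wf) b Ux) mulNmx ipNr ipC e2 oppr0 subr0.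
apply: (T2_char cf oP Ux).
- by rewrite -pq -mulmxA -mulmxBr; exact: hP.
- apply: ortho; [exact: Pself | | by rewrite (Q_sg cf (wf_Q_in wf) b Ux) ip0l].
  have z y : U y -> lip (sg y) (X y) = 0.
    by move=> Uy; apply: (T2_isotropic Uy) (TX y Uy); apply: memv_span; rewrite inE eqxx.
  have := cd_eq0 oU Ud b z Ux.
  by rewrite (cd_lip oU Ud b (cf_sm cf) hX Ux) X0 // add0r.
- apply: ortho; [exact: Pself | | ].
    have z y : U y -> lip (s b y) (X y) = 0.
      by move=> Uy; apply: (T2_isotropic Uy) (TX y Uy); apply: memv_span; rewrite !inE eqxx orbT.
    have := cd_eq0 oU Ud b z Ux; rewrite (cd_lip oU Ud b s_sm hX Ux).
    suff -> : lip (mcd b i (s b) x) (X x) = 0 by rewrite add0r.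
    have k1 := lip_sg_sbb cf b Ux; have k2 := lip_s_sbb cf b Ux; rewrite ipC in k1; rewrite ipC in k2.
    move: (mcd b i (s b) x) k1 k2 => Y k1 k2; have /span2P[a [c ->]] := TX x Ux.
    by rewrite ipDr !ipZr k1 k2 !mulr0 addr0.
  have [_ [c [_ ->]]] := Q_vals cf (wf_Q_in wf) b Ux.
  by rewrite ipZl X0 // mulr0.
Qed.

End TangentFrames.

(** * The dressed line and its central sphere congruence *)

Section HatSurface.
Variables (R : realType) (S : riemannSurface R) (n : nat).
Local Notation C := (Cplx R).
Local Notation vec := 'cV[C]_(n.+2).
Local Notation End := 'M[C]_(n.+2).
Variables (L : S -> {vspace vec}) (q N : form1 S n.+2 n.+2).
Variables (dom : set (P1 R)) (r : P1 R -> S -> End).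
Let V := central_sphere L.
Hypotheses (cw : constrained_Willmore setT L q) (sp : splitting setT V N).
Hypothesis dg : dressing_gauge V (perturbed_form N q) dom r.
Variable Ah : C -> form1 S n.+2 n.+2.
Hypothesis Ah_form : forall l, l != 0 -> is_form setT (Ah l).
Hypothesis Ah_hol : forall i, let Cx := [set l : C | l != 0] in
  mx_hol_family Cx (rs_dom i) (fun l p => (Ah l i p).1) /\
  mx_hol_family Cx (rs_dom i) (fun l p => (Ah l i p).2).
Hypothesis Ah_gauge : forall l, l != 0 -> dom (Some l) ->
  eq_connection (gauge (r (Some l)) (nabla (perturbed_form N q l))) (nabla (Ah l)).
Hypothesis Ah_1 : eq_connection (nabla (Ah 1)) (nabla 0).

Let P := oproj V.
Let dc i : dressing_chart i P (fun b => coef b N i) (fun b => coef b q i)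
    (dom_par dom) (r_par r) (Ah_par Ah i) :=
  dressing_chart_exists cw sp dg Ah_form Ah_hol Ah_gauge Ah_1 i.
Let wf i p (dp : rs_dom i p) := willmore_frame_exists cw sp dp.

Local Notation R0 b := (r_par r b 0).
Local Notation hN b i := (hatN (Ah_par Ah i) b).
Local Notation hQ b i := (hatQ (fun c => coef c q i) (r_par r) b).
Local Notation hP := (hatP P (r_par r)).

Let R_orth b x : orthogonal_mx (R0 b x).
Proof.
have [i di] := rs_cover x.
have := dc_rr_orth (dc i); apply; last exact: di.
exact: nbhs_singleton (dc_dm_near (dc i) b).
Qed.

Definition dressed b x : {vspace vec} := mx_image (R0 b x) (Lam b L x).

Let mem_dressed b x v : (v \in dressed b x) = (ladj (R0 b x) *m v \in Lam b L x).
Proof. exact: mx_imageP. Qed.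

Let R_pull b x (v : vec) : R0 b x *m (ladj (R0 b x) *m v) = v.
Proof. by rewrite mulmxA (orth_adjr (R_orth b x)) mul1mx. Qed.

Lemma dressed_isotropic b x u v : u \in dressed b x -> v \in dressed b x -> lip u v = 0.
Proof.
rewrite !mem_dressed; have [i di] := rs_cover x; have [U [sg [Ux w]]] := wf di.
rewrite (cf_Lam (wf_cf w) b Ux) => Tu Tv.
by rewrite -(R_pull b x u) -(R_pull b x v) (orth_ip _ _ (R_orth b x)) (T2_isotropic w Ux Tu Tv).
Qed.

Lemma dressed_proj b x v : v \in dressed b x -> hP x *m v = v.
Proof.
rewrite mem_dressed; have [i di] := rs_cover x; have [U [sg [Ux w]]] := wf di.
rewrite (cf_Lam (wf_cf w) b Ux) => Tv.
rewrite (hatPE (dc i) b di) -(mulmxA _ (ladj _)) -(mulmxA (R0 b x) (P x)).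
by rewrite (T2_proj w Ux Tv) R_pull.
Qed.

Lemma dressed_kill b i x v : rs_dom i x -> v \in dressed (~~ b) x ->
  hN b i x *m v = 0 /\ hQ b i x *m v = 0.
Proof.
move=> di; rewrite mem_dressed; have [U [sg [Ux w]]] := wf di.
rewrite (cf_Lam (wf_cf w) (~~ b) Ux) => Tv; have [Nv Qv] := T2_kill w Ux Tv.
rewrite -(R_pull (~~ b) x v); split.
  exact: (hatN_kill (dc i) di (T2_proj w Ux Tv) Nv Qv).
exact: (hatQ_kill (dc i) di Qv).
Qed.

(** Membership in the opposite dressed bundle makes [hatN] and [hatQ] kill [X], so its derivative
    can be pulled back by [R0 b]. Membership in [dressed b] makes the pullback of [X] a section of
    [Lam b L], to which [T2_section] applies. *)
Lemma dressed_deriv b i (O : set S) (X : S -> vec) x : open O -> O `<=` rs_dom i -> mxsm i O X ->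
  (forall y c, O y -> X y \in dressed c y) -> O x -> mcd b i X x \in dressed b x.
Proof.
move=> oO Od hX DX Ox; have dx := Od x Ox; have [U [sg [Ux w]]] := wf dx.
have oU := cf_open (wf_cf w).
have oUO : open (U `&` O) by exact: openI.
have subU : U `&` O `<=` U by move=> y [].
have subO : U `&` O `<=` O by move=> y [].
have UOd : U `&` O `<=` rs_dom i by move=> y [_ /Od].
have w' := wf_sub oUO subU w; have UOx : (U `&` O) x by [].
have hX' := mxsm_sub subO hX.
have R_sm : mxsm i (U `&` O) (R0 b).
  by apply: mxsm_sub UOd _; apply: (dc_rr_sm (dc i)); exact: nbhs_singleton (dc_dm_near (dc i) b).
have [NX QX] := dressed_kill (b := b) dx (DX x (~~ b) Ox).
rewrite mem_dressed (hat_pullback (dc i) oUO UOd UOx hX' NX QX).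
rewrite (cf_Lam (wf_cf w) b Ux); apply: (T2_section w') UOx.
  exact: (mxsmM oUO UOd (mxsm_ladj oUO UOd R_sm) hX').
move=> y [Uy Oy]; rewrite -(cf_Lam (wf_cf w) b Uy) -mem_dressed; exact: DX.
Qed.

Definition dressed_line p : {vspace vec} := (dressed true p :&: dressed false p)%VS.

Lemma hat_lift_deriv b i O X x : open O -> is_lift O dressed_line X -> O x -> rs_dom i x ->
  mcd b i X x \in dressed b x.
Proof.
move=> oO lX Ox dx.
have Ud : O `&` rs_dom i `<=` rs_dom i by move=> y [].
have Ux : (O `&` rs_dom i) x by [].
apply: (dressed_deriv b (open_chart i oO) Ud (is_lift_sm i lX) _ Ux) => y c [Oy _].
 have [_ /(_ y Oy)[_ _ _ e]] := lX.
have : X y \in dressed_line y by rewrite e memv_line.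
by rewrite memv_cap => /andP[]; case: c.
Qed.

Lemma hat_lift_mem b O X x : is_lift O dressed_line X -> O x -> X x \in dressed b x.
Proof.
move=> [_ /(_ x)] h Ox; have [_ _ _ e] := h Ox.
have : X x \in dressed_line x by rewrite e memv_line.
by rewrite memv_cap => /andP[]; case: b.
Qed.

Lemma hat_T2_sub b i O X x : open O -> is_lift O dressed_line X -> O x -> rs_dom i x ->
  (T2 b i X x <= dressed b x)%VS.
Proof.
move=> oO lX Ox dx; apply/span_subvP => v; rewrite !inE => /orP[]/eqP ->.
  exact: hat_lift_mem lX Ox.
exact: hat_lift_deriv oO lX Ox dx.
Qed.

Let W := [set p | immerses_at dressed_line p].

(** Without a lift, [lift_near] is the zero section, whose span has rank 0 instead of 3. *)
Lemma hat_has_lift p : W p -> exists O X, [/\ open O, O p & is_lift O dressed_line X].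
Proof.
move=> Wp; apply/not_existsP => no.
have e : lift_near dressed_line p = fun=> 0.
  rewrite /lift_near; case: xgetP => // X _ [O [oO Op lX]]; case: (no O); by exists X.
move: Wp; rewrite /W /= /immerses_at /Lam1 e mcdzE mcdzbE !mcd_cst => d3.
have : (<<[:: 0%R : vec; 0%R; 0%R]>> <= 0)%VS.
  by apply/span_subvP => v; rewrite !inE => /or3P[]/eqP ->; exact: mem0v.
by move=> /dimvS; rewrite d3 dimv0.
Qed.

(** For a lift with isotropic derivative, rank 3 means that the continuous function
    [lip (mcd true i X) (mcd false i X)] does not vanish. Isotropy is therefore used on a whole
    neighbourhood, and comes from [dressed] rather than from conformality on [W]. *)
Lemma hat_open : open W.
Proof.
rewrite openE => p Wp; have [O [X [oO Op lX]]] := hat_has_lift Wp.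
have [i di] := rs_cover p.
have oU := open_chart i oO; have Ud : O `&` rs_dom i `<=` rs_dom i by move=> y [].
have Up : (O `&` rs_dom i) p by [].
have Xsm := is_lift_sm i lX; have [_ lX'] := lX.
have Xr y : (O `&` rs_dom i) y -> conjv (X y) = X y by move=> [/lX'[]].
have Xn y : (O `&` rs_dom i) y -> lip (X y) (X y) = 0 by move=> [/lX'[_ _]]; rewrite lipE.
have X0 y : (O `&` rs_dom i) y -> X y != 0 by move=> [/lX'[]].
have Xi y : (O `&` rs_dom i) y -> lip (mcd true i X y) (mcd true i X y) = 0.
  move=> [Oy dy]; have T := hat_lift_deriv true oO lX Oy dy.
  exact: (dressed_isotropic T T).
have d3 : \dim (T3 i X p) = 3 by have [_ <-] := LamE oO lX Op di.
have hp0 : lip (mcd true i X p) (mcd false i X p) != 0.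
  apply/eqP => h0; have [_ /(_ h0)] := h_pos oU Ud Xsm Xr Xn X0 Xi Up.
  by rewrite -/(T3 i X p) d3.
have hc : {for p, continuous (fun x => lip (mcd true i X x) (mcd false i X x))}.
  exact: (sm_cont (h_sm oU Ud Xsm) Up).
have [U' [oU' U'p sub h0]] := nonzero_nbhd oU Up hc hp0.
apply: filterS (open_nbhs_nbhs (conj oU' U'p)) => x U'x; have [Ox dx] := sub x U'x.
rewrite /W /= /immerses_at; have [_ ->] := LamE oO lX Ox dx.
exact: (h_dim oU Ud Xsm Xr Xn X0 Xi (sub x U'x) (h0 x U'x)).
Qed.

Lemma hat_conformal : conformal_immersion W dressed_line.
Proof.
split=> [p Wp|p Wp]; have [O [X [oO Op lX]]] := hat_has_lift Wp.
  by exists X, O.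
split=> // u v; have [i di] := rs_cover p; have [/(_ true) e _] := LamE oO lX Op di.
rewrite /= in e; rewrite e => /(subvP (hat_T2_sub true oO lX Op di)) Tu.
move=> /(subvP (hat_T2_sub true oO lX Op di)) Tv.
by rewrite -lipE; exact: dressed_isotropic Tu Tv.
Qed.

Lemma hat_oproj x : is_oproj (mx_image (R0 true x) (V x)) (hP x).
Proof.
have og := R_orth true x; have [aP hPV PV] := willmore_oproj cw x; split.
- by rewrite ladj_sandwich aP.
- by move=> w; rewrite -!mulmxA; apply: mem_mx_image; exact: hPV.
- move=> v; rewrite (mx_imageP _ _ og) => Vv.
  by rewrite -(mulmxA _ (ladj _)) -(mulmxA _ (P x)) (PV _ Vv) R_pull.
Qed.

Let R_csplit i := hat_csplit (dc i).

(** Both sides have rank 4, so an inclusion is enough. The mixed second derivative of the lift stays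
    in the dressed bundle because [hatN false] kills the (1,0)-derivative, a section of
    [dressed true]. *)
Lemma hat_sphere p : W p -> central_sphere dressed_line p = mx_image (R0 true p) (V p).
Proof.
move=> Wp; have [O [X [oO Op lX]]] := hat_has_lift Wp; have [i di] := rs_cover p.
have oP := hat_oproj p.
rewrite (central_sphereE hat_open hat_conformal oO lX Wp Op di).
have cfh := conf_frame i hat_open hat_conformal oO lX.
have [U [sg [Up w]]] := wf di.
have dV : \dim (V p) = 4.
  rewrite -(T4_dim (wf_cf w) Up); congr (\dim _); apply/vspaceP => v.
  by rewrite (oproj_mem (willmore_oproj cw p)) (oproj_mem (wf_oproj w Up)).
apply/eqP; rewrite eqEdim (dim_mx_image _ (R_orth true p)) dV.
have Wp' : (W `&` O `&` rs_dom i) p by [].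
rewrite (T4_dim cfh Wp') leqnn andbT.
have oU := open_chart i oO; have Ud : O `&` rs_dom i `<=` rs_dom i by move=> y [].
have Up' : (O `&` rs_dom i) p by [].
have hXb b y : (O `&` rs_dom i) y -> mcd b i X y \in dressed b y.
  by move=> [Oy dy]; exact: hat_lift_deriv oO lX Oy dy.
have Xsm := is_lift_sm i lX.
apply/span_subvP => v; rewrite (oproj_mem oP) !inE => /or4P[]/eqP ->; apply/eqP.
- exact: (dressed_proj (hat_lift_mem true lX Op)).
- exact: (dressed_proj (hXb true p Up')).
- exact: (dressed_proj (hXb false p Up')).
have hY := mxsm_cd oU Ud true Xsm.
have PY y : (O `&` rs_dom i) y -> hP y *m mcd true i X y = mcd true i X y.
  by move=> Uy; exact: dressed_proj (hXb true y Uy).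
have := cs_proj oU Ud (csplit_sub Ud (R_csplit i)) false hY PY Up'.
have [-> _] := dressed_kill (b := false) di (hXb true p Up').
by rewrite add0r => e; rewrite -e.
Qed.

(** Where the lift immerses, [T2 (~~ b)] has rank 2 and fills [dressed (~~ b)], the image of
    [Lam (~~ b)]. The second exterior power of a plane is a line, so the image of the old wedge is a
    multiple of the new one. *)
Lemma hatQ_wedge b i O X x : open O -> is_lift O dressed_line X -> O x -> rs_dom i x -> W x ->
  exists k, hQ b i x = k *: lwedge (X x) (mcd (~~ b) i X x).
Proof.
move=> oO lX Ox dx Wx; have [U [sg [Ux w]]] := wf dx.
have [be e] := Q_wedge (wf_cf w) (wf_oproj w) (wf_cs w) (wf_Q_sm w) (wf_Q_in w) (wf_dQ w) b Ux.
rewrite /hatQ e -scalemxAr -scalemxAl (wedge_orth _ _ (R_orth (~~ b) x)).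
have d3 : \dim (T3 i X x) = 3 by have [_ <-] := LamE oO lX Ox dx.
have eT : T2 (~~ b) i X x = dressed (~~ b) x.
  apply/eqP; rewrite eqEdim (hat_T2_sub (~~ b) oO lX Ox dx) /=.
  apply: leq_trans (T2_dim (~~ b) d3).
  by rewrite (dim_mx_image _ (R_orth (~~ b) x)) (cf_Lam (wf_cf w) (~~ b) Ux) dim_span.
have mem v : v \in T2 (~~ b) i sg x -> R0 (~~ b) x *m v \in T2 (~~ b) i X x.
  by rewrite eT -(cf_Lam (wf_cf w) (~~ b) Ux) => h; exact: mem_mx_image.
have /span2P[a [c ->]] : R0 (~~ b) x *m sg x \in T2 (~~ b) i X x.
  by apply: mem; apply: memv_span; rewrite inE eqxx.
have /span2P[a' [c' ->]] : R0 (~~ b) x *m mcd (~~ b) i sg x \in T2 (~~ b) i X x.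
  by apply: mem; apply: memv_span; rewrite !inE eqxx orbT.
exists (be * (a * c' - c * a')).
rewrite !wedgeDl !wedgeDr !wedgeZl !wedgeZr !wedge_self [lwedge (mcd _ _ _ _) _]wedgeC.
by move: (lwedge _ _) => Z; mx_ring.
Qed.

Let hat_comm i x : W x -> rs_dom i x -> lie (hQ true i x) (hQ false i x) = 0.
Proof.
move=> Wx dx; have [O [X [oO Ox lX]]] := hat_has_lift Wx.
have [k ->] := hatQ_wedge true oO lX Ox dx Wx; have [k' ->] := hatQ_wedge false oO lX Ox dx Wx.
have iso b v : v \in dressed b x -> lip (X x) v = 0.
  exact: dressed_isotropic (hat_lift_mem b lX Ox).
rewrite lieZl lieZr wedge_comm ?scaler0 //.
- exact: iso true _ (hat_lift_mem true lX Ox).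
- exact: iso false _ (hat_lift_deriv false oO lX Ox dx).
- exact: iso true _ (hat_lift_deriv true oO lX Ox dx).
Qed.

Let hat_mem_wedge b i x : W x -> rs_dom i x -> hQ b i x \in wedge_sp (dressed_line x) (Lam1 dressed_line x).
Proof.
move=> Wx dx; have [O [X [oO Ox lX]]] := hat_has_lift Wx.
have [k ->] := hatQ_wedge b oO lX Ox dx Wx; apply: memvZ; apply: mem_wedge_sp.
  by have [_ /(_ x Ox)[_ _ _ ->]] := lX; exact: memv_line.
have [_ ->] := LamE oO lX Ox dx; apply: memv_span.
by rewrite !inE; case: (b); rewrite eqxx ?orbT.
Qed.

(** At l = -1 the dressed connection is d - 2 Nhat. Reading Nhat off the global family [Ah] gives at
    once its transformation under a change of chart. *)
Definition dressed_N : form1 S n.+2 n.+2 := - 2^-1 *: Ah (- 1).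
Definition dressed_q : form1 S n.+2 n.+2 :=
  Ad_form (r None) (form10 q) + Ad_form (r (Some 0)) (form01 q).

Lemma r_par0 b : R0 b = r (if b then Some 0 else None).
Proof. by rewrite /r_par /par /=; case: b => //; rewrite eqxx. Qed.

Lemma dressed_N_coef b i : coef b dressed_N i = hN b i.
Proof.
by apply/funext => x; rewrite /hatN /Ah_par; case: b; rewrite ?invrN ?invr1.
Qed.

Lemma dressed_q_coef b i : coef b dressed_q i = hQ b i.
Proof.
apply/funext => x; rewrite /hatQ -(orth_inv (R_orth (~~ b) x)) r_par0.
have -> : coef b dressed_q i x = if b
  then r None x *m (q i x).1 *m invmx (r None x) + r (Some 0) x *m 0 *m invmx (r (Some 0) x)
  else r None x *m 0 *m invmx (r None x) + r (Some 0) x *m (q i x).2 *m invmx (r (Some 0) x).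
  by case: b.
by case: b; rewrite mulmx0 mul0mx ?addr0 ?add0r.
Qed.

Lemma hat_form_in : form_in W (fun x => wedge_sp (dressed_line x) (Lam1 dressed_line x)) dressed_q.
Proof.
by apply/form_in_coef => b i x Wx dx; rewrite dressed_q_coef; exact: hat_mem_wedge.
Qed.

Lemma hat_splitting : splitting W (central_sphere dressed_line) dressed_N.
Proof.
refine (@csplit_splitting _ _ _ W (central_sphere dressed_line) hP dressed_N _ _ _).
- by move=> x Wx; rewrite hat_sphere //; exact: hat_oproj.
- have N1 : (-1 : C) != 0 by rewrite oppr_eq0 oner_neq0.
  have [h1 h2 h3] := Ah_form N1.
  have sc i b : mx_smooth (W `&` rs_dom i) (fun p => coef b dressed_N i p).
    apply/mx_smooth_sm => j.
    have Od := @subIsetr _ (W `&` rs_dom i) (rs_dom j).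
    have oO := open_chart j (open_chart i hat_open).
    have sm : mxsm j (setT `&` rs_dom i `&` rs_dom j) (coef b (Ah (-1)) i).
      by case: b; [exact: (proj1 (mx_smooth_sm _ _) (h1 i) j) | exact: (proj1 (mx_smooth_sm _ _) (h2 i) j)].
    have sub : W `&` rs_dom i `&` rs_dom j `<=` setT `&` rs_dom i `&` rs_dom j by move=> y [[]].
    have := mxsmZ oO Od (sm_cst oO Od (- 2^-1)) (mxsm_sub sub sm).
    by apply: (mxsm_ext oO Od) => y _; case: (b).
  split; [by move=> i; exact: sc i true | by move=> i; exact: sc i false | ].
  move=> i j p _ di dj; have [e1 e2] := h3 i j p I di dj; split.
    by rewrite -[LHS]/(- 2^-1 *: (Ah (-1) i p).1) e1 !scalerA mulrC -!scalerA.
  by rewrite -[LHS]/(- 2^-1 *: (Ah (-1) i p).2) e2 !scalerA mulrC -!scalerA.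
move=> i; have -> : (fun b => coef b dressed_N i) = hatN (Ah_par Ah i).
  by apply/funext => b; exact: dressed_N_coef.
by apply: csplit_sub (R_csplit i) => x [].
Qed.

Lemma hat_equations i x : W x -> rs_dom i x -> cov_d (- dressed_N) dressed_q i x = 0 /\
  cov_d (- dressed_N) (hodge dressed_N) i x = (2 *: wedge_lie dressed_q (hodge dressed_N)) i x.
Proof.
move=> Wx dx; have oD := @rs_open_dom _ _ i; have Dd : rs_dom i `<=` rs_dom i := @subset_refl _ _.
have N_sm b : mxsm i (rs_dom i) (coef b dressed_N i) by rewrite dressed_N_coef; exact: hatN_sm (dc i) b.
have [e1 e2 e3] := hat_laurent (dc i) dx; have uv := hat_comm Wx dx; split.
  rewrite cov_d_coef !dressed_q_coef !dressed_N_coef e1 e2 uv.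
  by move: (lie _ _) (lie _ _) => a b; mx_ring.
by rewrite (cov_d_hodge oD Dd dx N_sm) wedge_hodge !dressed_q_coef !dressed_N_coef e3.
Qed.

Lemma hat_form : is_form W dressed_q /\ real_form W dressed_q.
Proof.
have [_ [[q1 q2 q3] q_real] _ _] := cw.
have tr (g A : End) (z : C) : g *m (z *: A) *m invmx g = z *: (g *m A *m invmx g).
  by rewrite -scalemxAr -scalemxAl.
have cE b i p : coef b dressed_q i p = R0 (~~ b) p *m coef b q i p *m invmx (R0 (~~ b) p).
  by rewrite dressed_q_coef /hatQ (orth_inv (R_orth (~~ b) p)).
have sc i b : mx_smooth (W `&` rs_dom i) (coef b dressed_q i).
  apply/mx_smooth_sm => j.
  have Od := @subIsetr _ (W `&` rs_dom i) (rs_dom j).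
  have oO := open_chart j (open_chart i hat_open).
  have q_sm : mxsm j (setT `&` rs_dom i `&` rs_dom j) (coef b q i).
    by case: b; [exact: (proj1 (mx_smooth_sm _ _) (q1 i) j) | exact: (proj1 (mx_smooth_sm _ _) (q2 i) j)].
  have sub : W `&` rs_dom i `&` rs_dom j `<=` setT `&` rs_dom i `&` rs_dom j by move=> y [[]].
  have R_sm : mxsm j (W `&` rs_dom i `&` rs_dom j) (R0 (~~ b)).
    by apply: (mxsm_sub Od); apply: (dc_rr_sm (dc j)); exact: nbhs_singleton (dc_dm_near (dc j) _).
  rewrite dressed_q_coef.
  exact: (mxsmM oO Od (mxsmM oO Od R_sm (mxsm_sub sub q_sm)) (mxsm_ladj oO Od R_sm)).
split; first split.
- by move=> i; exact: sc i true.
- by move=> i; exact: sc i false.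
- move=> i j p _ di dj; have [e1 e2] := q3 i j p I di dj.
  have sc' b (z : C) : coef b q i p = z *: coef b q j p -> coef b dressed_q i p = z *: coef b dressed_q j p.
    by rewrite (cE b i p) (cE b j p) => ->; exact: tr.
  by split; [exact: sc' true _ e1 | exact: sc' false _ e2].
move=> i p _ di; have c1 := cE true i p; have c2 := cE false i p.
rewrite /coef in c1 c2; rewrite c1 c2 (q_real i p I di) !map_mxM map_invmx !r_par0 /=.
(* Infinity and 0 are exchanged by [P1star], so r(0) is the conjugate of r(oo), and the two
   components of the new multiplier are conjugate. *)
have doo : dom None.
  by have := nbhs_singleton (dc_dm_near (dc i) false); rewrite /dom_par /par /= eqxx.
by have := dg_real dg p doo; rewrite /P1star /P1inv /= => ->.
Qed.

End HatSurface.

Theorem theorem2p13 (R : realType) (Sigma : riemannSurface R) (n : nat)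
    (L : Sigma -> {vspace 'cV[Cplx R]_(n.+2)})
    (q N : form1 Sigma n.+2 n.+2)
    (dom : set (P1 R)) (r : P1 R -> Sigma -> 'M[Cplx R]_(n.+2))
    (V := central_sphere L)
    (r0 := r (Some 0)) (roo := r None)
    (Lhat := fun p => (mx_image (r0 p) (Lam10 L p) :&: mx_image (roo p) (Lam01 L p))%VS)
    (qhat := Ad_form roo (form10 q) + Ad_form r0 (form01 q))
    (W := [set p | immerses_at Lhat p]) :
  constrained_Willmore setT L q ->
  splitting setT V N ->
  dressing_gauge V (perturbed_form N q) dom r ->
  [/\ open W,
      conformal_immersion W Lhat,
      constrained_Willmore W Lhat qhat &
      forall p, W p -> central_sphere Lhat p = mx_image (r0 p) (V p)].
Proof.
move=> cw sp dg; have [Ah [Ah_form Ah_hol Ah_gauge Ah_1]] := dg_extend dg.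
have eL : Lhat = dressed_line L r.
  by apply/funext => p; rewrite /Lhat /dressed_line /dressed !r_par0.
rewrite /W eL.
have oW := hat_open cw sp dg Ah_form Ah_hol Ah_gauge Ah_1.
have cW := hat_conformal cw sp dg Ah_form Ah_hol Ah_gauge Ah_1.
split.
- exact: oW.
- exact: cW.
- split; [exact: cW | exact: (hat_form cw sp dg Ah_form Ah_hol Ah_gauge Ah_1) | | ].
    exact: (hat_form_in cw sp dg Ah_form Ah_hol Ah_gauge Ah_1).
  exists (dressed_N Ah); first exact: (hat_splitting cw sp dg Ah_form Ah_hol Ah_gauge Ah_1).
  by split=> i p Wp dp; have [] := hat_equations cw sp dg Ah_form Ah_hol Ah_gauge Ah_1 Wp dp.
by move=> p Wp; rewrite (hat_sphere cw sp dg Ah_form Ah_hol Ah_gauge Ah_1 Wp) r_par0.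
Qed.
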